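(* Let $\mathbb{T}_{\mathcal C}$ be the projective Fraïssé limit of the family $\mathcal{T}_{\mathcal{C}}$. Then $E(\mathbb{T}_{\mathcal C})$ is transitive, and the topological realization $|\mathbb{T}_{\mathcal C}|$ is a Kelley dendroid (thus smooth) with a dense set of endpoints, such that each point of $|\mathbb{T}_{\mathcal C}|$ is either an endpoint or a ramification point in the classical sense.
   Context: Graphs are pairs $(V,E)$ with $E\subseteq V^2$ reflexive and symmetric; a topological graph has compact zero-dimensional second-countable vertex set and closed edge set. Trees: finite graphs with unique simple paths between distinct vertices; rooted trees have a root $r$ and order $x\le y$ iff the path from $r$ to $y$ contains $x$. Epimorphisms between rooted trees: vertex maps sending edges to edges, surjective on vertices and edges, root to root, order-preserving. Connected: not a union of two nonempty disjoint closed sets with no edges between. Confluent: for each closed connected $Q$ of the target every component $K$ of $f^{-1}(Q)$ has $f(K)=Q$; light: distinct vertices with the same image are never adjacent. Splitting edge map: replace an edge $\langle a,b\rangle$ ($a<b$) by $\langle a,x\rangle,\langle x,b\rangle$ with $x$ new, identity elsewhere, $x\mapsto a$ or $b$; adding edge map: add a new vertex $y$ and an edge $\langle v,y\rangle$, identity elsewhere, $y\mapsto v$. Simple*-confluent epimorphisms are finite compositions of splitting edge maps, adding edge maps and light confluent epimorphisms. $\mathcal T_{\mathcal C}$ is the projective Fraïssé family of rooted trees with at least two vertices and simple*-confluent epimorphisms. Its projective Fraïssé limit $\mathbb T_{\mathcal C}$ is the unique rooted topological graph that is an inverse limit $\varprojlim\{F_n,\alpha_n\}$ of members of $\mathcal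 T_{\mathcal C}$ with bonding maps in the family (edges coordinatewise) such that (i) every $A\in\mathcal T_{\mathcal C}$ is an image of $\mathbb T_{\mathcal C}$ under an admissible epimorphism, and (ii) for admissible $f\colon\mathbb T_{\mathcal C}\to A$ and $g\colon B\to A$ in the family there is admissible $h\colon\mathbb T_{\mathcal C}\to B$ with $f=g\circ h$, admissible meaning of the form $h'\circ\alpha^\infty_m$ with $h'$ in the family. When the edge relation is transitive, the topological realization is the quotient space $V/E$. A dendroid is a hereditarily unicoherent arcwise connected continuum; it is smooth if for some point $p$ the order ($x\le y$ iff every arc from $p$ to $y$ contains $x$) is closed. A continuum $X$ is Kelley if for every subcontinuum $K$, every $p\in K$ and every sequence $p_n\to p$ there are subcontinua $K_n\ni p_n$ converging to $K$ in the Hausdorff metric. An endpoint (classical sense) is a point that is an endpoint of every arc containing it; a ramification point (classical sense) is a point $p$ for which there are three arcs pairwise intersecting exactly in $\{p\}$. *)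

(* Defs.v *)
From HB Require Import structures.
From mathcomp Require Import all_boot all_order all_algebra.
From mathcomp Require Import all_classical all_reals all_analysis.
From mathcomp Require Import Rstruct Rstruct_topology.

Record rtgraph := RTGraph { fv :> finType; fe : rel fv; froot : fv }.

Set Implicit Arguments.
Unset Strict Implicit.
Unset Printing Implicit Defensive.
Import Order.TTheory GRing.Theory Num.Theory.

Definition is_graph (A : rtgraph) := reflexive (fe A) /\ symmetric (fe A).

Definition spath (A : rtgraph) (u v : A) (s : seq A) : bool :=
  [&& path (fe A) u s, uniq (u :: s) & last u s == v].

Definition is_tree (A : rtgraph) :=
  is_graph A /\ forall u v : A, u != v -> exists! s : seq A, spath u v s.

Definition in_TC (A : rtgraph) := is_tree A /\ (1 < #|fv A|)%N.

Definition tle (A : rtgraph) (x y : A) :=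
  forall s : seq A, spath (froot A) y s -> x \in froot A :: s.

Definition epi (A B : rtgraph) (f : A -> B) :=
  [/\ forall x y, fe A x y -> fe B (f x) (f y),
      forall b : B, exists a : A, f a = b,
      forall u v : B, fe B u v -> exists x y : A, [/\ fe A x y, f x = u & f y = v],
      f (froot A) = froot B &
      forall x y : A, tle x y -> tle (f x) (f y)].

(* connectedness of a set of vertices (in a finite, discrete graph every
   set is closed) *)
Definition gconnected (A : rtgraph) (S : {set A}) :=
  forall P1 P2 : {set A}, P1 :|: P2 = S -> P1 :&: P2 = finset.set0 ->
    P1 != finset.set0 -> P2 != finset.set0 ->
    exists x y : A, [/\ x \in P1, y \in P2 & fe A x y].

Definition gcomponent (A : rtgraph) (S K : {set A}) :=
  [/\ K \subset S, K != finset.set0, gconnected K &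
      forall K' : {set A}, K \subset K' -> K' \subset S -> gconnected K' -> K' = K].

Definition confluent (A B : rtgraph) (f : A -> B) :=
  forall Q : {set B}, gconnected Q ->
    forall K : {set A}, gcomponent (f @^-1: Q) K -> f @: K = Q.

Definition light (A B : rtgraph) (f : A -> B) :=
  forall x y : A, x != y -> fe A x y -> f x != f y.

(* splitting edge map: the edge <a,b> (a < b) of B is replaced by
   <a,x>, <x,b> with x new; identity elsewhere; x |-> a or b *)
Definition splitting (A B : rtgraph) (f : A -> B) :=
  exists (x : A) (a b : B),
    [/\ a != b, fe B a b, tle a b & (f x == a) || (f x == b)] /\
    (froot A != x /\ f (froot A) = froot B) /\
    (forall u v : A, u != x -> v != x -> f u = f v -> u = v) /\
    (forall w : B, exists2 u : A, u != x & f u = w) /\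
    (forall u v : A, u != x -> v != x ->
        fe A u v = fe B (f u) (f v) && ([set f u; f v] != [set a; b])) /\
    (forall u : A, u != x -> fe A x u = (f u == a) || (f u == b)).

(* adding edge map: new vertex y and edge <v,y>; identity elsewhere; y |-> v *)
Definition adding (A B : rtgraph) (f : A -> B) :=
  exists (y : A) (v : B),
    f y = v /\
    (froot A != y /\ f (froot A) = froot B) /\
    (forall u w : A, u != y -> w != y -> f u = f w -> u = w) /\
    (forall w : B, exists2 u : A, u != y & f u = w) /\
    (forall u w : A, u != y -> w != y -> fe A u w = fe B (f u) (f w)) /\
    (forall u : A, u != y -> fe A y u = (f u == v)).

Inductive sstar : forall A B : rtgraph, (A -> B) -> Prop :=
| sstar_split (A B : rtgraph) (f : A -> B) :
    in_TC A -> in_TC B -> splitting f -> sstar f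
| sstar_add (A B : rtgraph) (f : A -> B) :
    in_TC A -> in_TC B -> adding f -> sstar f
| sstar_lc (A B : rtgraph) (f : A -> B) :
    in_TC A -> in_TC B -> epi f -> confluent f -> light f -> sstar f
| sstar_comp (A B C : rtgraph) (f : A -> B) (g : B -> C) :
    sstar f -> sstar g -> sstar (g \o f).

Section InvLim.
Variables (F : nat -> rtgraph) (al : forall n, F n.+1 -> F n).

Definition thread (x : forall n, F n) := forall n, al (x n.+1) = x n.

Definition lim_edge (x y : forall n, F n) := forall n, fe (F n) (x n) (y n).

(* open sets of the inverse limit topology (a basic open set is
   determined by one coordinate, since bonding maps determine the
   earlier ones) *)
Definition lim_open (S : (forall n, F n) -> Prop) :=
  forall x, thread x -> S x ->
    exists m, forall y, thread y -> y m = x m -> S y.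

(* (F, al) is an inverse sequence in T_C whose limit satisfies the
   projective Fraisse properties (i) and (ii); admissible maps are
   h' \o alpha^oo_m, i.e. x |-> h' (x m), with h' in the family *)
Definition fraisse_limit :=
  (forall n, sstar (al (n := n))) /\
  (forall A : rtgraph, in_TC A ->
     exists (m : nat) (h : F m -> A), sstar h) /\
  (forall (A B : rtgraph) (m : nat) (f : F m -> A) (g : B -> A),
     sstar f -> sstar g ->
     exists (k : nat) (h : F k -> B),
       sstar h /\ forall x, thread x -> f (x m) = g (h (x k))).
End InvLim.

Local Open Scope classical_set_scope.
Local Open Scope ring_scope.

Section Continua.
Variable X : topologicalType.

Definition metric_for (d : X -> X -> Rdefinitions.R) :=
  (forall x y, d x y = 0 <-> x = y) /\
  (forall x y, d x y = d y x) /\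
  (forall x y z, d x z <= d x y + d y z) /\
  (forall U : set X, open U <->
      forall x, U x -> exists2 e : Rdefinitions.R, 0 < e & forall y, d x y < e -> U y).

Definition continuum :=
  [/\ [set: X] !=set0, compact [set: X], connected [set: X],
      hausdorff_space X & exists d : X -> X -> Rdefinitions.R, metric_for d].

Definition subcontinuum (K : set X) := [/\ K !=set0, closed K & connected K].

Definition I01 : set Rdefinitions.R := [set t : Rdefinitions.R | 0 <= t <= 1].

Definition arc (A : set X) (a b : X) :=
  exists f : Rdefinitions.R -> X,
    [/\ {within I01, continuous f},
        (forall s t, I01 s -> I01 t -> f s = f t -> s = t),
        f @` I01 = A, f 0 = a & f 1 = b].

Definition is_arc (A : set X) := exists a b, arc A a b.

Definition arcwise_connected := forall x y : X, x <> y -> exists A, arc A x y.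

Definition hereditarily_unicoherent :=
  forall K L : set X, subcontinuum K -> subcontinuum L -> connected (K `&` L).

Definition dendroid :=
  [/\ continuum, hereditarily_unicoherent & arcwise_connected].

Definition arc_le (p x y : X) :=
  (y = p -> x = p) /\ (y <> p -> forall A, arc A p y -> A x).

Definition smooth := exists p : X, closed [set z : X * X | arc_le p z.1 z.2].

Definition hausdorff_cvg (d : X -> X -> Rdefinitions.R) (Kn : nat -> set X) (K : set X) :=
  forall e : Rdefinitions.R, 0 < e -> exists N : nat, forall n, (N <= n)%N ->
    (forall x, Kn n x -> exists2 y, K y & d x y < e) /\
    (forall y, K y -> exists2 x, Kn n x & d x y < e).

Definition kelley :=
  exists d : X -> X -> Rdefinitions.R, metric_for d /\
    forall (K : set X) (p : X) (pn : nat -> X),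
      subcontinuum K -> K p -> pn @ \oo --> p ->
      exists Kn : nat -> set X,
        (forall n, subcontinuum (Kn n) /\ Kn n (pn n)) /\ hausdorff_cvg d Kn K.

Definition endpoint (p : X) :=
  forall A a b, arc A a b -> A p -> p = a \/ p = b.

Definition ramification (p : X) :=
  exists A1 A2 A3 : set X, [/\ is_arc A1, is_arc A2 & is_arc A3] /\
    [/\ A1 `&` A2 = [set p], A1 `&` A3 = [set p] & A2 `&` A3 = [set p]].
End Continua.

Definition realization (F : nat -> rtgraph) (al : forall n, F n.+1 -> F n)
    (X : topologicalType) (q : (forall n, F n) -> X) :=
  (forall z : X, exists2 x, thread al x & q x = z) /\
  (forall x y, thread al x -> thread al y -> (q x = q y <-> lim_edge x y)) /\
  (forall U : set X, open U <-> lim_open al (q @^-1` U)).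

(* Main.v *)
(** Every map of the family is described by two local properties: it commutes with the parent
function up to collapsing, and each edge of the target at [f u] lifts to an edge leaving the
fibre component of [u]. Splitting the edge between two thread coordinates shows that an edge of
the limit joins only two points, whence transitivity. Repeatedly tripling a 1-Lipschitz function
on some [F m] and splitting the edges that became too steep yields, in the limit, continuous
real functions on the realization; weighted sums of them give a metric and a function [lam]
strictly increasing along the order, which parametrises the arcs. The smallest subcontinuum
through [q x] and [q y] is the union of the order intervals from the meet of [x] and [y], so
arcs are unique. Kelley's property comes from lifting components along confluent maps. If some
[z] lies strictly above [x], then gluing three copies of the branch of [z] at the first vertex
above [x n], for cofinally many [n], and choosing each time an unused copy, produces two further
branches leaving [z] and each other exactly at [q x]; so a point that is not maximal in the
order is a ramification point, and a maximal one is an endpoint. *)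

(* The limit has no explicit model. It is reached through property (ii) for the identity of some
   [F m]: every [g : B -> F m] of the family receives a map [h : F k -> B] with [g (h (x k)) = x m]
   for all threads [x]. A claim about the limit is thus reduced to one splitting, adding or gluing
   of a finite tree. The obstacle is that meets and first vertices of branches do not commute with
   the bonding maps, which may push them down; coherent threads are extracted from them by
   compactness, with finite coordinates frozen along an ultrafilter. The constant 3 is the number of
   edges into which two splittings cut an edge: each new vertex can lie over the nearer end, so a
   refinement errs by at most 1 against the tripled function, and after rescaling the errors 1/3 +
   1/9 + ... add up to 1/2. A jump of 2 between non-adjacent vertices survives this error. Three
   copies are glued because two may be occupied by branches already present and one must stay
   free. *)
From mathcomp Require Import all_boot all_order all_algebra.
From mathcomp Require Import all_classical all_reals all_analysis.
From mathcomp Require Import Rstruct Rstruct_topology.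
From mathcomp Require Import zify ring lra.
Require Import Defs.

Set Implicit Arguments.
Unset Strict Implicit.
Unset Printing Implicit Defensive.

(** * Finite rooted trees *)

Section ParentFunction.
Variables (T : finType) (r : T) (p : T -> T).
Hypotheses (pr : p r = r) (reach : forall v, fconnect p v r).

Definition padj u v := [|| u == v, u == p v | v == p u].

Definition height v := findex p v r.

Lemma padj_sym : symmetric padj.
Proof.
by move=> u v; rewrite /padj eq_sym; case: (v == u) => //=; rewrite orbC.
Qed.

Lemma padj_refl : reflexive padj.
Proof. by move=> u; rewrite /padj eqxx. Qed.

Lemma parent_padj v : padj (p v) v.
Proof. by rewrite /padj eqxx orbT. Qed.

Lemma height_root : height r = 0.
Proof. exact: findex0. Qed.

Lemma height_parent v : v != r -> height v = (height (p v)).+1.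
Proof. by move=> vr; rewrite /height fconnect_findex // eq_sym. Qed.

Lemma height_eq0 v : (height v == 0) = (v == r).
Proof. exact: findex_eq0. Qed.

Lemma height_iter k v : height (iter k p v) = height v - k.
Proof.
elim: k => [|k IH]; first by rewrite subn0.
rewrite iterS subnS -IH; set w := iter k p v.
have [->|wr] := eqVneq w r; first by rewrite pr height_root.
by rewrite (height_parent wr).
Qed.

Lemma parent_fix v : p v = v -> v = r.
Proof.
move=> pv; apply/eqP; apply: contraT => vr.
by have := height_parent vr; rewrite pv => /n_Sn.
Qed.

Lemma parent_neq v : v != r -> p v != v.
Proof. by apply: contra_neq; exact: parent_fix. Qed.

Lemma ancP u v : reflect (exists k, iter k p v = u) (fconnect p v u).
Proof.
apply: (iffP idP) => [/iter_findex <-|[k <-]]; [by exists (findex p v u)|].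
exact: fconnect_iter.
Qed.

Lemma anc_height u v : fconnect p v u -> height u <= height v.
Proof. by case/ancP=> k <-; rewrite height_iter leq_subr. Qed.

Lemma anc_height_eq u v : fconnect p v u -> height u = height v -> u = v.
Proof.
case/ancP=> [[|k]] //= <-; rewrite -iterS height_iter => h.
have v0 : height v == 0.
  by move: h; case: (height v) => // n; rewrite subSS => /eqP;
     rewrite ltn_eqF // ltnS leq_subr.
by move: v0; rewrite height_eq0 => /eqP ->; elim: k {h} => //= k ->.
Qed.

Lemma anc_anti u v : fconnect p v u -> fconnect p u v -> u = v.
Proof.
move=> vu uv; apply: anc_height_eq => //; apply/eqP.
by rewrite eqn_leq !anc_height.
Qed.

Lemma anc_total u v w : fconnect p w u -> fconnect p w v ->
  fconnect p v u \/ fconnect p u v.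
Proof.
case/ancP=> i <- /ancP[j <-]; case: (leqP i j) => [ij|/ltnW ij].
  by right; rewrite -(subnK ij) iterD fconnect_iter.
by left; rewrite -(subnK ij) iterD fconnect_iter.
Qed.

Lemma anc_root v : fconnect p r v -> v = r.
Proof. by move=> rv; apply: anc_anti (reach v). Qed.

Lemma anc_parent u v : fconnect p v u -> u != v -> fconnect p (p v) u.
Proof. by rewrite fconnect_eqVf eq_sym => /orP[->|]. Qed.

Lemma parent_anc u v : fconnect p (p v) u -> fconnect p v u.
Proof. by move=> h; apply: connect_trans h; exact: fconnect1. Qed.

Lemma child_toward u v : fconnect p v u -> u != v ->
  exists w, [/\ p w = u, w != u, w != r & fconnect p v w].
Proof.
move=> vu uv; have k0 : findex p v u != 0 by rewrite findex_eq0 eq_sym.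
case E : (findex p v u) k0 => [//|k] _.
have pw : p (iter k p v) = u by rewrite -iterS -E iter_findex.
exists (iter k p v).
have wu : iter k p v != u.
  apply/eqP => h; have lt : findex p v u < order p v by exact: findex_max.
  rewrite E in lt; have := findex_iter (ltnW lt).
  by rewrite h E => /esym/n_Sn.
split=> //; last exact: fconnect_iter.
by apply: contra wu => /eqP e; rewrite -pw e pr.
Qed.

Lemma child_uniq w w' v : w != r -> w' != r -> p w = p w' ->
  fconnect p v w -> fconnect p v w' -> w = w'.
Proof.
move=> wr w'r e vw vw'.
have h : height w = height w' by rewrite (height_parent wr) (height_parent w'r) e.
by case: (anc_total vw vw') => /anc_height_eq; [exact|move=> ->].
Qed.

(** The subtree above [g] hangs on the single edge between [g] and [p g]. This cut property,
    extended to paths below, stands in for uniqueness of paths later on. *)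
Lemma exit_subtree g x y : fconnect p x g -> padj x y ->
  fconnect p y g \/ (x = g /\ y = p g).
Proof.
move=> xg /or3P[/eqP <-|/eqP xy|/eqP yx]; first by left.
  by left; apply: parent_anc; rewrite -xy.
have [->|gx] := eqVneq g x; first by right.
by left; rewrite yx; apply: anc_parent.
Qed.

Lemma padj_comparable u v : padj u v -> fconnect p v u \/ fconnect p u v.
Proof.
case/or3P=> /eqP ->; [by left|left|right]; exact: fconnect1.
Qed.

Lemma path_exit g x s : path padj x s -> fconnect p x g ->
  ~~ fconnect p (last x s) g -> g \in x :: s /\ p g \in x :: s.
Proof.
elim: s x => [|y s IH] x /=; first by move=> _ ->.
case/andP=> xy ys xg nl; case: (exit_subtree xg xy) => [yg|[-> ->]].
  by case: (IH _ ys yg nl) => a b; rewrite inE a orbT inE b orbT.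
by rewrite !inE !eqxx orbT.
Qed.

Lemma path_enter g x s : path padj x s -> ~~ fconnect p x g ->
  fconnect p (last x s) g -> g \in s /\ p g \in x :: s.
Proof.
elim: s x => [|y s IH] x /=; first by move=> _ /negP.
case/andP=> xy ys xg yg; have [y1|y1] := boolP (fconnect p y g).
  rewrite padj_sym in xy; case: (exit_subtree y1 xy) => [h|[-> ->]].
    by rewrite h in xg.
  by rewrite !inE !eqxx.
by case: (IH _ ys y1 yg) => a b; rewrite inE a orbT inE b orbT.
Qed.

End ParentFunction.

Definition parent_spec (A : rtgraph) (p : A -> A) :=
  [/\ p (froot A) = froot A, forall v, fconnect p v (froot A) &
      forall u v, fe A u v = padj p u v].

(** The parent of [v] is the first step of its unique simple path to the root. For an edge between
    [u] and [v], either [v] lies on the path of [u], and the edge followed by the rest of that path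
    is again a simple path from [u]; or it does not, and putting the edge in front of the path of
    [u] gives the path of [v]. *)
Lemma tree_parent (A : rtgraph) : is_tree A -> exists p : A -> A, parent_spec p.
Proof.
case=> -[eR eS] eU; set r := froot A.
pose sp v : seq A := xget [::] (fun s => spath v r s).
have spP v : v != r -> spath v r (sp v).
  by move=> /eU[s [hs _]]; rewrite /sp; case: xgetP => [t -> //|/(_ s)].
have spU v s : v != r -> spath v r s -> s = sp v.
  move=> vr hs; have [t [_ tU]] := eU _ _ vr.
  by rewrite -(tU _ hs); apply: tU; exact: spP.
pose p v := if v == r then r else head r (sp v).
have pE v y s : v != r -> spath v r (y :: s) -> p v = y.
  by move=> vr /(spU _ _ vr) e; rewrite /p (negPf vr) -e.
have pr : p r = r by rewrite /p eqxx.
exists p; split=> // [v|u v].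
  have [->//|vr] := eqVneq v r; have := spP _ vr; move: (sp v) => s.
  elim: s v vr => [|y s IH] v vr; first by rewrite /spath /= (negPf vr).
  move=> hs; have pv := pE _ _ _ vr hs; apply: connect_trans (fconnect1 p v) _.
  rewrite pv; have [->//|yr] := eqVneq y r; apply: IH => //.
  by case/and3P: hs => /= /andP[_ h1] /andP[_ h2] h3; apply/and3P.
have pe w : fe A (p w) w.
  have [->|wr] := eqVneq w r; first by rewrite pr.
  have := spP _ wr; case E : (sp w) => [|y s]; first by rewrite /spath /= (negPf wr).
  move=> hs; rewrite (pE _ _ _ wr hs) eS.
  by case/and3P: hs => /= /andP[].
apply/idP/idP => [uv|/or3P[]/eqP ->]; [|exact: eR|exact: pe|by rewrite eS].
rewrite /padj; have [//|nuv /=] := eqVneq u v.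
have edge_root w : w != r -> fe A w r -> p w = r.
  move=> wr e; apply: (pE _ _ [::]) => //.
  by rewrite /spath /= e inE wr eqxx.
have [ur|ur] := eqVneq u r.
  have vr : v != r by rewrite -ur eq_sym.
  by rewrite (edge_root v vr) ?ur ?eqxx // eS -ur.
have [vr|vr] := eqVneq v r; first by rewrite (edge_root u) ?vr ?eqxx ?orbT // -vr.
have := spP _ ur; move: (sp u) => s hs.
have [vs|vs] := boolP (v \in s).
  case/splitPr: vs hs => s1 s2 hs.
  suff -> : p u = v by rewrite eqxx orbT.
  apply: (pE _ _ s2) => //; case/and3P: hs; rewrite cat_path last_cat /= => h1 h2 h3.
  apply/and3P; split=> //=; first by case/and3P: h1 => _ _ ->; rewrite uv.
  move: h2; rewrite cat_uniq mem_cat inE !negb_or => /andP[/andP[_ /andP[-> ->]]].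
  by case/and3P=> _ _ /= /andP[-> ->].
suff -> : p v = u by rewrite eqxx.
apply: (pE _ _ s) => //; case/and3P: hs => h1 h2 h3.
apply/and3P; split=> //; first by rewrite /= eS uv.
by rewrite /= inE eq_sym (negPf nuv) (negPf vs).
Qed.

Section Spec.
Variables (A : rtgraph) (p : A -> A).
Hypothesis pA : parent_spec p.
Implicit Types (u v x y : A) (s : seq A).
Let r := froot A.
Let pr : p r = r. Proof. by case: pA. Qed.
Let reach v : fconnect p v r. Proof. by case: pA. Qed.
Let feE u v : fe A u v = padj p u v. Proof. by case: pA. Qed.

Lemma path_feE x s : path (fe A) x s = path (padj p) x s.
Proof. by apply: eq_path => u v; exact: feE. Qed.

Lemma spath_self u s : spath u u s -> s = [::].
Proof.
case/and3P=> _; case/lastP: s => // s y; rewrite last_rcons cons_uniq mem_rcons inE.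
by case/andP=> /norP[/eqP uy _] _ /eqP e; case: uy.
Qed.

Lemma first_step_up u v y s : spath u v (y :: s) -> u = p y -> fconnect p v y.
Proof.
case/and3P=> /= /andP[_ ys] /andP[us _] /eqP <- uy; apply: contraT => vy.
rewrite path_feE in ys; case: (path_exit ys (connect0 _ _) vy) => _.
by rewrite -uy (negPf us).
Qed.

Lemma first_step_down u v y s : spath u v (y :: s) -> u != p y -> y = p u /\ ~~ fconnect p v u.
Proof.
case/and3P=> /= /andP[uy ys] /andP[us _] /eqP <- npy.
move: uy; rewrite feE => /or3P[/eqP uy|/eqP uy|/eqP yu].
- by rewrite uy mem_head in us.
- by rewrite uy eqxx in npy.
split=> //; apply/negP => h; rewrite path_feE in ys.
have ynu : ~~ fconnect p y u.
  apply/negP => yu'; have e : u = y.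
    by apply: (anc_anti pr reach) => //; rewrite yu; exact: fconnect1.
  by rewrite e mem_head in us.
by have [us' _] := path_enter ys ynu h; rewrite inE us' orbT in us.
Qed.

(** The first step is forced by the position of [v]: it goes to the child of [u] below [v] if [v] is
    above [u], and to the parent of [u] otherwise. *)
Lemma spath_uniq s s' u v : spath u v s -> spath u v s' -> s = s'.
Proof.
elim: s s' u => [|y s IH] [|y' s'] u hs hs' //.
- have e : u = v by apply/eqP; case/and3P: hs.
  by move: hs'; rewrite e => /spath_self.
- have e : u = v by apply/eqP; case/and3P: hs'.
  by move: hs; rewrite e => /spath_self.
have tl w t : spath u v (w :: t) -> spath w v t.
  by case/and3P=> /= /andP[_ h1] /andP[_ h2] h3; apply/and3P.
have nr w t : spath u v (w :: t) -> u = p w -> w != r.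
  case/and3P=> _ /= /andP[us _] _ uw; apply/eqP => e.
  by move: us; rewrite uw e pr mem_head.
suff e : y = y' by congr (_ :: _) => //; apply: (IH _ y); [exact: tl hs|rewrite e; exact: tl hs'].
have [uy|uy] := eqVneq u (p y); have [uy'|uy'] := eqVneq u (p y').
- apply: (child_uniq pr reach (v := v)); [exact: nr hs uy|exact: nr hs' uy'|by rewrite -uy|exact: first_step_up hs uy|exact: first_step_up hs' uy'].
- have vy := first_step_up hs uy; have [_ /negP[]] := first_step_down hs' uy'.
  by rewrite uy; apply: connect_trans vy _; exact: fconnect1.
- have vy := first_step_up hs' uy'; have [_ /negP[]] := first_step_down hs uy.
  by rewrite uy'; apply: connect_trans vy _; exact: fconnect1.
- by have [-> _] := first_step_down hs uy; have [-> _] := first_step_down hs' uy'.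
Qed.

Lemma spath_exists u v : exists s, spath u v s.
Proof.
have sub w : connect (fe A) w r.
  apply: connect_sub (reach w) => a b /eqP <-; apply: connect1.
  by rewrite feE padj_sym; exact: parent_padj.
have /connectP[s us ->] : connect (fe A) u v.
  apply: connect_trans (sub u) _; rewrite sym_connect_sym; first exact: sub.
  by move=> a b; rewrite !feE padj_sym.
by case/shortenP: us => s' us' uni _; exists s'; apply/and3P.
Qed.

Lemma parent_tree : is_tree A.
Proof.
split; first by split=> [u|u v]; rewrite !feE; [exact: padj_refl|exact: padj_sym].
move=> u v _; have [s hs] := spath_exists u v.
by exists s; split=> // s'; exact: spath_uniq.
Qed.

(** A simple path from the root to [y] that visits [x], with [y] not above [x], would enter and
    leave the subtree of [x] and so visit [p x] twice. *)
Lemma tleE x y : tle x y <-> fconnect p y x.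
Proof.
split=> [h|yx s hs]; last first.
  have [->|xr] := eqVneq x (froot A); first exact: mem_head.
  case/and3P: hs; rewrite path_feE => hs _ /eqP e.
  have rx : ~~ fconnect p (froot A) x.
    by apply: contra xr => /(anc_root pr reach) ->.
  rewrite -e in yx; case: (path_enter hs rx yx) => xs _.
  by rewrite inE xs orbT.
have [s hs] := spath_exists (froot A) y; have := h _ hs.
rewrite inE; case: eqVneq => [-> _|xr /= xs]; first exact: reach.
apply: contraT => yx; case/splitPr: xs hs => s1 s2 /and3P[].
rewrite path_feE -cat_rcons cat_path last_rcons last_cat last_rcons => /andP[h1 h2] uni /eqP e.
have px : p x != x by apply: (parent_neq (r := r)).
have rx : ~~ fconnect p (froot A) x.
  by apply: contra xr => /(anc_root pr reach) ->.
have [_ a] : x \in rcons s1 x /\ p x \in froot A :: rcons s1 x.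
  by apply: path_enter => //; rewrite last_rcons.
have [_ b] : x \in x :: s2 /\ p x \in x :: s2.
  by apply: path_exit => //; rewrite e.
move: a b; rewrite -rcons_cons mem_rcons !inE (negPf px) /= => a b.
move: uni; rewrite -cat_cons cat_uniq => /and3P[_ /hasPn/(_ _ b)] /=.
by rewrite -rcons_cons mem_rcons inE inE a orbT.
Qed.

End Spec.

(** Induction on the height: if [p'] directed the edge between [v] and [p v] the other way, the
    induction hypothesis at [p v] would give [p (p v) = v], a cycle. *)
Lemma parent_uniq (A : rtgraph) (p p' : A -> A) :
  parent_spec p -> parent_spec p' -> p =1 p'.
Proof.
case=> pr reach feE [p'r reach' feE'] v.
have [n] := ubnP (height (froot A) p v); elim: n v => // n IH v.
have [->|vr] := eqVneq v (froot A); first by rewrite pr p'r.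
rewrite (height_parent reach vr) ltnS => hn.
have := parent_padj p v; rewrite -feE feE' => /or3P[/eqP e|/eqP //|/eqP e].
  by have := parent_neq reach vr; rewrite e eqxx.
have := IH _ hn; rewrite -e => e2; case/eqP: vr; apply: (parent_fix reach).
by apply: (anc_anti pr reach (fconnect1 p v)); rewrite -{2}e2 fconnect1.
Qed.

(** Chosen for every graph, with default [v] when there is no parent function, so that the order
    [<~] can be written without a proof of [is_tree]. *)
Definition par (A : rtgraph) (v : A) : A :=
  xget v (fun u => exists2 p, @parent_spec A p & p v = u).
Arguments par {A} v.

Lemma parE (A : rtgraph) (p : A -> A) : parent_spec p -> par =1 p.
Proof.
move=> hp v; rewrite /par; case: xgetP => [u _ [p' hp' <-]|/(_ (p v)) []].
  exact: parent_uniq.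
by exists p.
Qed.

Lemma parP (A : rtgraph) : is_tree A -> parent_spec (@par A).
Proof.
case/tree_parent => p hp; have e := parE hp; case: hp => pr reach feE.
by split=> [|v|u v]; rewrite ?e // ?(eq_fconnect e) // feE /padj !e.
Qed.

(** * Maps of the family *)

Notation "u <~ v" := (fconnect par v u) (at level 70).

(** Confluence tested only on the sets formed by [f u] and a neighbour [b]. The walk [s] inside the
    fibre serves the vertices collapsed by splitting and adding maps, which need not lift an edge
    directly. *)
Definition lifting (A B : rtgraph) (f : A -> B) := forall u b, fe B (f u) b ->
  exists s v, [/\ path (fe A) u (rcons s v), all (fun w => f w == f u) s & f v = b].

Record tree_map (A B : rtgraph) (f : A -> B) := TreeMap {
  tm_dom : is_tree A;
  tm_cod : is_tree B;
  tm_root : f (froot A) = froot B;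
  tm_parent : forall v, f (par v) = f v \/ f (par v) = par (f v);
  tm_surj : forall b, exists a, f a = b;
  tm_lift : lifting f }.

Section TreeFacts.
Variable A : rtgraph.
Hypothesis TA : is_tree A.
Implicit Types u v w x y g : A.

Lemma par_root : par (froot A) = froot A. Proof. by case: (parP TA). Qed.
Lemma root_le v : froot A <~ v. Proof. by case: (parP TA). Qed.
Lemma feE u v : fe A u v = padj par u v. Proof. by case: (parP TA). Qed.
Lemma fe_refl u : fe A u u. Proof. by rewrite feE padj_refl. Qed.
Lemma fe_sym u v : fe A u v = fe A v u. Proof. by rewrite !feE padj_sym. Qed.
Lemma fe_par v : fe A (par v) v. Proof. by rewrite feE parent_padj. Qed.
Lemma tle_anti u v : u <~ v -> v <~ u -> u = v.
Proof. exact: (anc_anti par_root root_le). Qed.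
Lemma tle_total u v w : u <~ w -> v <~ w -> u <~ v \/ v <~ u.
Proof. exact: anc_total. Qed.
Lemma tle_trans v u w : u <~ v -> v <~ w -> u <~ w.
Proof. by move=> a b; apply: connect_trans b a. Qed.
Lemma par_le v : par v <~ v. Proof. exact: fconnect1. Qed.
Lemma le_par u v : u <~ v -> u != v -> u <~ par v. Proof. exact: anc_parent. Qed.
Lemma le_root v : v <~ froot A -> v = froot A.
Proof. exact: (anc_root par_root root_le). Qed.
Lemma child u v : u <~ v -> u != v ->
  exists w, [/\ par w = u, w != u, w != froot A & w <~ v].
Proof. exact: (child_toward par_root). Qed.
Lemma child_unique u v w w' : par w = u -> w != u -> par w' = u -> w' != u ->
  w <~ v -> w' <~ v -> w = w'.
Proof.
have nr y : par y != y -> y != froot A by apply: contra => /eqP ->; rewrite par_root.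
move=> <- nw e nw' wv w'v; rewrite eq_sym in nw; rewrite -e eq_sym in nw'.
exact: (child_uniq par_root root_le (nr _ nw) (nr _ nw') _ wv w'v).
Qed.
Lemma fe_comparable u v : fe A u v -> u <~ v \/ v <~ u.
Proof. by rewrite feE; exact: padj_comparable. Qed.
Lemma fe_le u v : fe A u v -> u <~ v -> u = v \/ u = par v.
Proof.
rewrite feE => /or3P[/eqP->|/eqP->|/eqP vu] uv; [by left|by right|left].
by apply: tle_anti => //; rewrite vu par_le.
Qed.
Lemma par_neq v : v != froot A -> par v != v.
Proof. exact: (parent_neq root_le). Qed.
Lemma path_par x s : path (fe A) x s = path (padj par) x s.
Proof. exact: (path_feE (parP TA)). Qed.
Lemma connected_tree u v : exists s, path (fe A) u s /\ last u s = v.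
Proof.
by have [s /and3P[h1 _ /eqP h2]] := spath_exists (parP TA) u v; exists s.
Qed.
End TreeFacts.

Lemma tleP (A : rtgraph) (x y : A) : is_tree A -> tle x y <-> x <~ y.
Proof. by move=> TA; apply: tleE; exact: parP. Qed.

Section TreeMapFacts.
Variables (A B : rtgraph) (f : A -> B).
Hypothesis fP : tree_map f.

Lemma tm_le u v : u <~ v -> f u <~ f v.
Proof.
case/ancP=> k <-; elim: k => //= k IH; apply: tle_trans IH.
by case: (tm_parent fP (iter k par v)) => ->; [exact: connect0|exact: par_le].
Qed.

Lemma tm_fe u v : fe A u v -> fe B (f u) (f v).
Proof.
rewrite (feE (tm_dom fP)) => /or3P[]/eqP ->; first exact: (fe_refl (tm_cod fP)).
  by case: (tm_parent fP v) => ->; [apply: fe_refl|apply: fe_par]; exact: tm_cod fP.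
rewrite (fe_sym (tm_cod fP)).
by case: (tm_parent fP u) => ->; [apply: fe_refl|apply: fe_par]; exact: tm_cod fP.
Qed.

Lemma tm_path u t : path (fe B) (f u) t ->
  exists s, [/\ path (fe A) u s, f (last u s) = last (f u) t &
               all (fun w => f w \in f u :: t) s].
Proof.
elim: t u => [|b t IH] u /=; first by exists [::].
case/andP=> ub bt; have [s [v [us sf fv]]] := tm_lift fP ub.
rewrite -fv in bt; have [s' [vs' e a]] := IH _ bt.
exists (rcons s v ++ s'); rewrite cat_path us last_rcons vs' last_cat last_rcons -fv.
split=> //; rewrite all_cat all_rcons -andbA; apply/and3P; split.
- by rewrite !inE eqxx orbT.
- by apply: sub_all sf => w /eqP ->; rewrite mem_head.
- by apply: sub_all a => w; rewrite inE => h; rewrite inE; apply/orP; right; rewrite inE.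
Qed.

(* The fibre component of [g] over [f g] has [g] as its lowest vertex, so lifted
   paths cannot leave the subtree above [g]. *)
Lemma tm_up g w : g = froot A \/ f (par g) != f g -> f g <~ w ->
  exists v, g <~ v /\ f v = w.
Proof.
have TA := tm_dom fP; have TB := tm_cod fP.
move=> hg; have [n] := ubnP (height (froot B) par w); elim: n w => // n IH w hn gw.
have [<-|ne] := eqVneq (f g) w; first by exists g.
have wr : w != froot B by apply: contra ne => /eqP e; rewrite e in gw *; rewrite (le_root TB gw).
have gpw := le_par gw ne.
have [|v [gv fv]] := IH (par w) _ gpw.
  by move: hn; rewrite (height_parent (root_le TB) wr).
have vw : fe B (f v) w by rewrite fv; exact: fe_par.
have [s [u [vs sf fu]]] := tm_lift fP vw.
exists u; split=> //; apply: contraT => gu.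
rewrite (path_par TA) in vs.
have := path_exit (g := g) vs gv; rewrite last_rcons => /(_ gu) [_].
have par_out y : f g <~ f y -> y <> par g \/ g = froot A.
  move=> gy; case: hg => hg; [by right|left=> e].
  case: (tm_parent fP g) => h; first by rewrite h eqxx in hg.
  case/eqP: hg; apply: (tle_anti TB); first exact: tm_le (par_le g).
  by rewrite -e.
case: (par_out u) => [|ug|gr]; first by rewrite fu.
  rewrite inE mem_rcons inE => /or3P[/eqP e|/eqP e|e].
  - by case: (par_out v); [rewrite fv|rewrite e|move=> gr; rewrite gr (root_le TA) in gu].
  - by rewrite e in ug.
  - case: (par_out (par g)) => [|//|gr]; last by rewrite gr (root_le TA) in gu.
    by move/allP: sf => /(_ _ e)/eqP ->; rewrite fv.
by rewrite gr (root_le TA) in gu.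
Qed.

(** Along the chain from [x] to [z] the image climbs at most one step at a time, so it meets [b];
    [g] is the lowest vertex of the chain where it does, which is the form that [tm_up] asks for. *)
Lemma tm_first x z b : x <~ z -> f x <~ b -> f x != b -> b <~ f z ->
  exists g, [/\ x <~ g, x != g, g <~ z, f g = b & f (par g) != f g].
Proof.
have TA := tm_dom fP; have TB := tm_cod fP.
move=> xz xb nxb bz; case/ancP: xz => k; elim: k z bz => [|k IH] z bz kz.
  rewrite -kz /= in xb nxb; case/eqP: nxb.
  by rewrite [LHS](tle_anti TB (v := b)) //; rewrite -kz //= in xb *.
(* As long as [b] is below the image of the parent one can descend; otherwise the image arrives at
   [b] exactly at [z]. *)
have [pb|pb] := boolP (b <~ f (par z)).
  have [|g [h1 h2 h3 h4 h5]] := IH (par z) pb; first by rewrite -iterSr.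
  by exists g; split=> //; apply: tle_trans h3 (par_le z).
have xz : x <~ par z by apply/ancP; exists k; rewrite -iterSr.
have fz : f z = b.
  case: (tm_parent fP z) => e; first by rewrite e bz in pb.
  apply/eqP; apply: contraR pb; rewrite eq_sym => ne; rewrite e; exact: le_par.
have npz : f (par z) != f z by rewrite fz; apply: contra pb => /eqP ->; exact: connect0.
exists z; split=> //; first by apply: tle_trans xz (par_le z).
by apply: contra nxb => /eqP ->; rewrite fz.
Qed.

End TreeMapFacts.

Lemma tree_map_comp (A B C : rtgraph) (f : A -> B) (g : B -> C) :
  tree_map f -> tree_map g -> tree_map (g \o f).
Proof.
move=> fP gP; split.
- exact: tm_dom fP.
- exact: tm_cod gP.
- by rewrite /= (tm_root fP) (tm_root gP).
- move=> v /=; case: (tm_parent fP v) => ->; first by left.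
  exact: (tm_parent gP).
- move=> c; have [b <-] := tm_surj gP c; have [a <-] := tm_surj fP b.
  by exists a.
move=> u c /= uc; have [t [b [ut tg gb]]] := tm_lift gP uc.
move: ut; rewrite rcons_path => /andP[ut tb].
(* [f] lifts the walk [t] to vertices whose images stay in one fibre of [g]; the last edge is lifted
   from the end of that walk. *)
have [s [us e a]] := tm_path fP ut; rewrite -e in tb.
have [s' [v [ws' sf' fv]]] := tm_lift fP tb.
exists (s ++ s'), v; rewrite rcons_cat cat_path us ws' fv; split=> //.
have tgu w : w \in f u :: t -> g w = g (f u).
  by rewrite inE => /predU1P[->//|/(allP tg)/eqP].
rewrite all_cat; apply/andP; split; apply/allP => w ws.
  by rewrite /= (tgu _ (allP a _ ws)).
by rewrite /= (eqP (allP sf' _ ws)) e tgu // mem_last.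
Qed.

Lemma set2_eq (T : finType) (a b c d : T) : a != b ->
  ([set c; d] == [set a; b])%SET = ((c == a) && (d == b) || (c == b) && (d == a)).
Proof.
move=> ab; apply/eqP/idP => [e|/orP[]/andP[/eqP-> /eqP->]] //; last exact: finset.setUC.
have ca : c \in [set a; b]%SET by rewrite -e !finset.inE eqxx.
have da : d \in [set a; b]%SET by rewrite -e !finset.inE eqxx orbT.
have ac : a \in [set c; d]%SET by rewrite e !finset.inE eqxx.
have bc : b \in [set c; d]%SET by rewrite e !finset.inE eqxx orbT.
move: ca da ac bc; rewrite !finset.inE.
case/orP=> /eqP -> /orP[]/eqP ->; rewrite ?eqxx ?orbT //= ?orbb eq_sym ?(negPf ab) //.
by rewrite eq_sym (negPf ab).
Qed.

(* Splitting and adding share a section [j] of [f] that misses only the new vertex. *)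
Lemma new_vertex_section (A B : rtgraph) (f : A -> B) (x : A) :
  (forall u v : A, u != x -> v != x -> f u = f v -> u = v) ->
  (forall w : B, exists2 u : A, u != x & f u = w) ->
  exists j : B -> A, [/\ forall w, f (j w) = w, forall w, j w != x &
    forall u, u != x -> j (f u) = u].
Proof.
move=> inj sur; pose P w u := u != x /\ f u = w.
have ex w : exists u, P w u by have [u h1 h2] := sur w; exists u.
have [j jP] := choice ex; exists j; split=> [w|w|u ux]; [by case: (jP w)..|].
by apply: inj => //; case: (jP (f u)).
Qed.

(** * Splitting edge maps *)

Section Splitting.
Variables (A B : rtgraph) (f : A -> B) (x : A) (a b : B) (j : B -> A).
Hypothesis (TB : is_tree B) (GA : is_graph A).
Hypotheses (nab : a != b) (ab : fe B a b) (lab : tle a b)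
  (fx : (f x == a) || (f x == b)) (rx : froot A != x) (fr : f (froot A) = froot B)
  (fj : forall w, f (j w) = w) (jx : forall w, j w != x)
  (jf : forall u, u != x -> j (f u) = u)
  (fe_old : forall u v : A, u != x -> v != x ->
     fe A u v = fe B (f u) (f v) && ([set f u; f v] != [set a; b])%SET)
  (fe_new : forall u : A, u != x -> fe A x u = (f u == a) || (f u == b)).

Let par_b : par b = a.
Proof. by case: (fe_le TB ab); [apply/tleP|move=> e; move: (nab); rewrite e eqxx|]. Qed.

Let b_root : b != froot B.
Proof. by apply: contra nab => /eqP e; rewrite -par_b e par_root. Qed.

Definition split_parent (v : A) : A :=
  if v == x then j a else if f v == b then x else j (par (f v)).

Lemma split_parent_spec : parent_spec split_parent.
Proof.
have jr : j (froot B) = froot A by rewrite -fr jf.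
have pr : split_parent (froot A) = froot A.
  by rewrite /split_parent (negPf rx) fr eq_sym (negPf b_root) par_root.
have spx : split_parent x = j a by rewrite /split_parent eqxx.
have reach v : v != x -> fconnect split_parent v (froot A).
  have [n] := ubnP (height (froot B) par (f v)); elim: n v => // n IH v hn vx.
  have [fvr|fvr] := eqVneq (f v) (froot B).
    by rewrite -(jf vx) fvr jr.
  move: hn; rewrite (height_parent (root_le TB) fvr) ltnS => hn.
  have h : fconnect split_parent (j (par (f v))) (froot A) by apply: IH; rewrite ?fj.
  apply: connect_trans (fconnect1 _ v) _; rewrite {2}/split_parent (negPf vx).
  case: eqP => [fvb|//]; apply: connect_trans (fconnect1 _ x) _.
  by rewrite spx -par_b -fvb.
split=> // [v|u v].
  have [->|vx] := eqVneq v x; last exact: reach.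
  by apply: connect_trans (fconnect1 _ x) _; rewrite spx reach.
have pold w : w != x -> (x == split_parent w) = (f w == b).
  move=> wx; rewrite /split_parent (negPf wx); case: (eqVneq (f w) b) => _; first by rewrite eqxx.
  by apply/negbTE; rewrite eq_sym jx.
have pnew w : w != x -> (w == split_parent x) = (f w == a).
  move=> wx; rewrite /split_parent eqxx; apply/eqP/eqP => [->//|<-]; by rewrite jf.
case: (eqVneq u x) => [->|ux]; case: (eqVneq v x) => [->|vx].
- by case: GA => -> _; rewrite padj_refl.
- by rewrite fe_new // /padj pold // pnew // [x == v]eq_sym (negPf vx) orbC.
- by case: GA => _ ->; rewrite fe_new // /padj pold // pnew // (negPf ux).
rewrite fe_old // (feE TB) set2_eq // /padj.
have -> : (f u == f v) = (u == v).
  by apply/eqP/eqP => [e|->//]; rewrite -(jf ux) e jf.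
have pE w1 w2 : w1 != x -> w2 != x ->
    (w1 == split_parent w2) = (f w2 != b) && (f w1 == par (f w2)).
  move=> h1 h2; rewrite /split_parent (negPf h2); case: (eqVneq (f w2) b) => /= _; first by rewrite (negPf h1).
  by apply/eqP/eqP => [->//|<-]; rewrite jf.
rewrite !pE //; case: (eqVneq u v) => [->|nuv] /=.
  by apply/negP => /orP[]/andP[/eqP-> /eqP e]; move: (nab); rewrite e eqxx.
have nba : b != par a.
  apply: contra nab => /eqP e; apply/eqP; apply: (tle_anti TB); last by rewrite e par_le.
  by rewrite -par_b par_le.
have nf : f u != f v by apply: contra nuv => /eqP e; rewrite -(jf ux) e jf.
case: (eqVneq (f v) b) => [vb|vb] /=; case: (eqVneq (f u) b) => [ub|ub] /=.
- by rewrite ub vb eqxx in nf.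
- rewrite vb par_b; case: (eqVneq (f u) a) => [->|_] /=; last by rewrite andbT.
  by rewrite (negPf nba).
- rewrite ub par_b; case: (eqVneq (f v) a) => [->|_] /=; last by rewrite ?andbF ?orbF ?andbT.
  by rewrite (negPf nba) ?andbF ?orbF ?andbT.
- by rewrite !andbF andbT.
Qed.

Lemma splitting_tree_map : tree_map f.
Proof.
have TA := parent_tree split_parent_spec; have pE := parE split_parent_spec.
have GB : forall w, fe B w w by move=> w; exact: fe_refl.
split=> //.
- move=> v; rewrite pE /split_parent; case: eqP => [->|/eqP vx].
    by rewrite fj; case/orP: fx => /eqP ->; [left|rewrite par_b; right].
  case: eqP => [->|_]; last by rewrite fj; right.
  by rewrite par_b; case/orP: fx => /eqP ->; [right|left].
- by move=> w; exists (j w).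
move=> u c uc.
(* If [u] is the new vertex, one step leads to the old end that has the same image. *)
have toj : exists s, [/\ path (fe A) u s, last u s = j (f u) & all (fun w => f w == f u) s].
  have [ux|ux] := eqVneq u x; last by exists [::]; rewrite /= jf.
  by exists [:: j (f u)]; rewrite /= fj eqxx ux fe_new // fj fx.
have [s [us lu sf]] := toj.
(* Only the edge between [a] and [b] has lost its direct lift; it now runs through [x], which lies
   over one of its ends. *)
have [e|ne] := boolP ([set f u; c] == [set a; b])%SET; last first.
  exists s, (j c); rewrite rcons_path us lu fe_old // !fj uc ne; by split.
move: e; rewrite set2_eq // => e.
have xc w : w != x -> (f w == a) || (f w == b) -> fe A x w by move=> ? ?; rewrite fe_new.
have cab : (c == a) || (c == b) by case/orP: e => /andP[_ ->]; rewrite ?orbT.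
have uab : (f u == a) || (f u == b) by case/orP: e => /andP[-> _]; rewrite ?orbT.
have [ux|ux] := eqVneq u x.
  by exists [::], (j c); rewrite /= ux fe_new // fj; split; rewrite ?cab.
have ux' : fe A u x by case: GA => _ ->; exact: xc.
have [fxu|fxu] := eqVneq (f x) (f u).
  by exists [:: x], (j c); rewrite /= fxu eqxx ux' fe_new // fj cab.
exists [::], x; rewrite /= ux'; split=> //.
by case/orP: e fx fxu => /andP[/eqP-> /eqP->] /orP[]/eqP-> //; rewrite eqxx.
Qed.

End Splitting.

Lemma splitting_map (A B : rtgraph) (f : A -> B) :
  is_tree B -> is_graph A -> splitting f -> tree_map f.
Proof.
move=> TB GA [x [a [b [[nab ab lab fx] [[rx fr] [inj [sur [eo en]]]]]]]].
have [j [fj jx jf]] := new_vertex_section inj sur.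
exact: (splitting_tree_map TB GA nab ab lab fx rx fr fj jx jf eo en).
Qed.

Section Adding.
Variables (A B : rtgraph) (f : A -> B) (y : A) (v : B) (j : B -> A).
Hypothesis (TB : is_tree B) (GA : is_graph A).
Hypotheses (fy : f y = v) (ry : froot A != y) (fr : f (froot A) = froot B)
  (fj : forall w, f (j w) = w) (jy : forall w, j w != y)
  (jf : forall u, u != y -> j (f u) = u)
  (fe_old : forall u w : A, u != y -> w != y -> fe A u w = fe B (f u) (f w))
  (fe_new : forall u : A, u != y -> fe A y u = (f u == v)).

Definition add_parent (u : A) : A := if u == y then j v else j (par (f u)).

Lemma add_parent_spec : parent_spec add_parent.
Proof.
have jr : j (froot B) = froot A by rewrite -fr jf.
have reach u : u != y -> fconnect add_parent u (froot A).
  have [n] := ubnP (height (froot B) par (f u)); elim: n u => // n IH u hn uy.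
  have [fvr|fvr] := eqVneq (f u) (froot B); first by rewrite -(jf uy) fvr jr.
  move: hn; rewrite (height_parent (root_le TB) fvr) ltnS => hn.
  apply: connect_trans (fconnect1 _ u) _; rewrite {2}/add_parent (negPf uy).
  by apply: IH; rewrite ?fj.
split=> [|u|u w]; first by rewrite /add_parent (negPf ry) fr par_root.
  have [->|uy] := eqVneq u y; last exact: reach.
  by apply: connect_trans (fconnect1 _ y) _; rewrite {2}/add_parent eqxx reach.
have pold w' : (y == add_parent w') = false.
  by rewrite /add_parent; case: ifP => _; apply/negbTE; rewrite eq_sym jy.
have pnew w' : w' != y -> (w' == add_parent y) = (f w' == v).
  by move=> wy; rewrite /add_parent eqxx; apply/eqP/eqP => [->//|<-]; rewrite jf.
case: (eqVneq u y) => [->|uy]; case: (eqVneq w y) => [->|wy].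
- by case: GA => -> _; rewrite padj_refl.
- by rewrite fe_new // /padj pold pnew // [y == w]eq_sym (negPf wy).
- by case: GA => _ ->; rewrite fe_new // /padj pold pnew // (negPf uy) orbF.
rewrite fe_old // (feE TB) /padj.
have -> : (f u == f w) = (u == w).
  by apply/eqP/eqP => [e|->//]; rewrite -(jf uy) e jf.
have pE w1 w2 : w1 != y -> w2 != y -> (w1 == add_parent w2) = (f w1 == par (f w2)).
  move=> h1 h2; rewrite /add_parent (negPf h2).
  by apply/eqP/eqP => [->//|<-]; rewrite jf.
by rewrite !pE.
Qed.

Lemma adding_tree_map : tree_map f.
Proof.
have pA := add_parent_spec; split=> //; first exact: parent_tree pA.
- move=> u; rewrite (parE pA) /add_parent.
  by case: eqP => [->|_]; rewrite fj; [left; rewrite fy|right].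
- by move=> w; exists (j w).
move=> u c uc; have [uy|uy] := eqVneq u y.
  exists [:: j v], (j c); rewrite /= fj uy fy eqxx !andbT; split=> //.
  by rewrite fe_new // fj eqxx fe_old // !fj; rewrite uy fy in uc.
by exists [::], (j c); rewrite /= fj andbT fe_old // fj.
Qed.

End Adding.

Lemma adding_map (A B : rtgraph) (f : A -> B) :
  is_tree B -> is_graph A -> adding f -> tree_map f.
Proof.
move=> TB GA [y [v [fy [[ry fr] [inj [sur [eo en]]]]]]].
have [j [fj jy jf]] := new_vertex_section inj sur.
exact: (adding_tree_map TB GA fy ry fr fj jy jf eo en).
Qed.

(** * Confluence and edge lifting *)

Section Confluent.
Variables (A B : rtgraph) (f : A -> B).
Hypotheses (TA : is_tree A) (TB : is_tree B).

Lemma path_crossing (T : Type) (e : rel T) (P : pred T) x s :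
  path e x s -> P x -> ~~ P (last x s) -> exists u v, [/\ P u, ~~ P v & e u v].
Proof.
elim: s x => [|y s IH] x /=; first by move=> _ ->.
case/andP=> xy ys px nl; have [py|py] := boolP (P y); first exact: IH ys py nl.
by exists x, y.
Qed.

(** Confluence is applied to the component of [u] over the set of [f u] and [c]. Its image contains
    [c], so a path inside it reaches the fibre of [c]; cut at its first vertex over [c], this path
    is the lift. *)
Lemma confluent_lifting : confluent f -> lifting f.
Proof.
move=> cf u c uc; have [fuc|fuc] := eqVneq (f u) c.
  by exists [::], u; rewrite /= fe_refl.
pose Q := [set f u; c]%SET.
have cQ : gconnected Q.
  move=> P1 P2 e _ /finset.set0Pn[x x1] /finset.set0Pn[y y2].
  have xQ : x \in Q by rewrite -e finset.inE x1.
  have yQ : y \in Q by rewrite -e finset.inE y2 orbT.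
  exists x, y; split=> //; move: xQ yQ; rewrite !finset.inE.
  by case/orP=> /eqP -> /orP[]/eqP ->; rewrite ?fe_refl // fe_sym.
pose R := [rel v w : A | [&& fe A v w, f v \in Q & f w \in Q]].
have Rsym v w : R v w -> R w v by case/and3P=> h1 h2 h3; rewrite /= fe_sym // h1 h2 h3.
pose K := [set v | connect R u v]%SET.
have uQ : f u \in Q by rewrite !finset.inE eqxx.
have KQ v : v \in K -> f v \in Q.
  rewrite finset.inE => /connectP[s us ->]; elim/last_ind: s us => [|s y _] //.
  by rewrite rcons_path last_rcons => /andP[_ /and3P[]].
(* A predicate that separates [u] from a vertex of [K] changes its value along an edge inside [K];
   connectedness of [K] follows. *)
have crossing (P : pred A) y : y \in K -> P u != P y ->
    exists v w, [/\ v \in K, w \in K, P v, ~~ P w & fe A v w].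
  rewrite finset.inE => /connectP[s us ->] ne.
  have cK v : v \in u :: s -> v \in K.
    by move=> h; rewrite finset.inE; exact: (path_connect us h).
  have us2 : path [rel v w | (v \in K) && (w \in K) && fe A v w] u s.
    apply: (sub_in_path (P := [in K])) us; first by move=> v w vK wK /and3P[vw _ _] /=; apply/andP; split=> //; apply/andP.
    by apply/allP => v /cK.
  have [pu|pu] := boolP (P u).
    rewrite pu in ne; have npl : ~~ P (last u s) by case: (P _) ne.
    have [v [w [pv pw /andP[/andP[vK wK] vw]]]] := path_crossing us2 pu npl.
    by exists v, w; split.
  rewrite (negPf pu) in ne; have npl : ~~ predC P (last u s) by case E: (P _) ne => //=; rewrite E.
  have [v [w [pv pw /andP[/andP[vK wK] vw]]]] := path_crossing us2 pu npl.
  by exists w, v; rewrite fe_sym //; split=> //; move: pw; rewrite /= negbK.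
have compK : gcomponent (f @^-1: Q)%SET K.
  split.
  - by apply/fintype.subsetP => v /KQ h; rewrite finset.inE.
  - by apply/finset.set0Pn; exists u; rewrite finset.inE connect0.
  - move=> P1 P2 e12 e0 /finset.set0Pn[x x1] /finset.set0Pn[y y2].
    have dis v : v \in P1 -> v \in P2 = false.
      move=> v1; apply/negP => v2; have : v \in (P1 :&: P2)%SET by rewrite finset.inE v1.
      by rewrite e0 finset.inE.
    have P12 v : v \in K -> (v \in P1) || (v \in P2) by rewrite -e12 finset.inE.
    have xK : x \in K by rewrite -e12 finset.inE x1.
    have yK : y \in K by rewrite -e12 finset.inE y2 orbT.
    have y1 : y \in P1 = false by apply/negP => /dis; rewrite y2.
    have [v [w [vK wK v1 w1 vw]]] : exists v w, [/\ v \in K, w \in K, v \in P1, w \notin P1 & fe A v w].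
      have [u1|u1] := boolP (u \in P1).
        by apply: (crossing [in P1] y) => //=; rewrite u1 y1.
      by apply: (crossing [in P1] x) => //=; rewrite (negPf u1) x1.
    by exists v, w; split=> //; case/orP: (P12 _ wK) => //; rewrite (negPf w1).
  move=> K' KK' K'Q cK'; apply/eqP; rewrite finset.eqEsubset KK' andbT.
  rewrite -finset.setD_eq0; apply: contraT => D0.
  have [|||x [y [xK yD xy]]] := cK' K (K' :\: K)%SET _ _ _ D0.
  - by rewrite finset.setDE finset.setUIr finset.setUCr finset.setIT; apply/finset.setUidPr.
  - by rewrite finset.setIDA finset.setIC finset.setDE -finset.setIA finset.setICr finset.setI0.
  - by apply/finset.set0Pn; exists u; rewrite finset.inE connect0.
  move: yD; rewrite finset.inE => /andP[/negP yK yK']; case: yK.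
  have yQ : f y \in Q by move/fintype.subsetP: K'Q => /(_ _ yK'); rewrite finset.inE.
  rewrite finset.inE; apply: connect_trans (_ : connect R u x) _.
    by rewrite finset.inE in xK.
  by apply: connect1; rewrite /= xy (KQ _ xK) yQ.
have : c \in (f @: K)%SET by rewrite (cf Q cQ K compK) !finset.inE eqxx orbT.
case/imsetP=> w; rewrite finset.inE => /connectP[s us ->] fc.
suff gen x : f x = f u -> path R x s -> c = f (last x s) ->
    exists s' v, [/\ path (fe A) x (rcons s' v), all (fun w => f w == f u) s' & f v = c].
  exact: gen us fc.
elim: s x {us fc} => [|y s IH] x fxu /=; first by move=> _ e; rewrite e fxu eqxx in fuc.
case/andP=> /and3P[xy _]; rewrite !finset.inE => /orP[/eqP fy|/eqP fy] ys e; last first.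
  by exists [::], y; rewrite /= xy.
have [s' [v [h1 h2 h3]]] := IH _ fy ys e.
by exists (y :: s'), v; rewrite /= xy h1 fy eqxx h2.
Qed.

(** Edges lift at [u] itself here. If the image of [K] missed part of [Q], an edge of [Q] leaving
    the image would lift to a vertex [v] adjacent to [K], and [K] with [v] added would contradict
    maximality. *)
Lemma lifting_confluent : (forall u c, fe B (f u) c -> exists2 v, fe A u v & f v = c) ->
  confluent f.
Proof.
move=> lf Q cQ K [KQ K0 cK maxK]; apply/eqP; rewrite finset.eqEsubset.
have sub : (f @: K \subset Q)%SET.
  by apply/fintype.subsetP => _ /imsetP[v vK ->]; move/fintype.subsetP: KQ => /(_ _ vK); rewrite finset.inE.
rewrite sub /= -finset.setD_eq0; apply: contraT => D0.
have [||//|x [y [/imsetP[u uK xu] yD xy]]] := cQ (f @: K)%SET (Q :\: f @: K)%SET _ _ _ D0.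
- by rewrite finset.setDE finset.setUIr finset.setUCr finset.setIT; apply/finset.setUidPr.
- by rewrite finset.setIDA finset.setIC finset.setDE -finset.setIA finset.setICr finset.setI0.
- case/finset.set0Pn: K0 => v vK; apply/finset.set0Pn; exists (f v); exact: imset_f.
have [v uv fv] : exists2 v, fe A u v & f v = y by apply: lf; rewrite -xu.
move: yD; rewrite finset.inE => /andP[/negP yK yQ]; case: yK.
have <- : (v |: K)%SET = K.
  apply: maxK; first exact: finset.subsetUr.
    by rewrite finset.subUset KQ andbT finset.sub1set finset.inE fv.
  move=> P1 P2 e12 e0 P10 P20.
  have dis w : w \in P1 -> w \in P2 = false.
    move=> v1; apply/negP => v2; have : w \in (P1 :&: P2)%SET by rewrite finset.inE v1.
    by rewrite e0 finset.inE.
  have inU w : w \in (v |: K)%SET = (w \in P1) || (w \in P2) by rewrite -e12 finset.inE.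
  (* A part that misses [K] is reduced to [v], and the edge to [u] crosses; if both parts meet [K],
     connectedness of [K] applies. *)
  have [n1|n1] := boolP (P1 :&: K == finset.set0)%SET.
    case/finset.set0Pn: P10 => w w1.
    have wv : w = v.
      have := inU w; rewrite w1 !finset.inE => /orP[/eqP//|wK].
      by move/eqP: n1 => /setP/(_ w); rewrite !finset.inE w1 wK.
    exists v, u; rewrite -wv w1 fe_sym // wv uv; split=> //.
    have := inU u; rewrite !finset.inE uK orbT => /esym/orP[u1|//].
    by move/eqP: n1 => /setP/(_ u); rewrite !finset.inE u1 uK.
  have [n2|n2] := boolP (P2 :&: K == finset.set0)%SET.
    case/finset.set0Pn: P20 => w w1.
    have wv : w = v.
      have := inU w; rewrite w1 orbT !finset.inE => /orP[/eqP//|wK].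
      by move/eqP: n2 => /setP/(_ w); rewrite !finset.inE w1 wK.
    exists u, v; rewrite -wv w1 wv uv; split=> //.
    have := inU u; rewrite !finset.inE uK orbT => /esym/orP[//|u1].
    by move/eqP: n2 => /setP/(_ u); rewrite !finset.inE u1 uK.
  have [||x' [y' [+ + xy']]] := cK (P1 :&: K)%SET (P2 :&: K)%SET _ _ n1 n2.
  - rewrite -finset.setIUl e12; apply/finset.setIidPr; exact: finset.subsetUr.
  - by rewrite finset.setIACA e0 finset.set0I.
  by rewrite !finset.inE => /andP[? _] /andP[? _]; exists x', y'.
by apply/imsetP; exists v; rewrite ?fv // !finset.inE eqxx.
Qed.

End Confluent.

Lemma epi_map (A B : rtgraph) (f : A -> B) :
  is_tree A -> is_tree B -> epi f -> confluent f -> tree_map f.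
Proof.
move=> TA TB [fE fS _ fr fO] cf; split=> // [v|]; last exact: confluent_lifting.
have lev : f (par v) <~ f v by apply/tleP => //; apply: fO; apply/tleP => //; exact: par_le.
by case: (fe_le TB (fE _ _ (fe_par TA v)) lev); [left|right].
Qed.

Lemma sstar_tree_map (A B : rtgraph) (f : A -> B) : sstar f -> tree_map f.
Proof.
elim=> {A B f} [A B f [TA _] [TB _] h|A B f [TA _] [TB _] h|A B f [TA _] [TB _] h1 h2 _|].
- by apply: splitting_map => //; case: TA.
- by apply: adding_map => //; case: TA.
- exact: epi_map.
by move=> A B C f g _ fP _ gP; exact: tree_map_comp.
Qed.

Lemma sstar_in_TC (A B : rtgraph) (f : A -> B) : sstar f -> in_TC A /\ in_TC B.
Proof. by elim=> // {}A {}B C {}f g _ [hA _] _ [_ hC]. Qed.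

(** * Splitting, adding and copying branches *)

(** The splitting of the edge below [b]: [s] is the new vertex, [j] embeds the old ones, and [side]
    tells whether [s] is sent to the upper or to the lower end. Only parents are recorded, since
    they determine the edges. *)
Record edge_split (A : rtgraph) (b : A) (side : bool) (B : rtgraph) (g : B -> A)
    (s : B) (j : A -> B) := EdgeSplit {
  es_sstar : sstar g;
  es_section : forall w, g (j w) = w;
  es_new : forall w, j w != s;
  es_cover : forall u, u != s -> j (g u) = u;
  es_side : g s = if side then b else par b;
  es_par_new : par s = j (par b);
  es_par_split : par (j b) = s;
  es_par_old : forall w, w != b -> par (j w) = j (par w) }.

Lemma edge_split_exists (A : rtgraph) (b : A) (side : bool) :
  in_TC A -> b != froot A ->
  exists (B : rtgraph) (g : B -> A) (s : B) (j : A -> B), edge_split b side g s j.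
Proof.
move=> [TA cA] br; set a := par b.
have nab : a != b by exact: par_neq.
pose e (u v : option A) := match u, v with
  | None, None => true
  | None, Some w | Some w, None => (w == a) || (w == b)
  | Some u, Some v => fe A u v && ([set u; v] != [set a; b])%SET
  end.
pose B := RTGraph (option A) e (Some (froot A)).
pose g (u : B) : A := if u is Some w then w else if side then b else a.
pose j (w : A) : B := Some w.
have GB : is_graph B.
  split=> [[u|]|[u|] [v|]] //=; last by rewrite (fe_sym TA) finset.setUC.
  rewrite fe_refl //= set2_eq //; apply/negP.
  by case/orP=> /andP[/eqP-> /eqP h]; move: nab; rewrite h eqxx.
have ab : fe A a b by exact: fe_par.
have lab : tle a b by apply/tleP => //; exact: par_le.
have gx : (g None == a) || (g None == b) by rewrite /=; case: (side); rewrite eqxx ?orbT.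
have jg u : u != None :> B -> j (g u) = u by case: u.
have eo (u v : B) : u != None -> v != None ->
    fe B u v = fe A (g u) (g v) && ([set g u; g v] != [set a; b])%SET.
  by case: u v => [u|] // [v|].
have en (u : B) : u != None -> fe B None u = (g u == a) || (g u == b) by case: u.
have gj w : g (j w) = w by [].
have jn w : j w != None by [].
have pB := split_parent_spec TA GB nab ab lab (erefl : froot B != None) (erefl : g (froot B) = froot A)
  gj jn jg eo en.
have pE := parE pB.
have spl : splitting g.
  exists None, a, b; split=> //; split=> //; split; first by case=> [u|] // [v|] // _ _ /= ->.
  split; first by move=> w; exists (Some w).
  by split.
exists B, g, None, j; split=> //.
- apply: sstar_split => //; split; first exact: parent_tree pB.
  by rewrite card_option ltnS ltnW.
- by rewrite pE /split_parent eqxx.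
- by move=> w wb; rewrite pE /split_parent /= (negPf wb).
Qed.

(** Puts a maximal vertex over any given vertex, which is the source of the dense set of
    endpoints. *)
Lemma leaf_add_exists (A : rtgraph) (v : A) : in_TC A ->
  exists (B : rtgraph) (g : B -> A) (y : B),
    [/\ sstar g, g y = v & forall u, y <~ u -> u = y].
Proof.
move=> [TA cA].
pose e (u w : option A) := match u, w with
  | None, None => true
  | None, Some w | Some w, None => w == v
  | Some u, Some w => fe A u w
  end.
pose B := RTGraph (option A) e (Some (froot A)).
pose g (u : B) : A := if u is Some w then w else v.
pose j (w : A) : B := Some w.
have GB : is_graph B.
  by split=> [[u|]|[u|] [w|]] //=; [exact: fe_refl|rewrite (fe_sym TA)].
have jg u : u != None :> B -> j (g u) = u by case: u.
have eo (u w : B) : u != None -> w != None -> fe B u w = fe A (g u) (g w).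
  by case: u w => [u|] // [w|].
have en (u : B) : u != None -> fe B None u = (g u == v) by case: u.
have gj w : g (j w) = w by [].
have jn w : j w != None by [].
have pB := add_parent_spec TA GB (erefl : froot B != None) (erefl : g (froot B) = froot A)
  gj jn jg eo en.
exists B, g, None; split=> //.
  apply: sstar_add; [|by []|].
    by split; [exact: parent_tree pB|rewrite card_option ltnS ltnW].
  exists None, v; split=> //; split=> //; split; first by case=> [u|] // [w|] // _ _ /= ->.
  split; first by move=> w; exists (Some w).
  by split.
move=> u yu; apply/eqP; apply: contraT => uy; rewrite eq_sym in uy.
have [w [pw _ _ _]] := child (parent_tree pB) yu uy.
by move: pw; rewrite (parE pB) /add_parent; case: ifP.
Qed.

(** [c i] embeds the whole tree, using copy number [i] for what lies strictly above [s]; elsewhere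
    the three embeddings agree. *)
Record branch_copies (A : rtgraph) (s : A) (B : rtgraph) (g : B -> A)
    (c : 'I_3 -> A -> B) := BranchCopies {
  bc_sstar : sstar g;
  bc_section : forall i v, g (c i v) = v;
  bc_cover : forall x, exists i, x = c i (g x);
  bc_par : forall i v, par (c i v) = c i (par v);
  bc_base : forall i j v, ~~ ((s <~ v) && (s != v)) -> c i v = c j v;
  bc_inj : forall i j v, (s <~ v) && (s != v) -> c i v = c j v -> i = j }.

(* Gluing three copies of the part of the tree above [s] along [s]; folding them
   back onto each other is light and confluent. *)
Lemma branch_copies_exists (A : rtgraph) (s : A) : in_TC A ->
  exists (B : rtgraph) (g : B -> A) (c : 'I_3 -> A -> B), branch_copies s g c.
Proof.
move=> [TA cA]; pose above v := (s <~ v) && (s != v).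
pose P (x : 'I_3 * A) := (x.1 == ord0) || above x.2.
pose T := {x : 'I_3 * A | P x}.
have P0 v : P (ord0, v) by [].
(* The default of [insubd] sends vertices not strictly above [s] to copy 0, which is where the three
   copies are glued. *)
pose c (i : 'I_3) (v : A) : T := insubd (Sub (ord0, v) (P0 v)) (i, v).
have cE i v : val (c i v) = (if above v then i else ord0, v).
  rewrite val_insubd SubK /P /=; case: (above v); first by rewrite orbT.
  by rewrite orbF; case: eqP => // ->.
pose g (x : T) := (val x).2.
have gc i v : g (c i v) = v by rewrite /g cE.
have cg x : x = c (val x).1 (g x).
  apply: val_inj; rewrite cE /g; case: x => -[i v] /= h.
  by move: h; rewrite /P /=; case: (above v) => //; rewrite orbF => /eqP ->.
pose p (x : T) := c (val x).1 (par (g x)).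
have above_par v : above (par v) -> above v.
  case/andP=> h1 h2; rewrite /above (tle_trans h1 (par_le v)) /=.
  apply: contra h2 => /eqP e; apply/eqP; apply: (tle_anti TA) => //.
  by rewrite e par_le.
have pc i v : p (c i v) = c i (par v).
  apply: val_inj; rewrite /p !cE gc /=.
  by case: ifP => // /above_par ->.
have ar : above (froot A) = false.
  by apply/negP => /andP[/(le_root TA) ->]; rewrite eqxx.
pose r := c ord0 (froot A).
have gr x : g x = froot A -> x = r.
  by move=> e; rewrite (cg x) e; apply: val_inj; rewrite !cE ar.
pose B := RTGraph T (padj p) r.
have gp x : g (p x) = par (g x) by rewrite /p gc.
have pB : @parent_spec B p.
  split=> //; first by rewrite pc par_root.
  move=> v; have [n] := ubnP (height (froot A) par (g v)); elim: n v => // n IH v hn.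
  have [/gr ->//|vr] := eqVneq (g v) (froot A).
  apply: connect_trans (fconnect1 p v) _; apply: IH.
  by move: hn; rewrite (height_parent (root_le TA) vr) gp.
have pE := parE pB; have TB := parent_tree pB.
have gle (x y : B) : x <~ y -> g x <~ g y.
  case/ancP=> k <-; elim: k => //= k IH; apply: tle_trans IH.
  by rewrite pE gp par_le.
have lft (u : B) b : fe A (g u) b -> exists2 v, fe B u v & g v = b.
  rewrite (feE TA) => /or3P[/eqP <-|/eqP e|/eqP ->].
  - by exists u; rewrite //= padj_refl.
  - exists (c (val u).1 b); last exact: gc.
    by rewrite /= /padj pc -e -cg eqxx orbT.
  - by exists (p u); rewrite ?gp //= padj_sym parent_padj.
exists B, g, c; split=> //.
- apply: sstar_lc => //.
  + split=> //; apply: (leq_trans cA); rewrite -(card_imset _ (f := c ord0)) ?max_card //.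
    by move=> u v /(congr1 g); rewrite !gc.
  + split.
    * move=> x y; rewrite /= /padj => /or3P[]/eqP ->; rewrite ?fe_refl ?gp ?fe_par //.
      by rewrite (fe_sym TA) fe_par.
    * by move=> b; exists (c ord0 b).
    * move=> u v uv; have [|y xy gy] := lft (c ord0 u) v; first by rewrite gc.
      by exists (c ord0 u), y; rewrite gc.
    * by rewrite /= gc.
    * by move=> x y /(tleP _ _ TB) h; apply/tleP => //; exact: gle.
  + exact: lifting_confluent.
  + move=> x y nxy; rewrite /= /padj (negPf nxy) /= => h.
    apply: contraNneq nxy => e.
    case/orP: h => /eqP h; move: e; rewrite h gp.
      have [/gr yr _|yr e] := eqVneq (g y) (froot A); first by rewrite yr pc par_root.
      by have := par_neq TA yr; rewrite e eqxx.
    have [/gr yr _|yr /esym e] := eqVneq (g x) (froot A); first by rewrite yr pc par_root.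
    by have := par_neq TA yr; rewrite e eqxx.
- by move=> x; exists (val x).1.
- by move=> i v; rewrite pE pc.
- by move=> i j v h; apply: val_inj; rewrite !cE /above (negPf h).
by move=> i j v h /(congr1 val); rewrite !cE /above h; case.
Qed.

Section Copies.
Variables (A : rtgraph) (s : A) (B : rtgraph) (g : B -> A) (c : 'I_3 -> A -> B).
Hypothesis gP : branch_copies s g c.

Lemma copies_le i u v : u <~ v -> c i u <~ c i v.
Proof.
case/ancP=> k <-; elim: k => //= k IH; apply: tle_trans IH.
by rewrite -(bc_par gP) par_le.
Qed.

Lemma copies_below i v x : x <~ c i v -> x = c i (g x).
Proof.
case/ancP=> k <-; elim: k => /= [|k IH]; first by rewrite (bc_section gP).
by rewrite IH (bc_par gP) (bc_section gP).
Qed.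

(** Everything below [c i v] lies in copy [i], and distinct copies are disjoint strictly above
    [s]. *)
Lemma copies_meet i j v w x : i != j -> x <~ c i v -> x <~ c j w ->
  s <~ g x -> g x = s.
Proof.
move=> ij /copies_below xi /copies_below xj sx; apply/eqP; rewrite eq_sym.
apply: contraNT ij => ne; apply/eqP; apply: (bc_inj gP (v := g x)).
  by rewrite sx ne.
by rewrite -xi -xj.
Qed.

End Copies.

(** * Refinement of Lipschitz functions *)

Import Order.TTheory GRing.Theory Num.Theory.

Section Refine.
Local Open Scope ring_scope.

Definition lip (A : rtgraph) (phi : A -> int) :=
  forall v, -1 <= phi v - phi (par v) <= 1.

Definition incr (A : rtgraph) (phi : A -> int) := forall v, phi (par v) <= phi v.

Lemma lip_fe (A : rtgraph) (phi : A -> int) : is_tree A -> lip phi ->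
  forall u v, fe A u v -> -1 <= phi u - phi v <= 1.
Proof.
move=> TA L u v; rewrite (feE TA) => /or3P[]/eqP ->; [by lia| |].
  by have := L v; lia.
by have := L u; lia.
Qed.

Lemma incr_le (A : rtgraph) (phi : A -> int) : incr phi ->
  forall u v, u <~ v -> phi u <= phi v.
Proof.
move=> I u v /ancP[k <-]; elim: k => //= k IH; exact: le_trans (I _) IH.
Qed.

Lemma sstar_id (A : rtgraph) : in_TC A -> sstar (@id A).
Proof.
move=> TA; have [TA' _] := TA; apply: sstar_lc => //.
  by split=> // [b|u v uv]; [exists b|exists u, v].
by apply: lifting_confluent => // u c uc; exists c.
Qed.

Variables (A : rtgraph) (phi : A -> int).

Definition near3 (B : rtgraph) (g : B -> A) (psi : B -> int) :=
  forall b, -1 <= psi b - 3 * phi (g b) <= 1.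

(* Tripling [phi] gives edges of jump 3; each is repaired by two splittings.
   [e = 0]: no splitting done yet; [e = 1]: the lower third is already in place. *)
Definition steep (e : int) (B : rtgraph) (g : B -> A) (psi : B -> int) (v : B) :=
  exists d : int, [/\ d = 1 \/ d = -1, phi (g v) = phi (g (par v)) + d,
    psi v = 3 * phi (g v) & psi (par v) = 3 * phi (g (par v)) + e * d].

Definition flat (B : rtgraph) (psi : B -> int) (v : B) :=
  -1 <= psi v - psi (par v) <= 1.

Lemma steep_root e (B : rtgraph) (g : B -> A) psi v : is_tree B -> steep e g psi v -> v != froot B.
Proof.
move=> TB [d [hd h _ _]]; apply/eqP => vr; move: h; rewrite vr par_root //; lia.
Qed.

(** The lists name edges by their upper ends: those in [l1] may need two splittings, those in [l2]
    one, so twice the size of [l1] plus the size of [l2] drops at each splitting. The new vertex of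
    the first splitting is sent to the lower end and that of the second to the upper end, which
    keeps [near3] within 1. *)
Lemma refine_loop n (B : rtgraph) (g : B -> A) (psi : B -> int) (l1 l2 : seq B) :
  sstar g -> near3 g psi ->
  (forall v, [\/ flat psi v, steep 0 g psi v /\ v \in l1 | steep 1 g psi v /\ v \in l2]) ->
  (incr phi -> incr psi) ->
  ((size l1).*2 + size l2 <= n)%N ->
  exists (B' : rtgraph) (g' : B' -> A) (psi' : B' -> int),
    [/\ sstar g', near3 g' psi', lip psi' & incr phi -> incr psi'].
Proof.
elim: n B g psi l1 l2 => [|n IH] B g psi l1 l2 gS gN cl gI.
  case: l1 cl => // cl; case: l2 cl => // cl _; exists B, g, psi; split=> // v.
  by case: (cl v) => // -[].
have [[TB cB] _] := sstar_in_TC gS; have gP := sstar_tree_map gS.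
have incr_g v : incr phi -> phi (g (par v)) <= phi (g v).
  by move=> I; case: (tm_parent gP v) => ->.
case: l1 cl => [|v l1] cl; last first.
  (* A listed vertex that is not steep is discarded; the measure drops all the same. *)
  move=> hn; have [bad|ok] := pselect (steep 0 g psi v); last first.
    apply: (IH B g psi l1 l2) => // [u|]; last by move: hn => /=; lia.
    case: (cl u) => [fu|[bu]|[bu ul]]; [by constructor 1| |by constructor 3].
    by rewrite inE => /predU1P[e|ul]; [rewrite e in bu|constructor 2].
  have [B' [h [s [j hP]]]] := edge_split_exists false (conj TB cB) (steep_root TB bad).
  case: (bad) => d [hd h1 h2 h3].
  have hj := es_section hP; have sh := es_side hP; rewrite /= in sh.
  pose psi' u := if u == s then psi (par v) + d else psi (h u).
  have pj w : psi' (j w) = psi w by rewrite /psi' (negPf (es_new hP w)) hj.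
  have ps : psi' s = psi (par v) + d by rewrite /psi' eqxx.
  have cov u : u = s \/ exists2 w, u = j w & w = h u.
    have [->|us] := eqVneq u s; [by left|right].
    by exists (h u); rewrite // (es_cover hP us).
  apply: (IH B' (g \o h) psi' (map j l1) (j v :: map j l2)).
  - exact: sstar_comp (es_sstar hP) gS.
  - move=> u; case: (cov u) => [->|[w -> _]].
      by rewrite ps /= sh; lia.
    by rewrite pj /= hj.
  - move=> u; case: (cov u) => [->|[w -> _]].
      by constructor 1; rewrite /flat ps (es_par_new hP) pj; lia.
    have [->|wv] := eqVneq w v.
      constructor 3; rewrite mem_head; split=> //; exists d.
      by rewrite (es_par_split hP) pj ps /= hj sh; split=> //; lia.
    have pw := es_par_old hP wv.
    case: (cl w) => [fw|[[d' bw]]|[[d' bw] wl]].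
    + by constructor 1; rewrite /flat pw !pj.
    + rewrite inE (negPf wv) /= => wl; constructor 2; split; last exact: map_f.
      by exists d'; rewrite pw !pj /= !hj.
    + constructor 3; split; last by rewrite inE map_f ?orbT.
      by exists d'; rewrite pw !pj /= !hj.
  - move=> I u; have := incr_g v I; case: (cov u) => [->|[w -> _]].
      by rewrite (es_par_new hP) ps pj; lia.
    have [->|wv] := eqVneq w v; first by rewrite (es_par_split hP) ps pj; lia.
    by rewrite (es_par_old hP wv) !pj => _; exact: gI.
  - by move: hn; rewrite /= !size_map; lia.
case: l2 cl => [|v l2] cl hn.
  exists B, g, psi; split=> // v; by case: (cl v) => // -[].
have [bad|ok] := pselect (steep 1 g psi v); last first.
  apply: (IH B g psi [::] l2) => // u.
  case: (cl u) => [fu|[bu //]|[bu]]; first by constructor 1.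
  by rewrite inE => /predU1P[e|ul]; [rewrite e in bu|constructor 3].
have [B' [h [s [j hP]]]] := edge_split_exists true (conj TB cB) (steep_root TB bad).
case: (bad) => d [hd h1 h2 h3].
have hj := es_section hP; have sh := es_side hP; rewrite /= in sh.
(* The lower neighbour has three times the lower value plus [d], so a jump of [2 * d] remains, and
   the new value halves it. *)
pose psi' u := if u == s then psi v - d else psi (h u).
have pj w : psi' (j w) = psi w by rewrite /psi' (negPf (es_new hP w)) hj.
have ps : psi' s = psi v - d by rewrite /psi' eqxx.
have cov u : u = s \/ exists2 w, u = j w & w = h u.
  have [->|us] := eqVneq u s; [by left|right].
  by exists (h u); rewrite // (es_cover hP us).
apply: (IH B' (g \o h) psi' [::] (map j l2)).
- exact: sstar_comp (es_sstar hP) gS.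
- move=> u; case: (cov u) => [->|[w -> _]].
    by rewrite ps /= sh; lia.
  by rewrite pj /= hj.
- move=> u; case: (cov u) => [->|[w -> _]].
    by constructor 1; rewrite /flat ps (es_par_new hP) pj; lia.
  have [->|wv] := eqVneq w v.
    by constructor 1; rewrite /flat (es_par_split hP) pj ps; lia.
  have pw := es_par_old hP wv.
  case: (cl w) => [fw|[_ //]|[[d' bw]]].
  + by constructor 1; rewrite /flat pw !pj.
  rewrite inE (negPf wv) /= => wl; constructor 3; split; last exact: map_f.
  by exists d'; rewrite pw !pj /= !hj.
- move=> I u; have := incr_g v I; case: (cov u) => [->|[w -> _]].
    by rewrite (es_par_new hP) ps pj; lia.
  have [->|wv] := eqVneq w v; first by rewrite (es_par_split hP) ps pj; lia.
  by rewrite (es_par_old hP wv) !pj => _; exact: gI.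
- by move: hn; rewrite /= !size_map; lia.
Qed.

Lemma refine3 : in_TC A -> lip phi ->
  exists (B : rtgraph) (g : B -> A) (psi : B -> int),
    [/\ sstar g, near3 g psi, lip psi & incr phi -> incr psi].
Proof.
move=> TA L; apply: (refine_loop (g := id) (psi := fun v => 3 * phi v)
  (l1 := enum A) (l2 := [::]) (sstar_id TA) _ _ _ (leqnn _)).
- by move=> b; lia.
- move=> v; have := L v; have [e|h] := eqVneq (phi v) (phi (par v)).
    by move=> _; constructor 1; rewrite /flat /= e; lia.
  move=> hl; constructor 2; rewrite mem_enum; split=> //.
  by exists (phi v - phi (par v)); split; lia.
- by move=> I v; have := I v; lia.
Qed.

End Refine.

Local Open Scope classical_set_scope.

(** * Threads *)

(** Levels above [N] are chosen successively inside [P], levels below are images of [v]. Induction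
    on [N] shifts the sequence, so that choices are made only for [N = 0]. *)
Lemma thread_from N (F : nat -> rtgraph) (al : forall n, F n.+1 -> F n)
    (P : forall n, F n -> Prop) :
  (forall n, N <= n -> forall u : F n, P n u -> exists2 u', P n.+1 u' & al n u' = u) ->
  forall v : F N, P N v ->
  exists t, [/\ thread al t, t N = v & forall n, N <= n -> P n (t n)].
Proof.
elim: N F al P => [|N IH] F al P hP v Pv.
  pose sec n (u : F n) : F n.+1 := xget (froot _) (fun u' => P n.+1 u' /\ al n u' = u).
  pose t := nat_rect (fun n => F n) v sec.
  have secP n u : P n u -> P n.+1 (sec n u) /\ al n (sec n u) = u.
    move=> Pu; have [u' h1 h2] := hP n isT _ Pu.
    by apply: (@xgetPex _ (froot _) (fun u' => P n.+1 u' /\ al n u' = u)); exists u'.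
  have Pt n : P n (t n) by elim: n => // n Pn; case: (secP n _ Pn).
  by exists t; split=> // n; case: (secP n _ (Pt n)).
have [n|t [tt tN tP]] := IH (F \o S) (fun n => al n.+1) (fun n => P n.+1) _ v Pv.
  exact: (hP n.+1).
exists (fun n => if n is n'.+1 then t n' else al 0 (t 0)); split=> //.
  by case.
by case.
Qed.

(** Compactness of the limit: as [F n] is finite, the [n]-th coordinate of [T i] is constant on a
    set of the ultrafilter. *)
Lemma ultra_thread (I : Type) (U : set_system I) (F : nat -> rtgraph)
    (al : forall n, F n.+1 -> F n) (T : I -> forall n, F n) :
  UltraFilter U -> (forall i, thread al (T i)) ->
  exists c, thread al c /\ forall n, U [set i | T i n = c n].
Proof.
move=> UU hT.
have ex n : exists v : F n, U [set i | T i n = v].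
  apply: contrapT => /forallNP h.
  have hC v : U [set i | T i n <> v].
    by have [/h|] := in_ultra_setVsetC [set i | T i n = v] UU.
  have h2 : \forall i \near U, forall v, T i n <> v by exact: filter_forall.
  by case: (filter_ex h2) => i /(_ (T i n)).
pose c n : F n := xget (froot _) (fun v => U [set i | T i n = v]).
have cP n : U [set i | T i n = c n].
  by apply: (@xgetPex _ (froot _) (fun v => U [set i | T i n = v])); exact: ex.
exists c; split=> // n.
have [i [<- <-]] := filter_ex (filterI (cP n) (cP n.+1)).
exact: hT.
Qed.

Definition xle (F : nat -> rtgraph) (x y : forall n, F n) := forall n, x n <~ y n.
Notation "x <<~ y" := (xle x y) (at level 70).

Section Threads.
Variables (F : nat -> rtgraph) (al : forall n, F n.+1 -> F n).
Hypothesis HF : fraisse_limit al.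
Local Notation thr := (forall n, F n).
Local Notation thread := (thread al).
Implicit Types x y z c t : thr.

Lemma bond_sstar n : sstar (@al n). Proof. by case: HF. Qed.
Lemma bond_map n : tree_map (@al n). Proof. exact: sstar_tree_map (bond_sstar n). Qed.
Lemma F_TC n : in_TC (F n). Proof. by case: (sstar_in_TC (bond_sstar n)). Qed.
Lemma F_tree n : is_tree (F n). Proof. by case: (F_TC n). Qed.

(** Relations preserved by the bonding maps pass to lower levels, so between threads they need only
    be checked cofinally. *)
Lemma thread_down (R : forall n, F n -> F n -> Prop) x y :
  (forall n u v, R n.+1 u v -> R n (al u) (al v)) ->
  thread x -> thread y -> forall m k, m <= k -> R k (x k) (y k) -> R m (x m) (y m).
Proof.
move=> hR hx hy m k /subnK <-; elim: (k - m) => //= d IH h; apply: IH.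
by rewrite -hx -hy; exact: hR.
Qed.

Lemma thread_eq x y m k : thread x -> thread y -> m <= k -> x k = y k -> x m = y m.
Proof. by move=> hx hy; apply: (@thread_down (fun n u v => u = v)) => // n u v ->. Qed.

Lemma thread_le x y m k : thread x -> thread y -> m <= k -> x k <~ y k -> x m <~ y m.
Proof.
move=> hx hy; apply: (@thread_down (fun n u v => u <~ v)) => // n u v.
exact: (tm_le (bond_map n)).
Qed.

Lemma thread_fe x y m k : thread x -> thread y -> m <= k ->
  fe (F k) (x k) (y k) -> fe (F m) (x m) (y m).
Proof.
move=> hx hy; apply: (@thread_down (fun n u v => fe (F n) u v)) => // n u v.
exact: (tm_fe (bond_map n)).
Qed.

Lemma thread_ext x y : (forall n, x n = y n) -> x = y.
Proof. by move=> h; apply: functional_extensionality_dep. Qed.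

Lemma thread_eq_cofinal x y : thread x -> thread y ->
  (forall N, exists2 n, N <= n & x n = y n) -> x = y.
Proof.
by move=> hx hy h; apply: thread_ext => n; have [k nk] := h n; exact: thread_eq.
Qed.

Lemma thread_le_cofinal x y : thread x -> thread y ->
  (forall N, exists2 n, N <= n & x n <~ y n) -> x <<~ y.
Proof. by move=> hx hy h n; have [k nk] := h n; exact: thread_le. Qed.

Lemma thread_neq x y : thread x -> thread y -> x <> y ->
  exists N, forall n, N <= n -> x n != y n.
Proof.
move=> hx hy nxy; have [N hN] : exists N, x N != y N.
  apply: contrapT => h; apply: nxy; apply: thread_ext => n; apply/eqP.
  by apply: contraT => e; case: h; exists n.
exists N => n Nn; apply: contra hN => /eqP e; apply/eqP; exact: thread_eq e.
Qed.

Lemma thread_nle x y : thread x -> thread y -> ~ x <<~ y ->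
  exists N, forall n, N <= n -> ~~ (x n <~ y n).
Proof.
move=> hx hy nxy; have [N hN] : exists N, ~~ (x N <~ y N).
  apply: contrapT => h; apply: nxy => n.
  by apply: contraT => e; case: h; exists n.
by exists N => n Nn; apply: contra hN => e; exact: thread_le e.
Qed.

Lemma thread_nfe x y : thread x -> thread y -> ~ lim_edge x y ->
  exists N, forall n, N <= n -> ~~ fe (F n) (x n) (y n).
Proof.
move=> hx hy nxy; have [N hN] : exists N, ~~ fe (F N) (x N) (y N).
  apply: contrapT => h; apply: nxy => n.
  by apply: contraT => e; case: h; exists n.
by exists N => n Nn; apply: contra hN => e; exact: thread_fe e.
Qed.

Lemma edge_refl x : lim_edge x x. Proof. by move=> n; exact: fe_refl (F_tree n) _. Qed.
Lemma edge_sym x y : lim_edge x y -> lim_edge y x.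
Proof. by move=> h n; rewrite (fe_sym (F_tree n)); exact: h. Qed.
Lemma xle_refl x : x <<~ x. Proof. by move=> n; exact: connect0. Qed.
Lemma xle_trans y x z : x <<~ y -> y <<~ z -> x <<~ z.
Proof. by move=> a b n; apply: tle_trans (a n) (b n). Qed.
Lemma xle_anti x y : x <<~ y -> y <<~ x -> x = y.
Proof. by move=> a b; apply: thread_ext => n; exact: (tle_anti (F_tree n) (a n) (b n)). Qed.

Lemma xle_total x y z : thread x -> thread y -> x <<~ z -> y <<~ z -> x <<~ y \/ y <<~ x.
Proof.
move=> hx hy xz yz; have [|nxy] := pselect (x <<~ y); [by left|right].
have [N hN] := thread_nle hx hy nxy; apply: thread_le_cofinal => // M.
exists (maxn M N); first exact: leq_maxl.
by case: (tle_total (xz (maxn M N)) (yz _)) => // h; case/negP: (hN _ (leq_maxr M N)).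
Qed.

Lemma edge_comparable x y : thread x -> thread y -> lim_edge x y -> x <<~ y \/ y <<~ x.
Proof.
move=> hx hy e; have [|nxy] := pselect (x <<~ y); [by left|right].
have [N hN] := thread_nle hx hy nxy; apply: thread_le_cofinal => // M.
exists (maxn M N); first exact: leq_maxl.
case: (fe_comparable (F_tree _) (e (maxn M N))) => // h.
by case/negP: (hN _ (leq_maxr M N)).
Qed.

Lemma thread_through m (v : F m) : exists2 t, thread t & t m = v.
Proof.
have [n _ u _|t [h1 h2 _]] := thread_from (al := al) (P := fun _ _ => True) _ (v := v) I.
  by have [u' e] := tm_surj (bond_map n) u; exists u'.
by exists t.
Qed.

Definition root_thread : thr := fun n => froot (F n).

Lemma root_thread_thread : thread root_thread.
Proof. by move=> n; exact: tm_root (bond_map n). Qed.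

Lemma root_thread_le x : root_thread <<~ x.
Proof. by move=> n; exact: root_le (F_tree n) _. Qed.

(* the extension property (ii) of the Fraisse limit for the identity of [F m] *)
Lemma amalgam m (B : rtgraph) (g : B -> F m) : sstar g ->
  forall N, exists k (h : F k -> B), [/\ N <= k, sstar h & forall x, thread x -> x m = g (h (x k))].
Proof.
move=> gS N; case: HF => _ [_ /(_ (F m) B m id g (sstar_id (F_TC m)) gS)].
case=> k [h [hS hE]].
suff [h' [h'S h'E]] : exists h' : F (N + k) -> B, sstar h' /\
    forall x, thread x -> h' (x (N + k)%N) = h (x k).
  exists (N + k)%N, h'; split=> //; first exact: leq_addr.
  by move=> x hx; rewrite h'E // -hE.
elim: N => [|n [h' [h'S h'E]]]; first by exists h.
exists (h' \o @al (n + k)%N); split; first exact: sstar_comp (bond_sstar _) h'S.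
by move=> x hx; rewrite /= hx h'E.
Qed.

(** * Edges of the limit *)

Section EdgeSplit.
Variables (A : rtgraph) (b : A) (side : bool) (B : rtgraph) (g : B -> A) (s : B) (j : A -> B).
Hypotheses (TA : is_tree A) (hP : edge_split b side g s j).

Lemma es_inj u v : j u = j v -> u = v.
Proof. by move=> e; rewrite -(es_section hP u) e (es_section hP). Qed.

Lemma es_tree : is_tree B. Proof. exact: tm_dom (sstar_tree_map (es_sstar hP)). Qed.

Lemma es_child w : par w = s -> w != s -> w = j b.
Proof.
move=> pw ws; have e := es_cover hP ws; rewrite -e in pw *.
by have [->//|nb] := eqVneq (g w) b; move: (es_new hP (par (g w))); rewrite -(es_par_old hP nb) pw eqxx.
Qed.

Lemma es_nbr w : fe B s (j w) -> w = b \/ w = par b.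
Proof.
rewrite (feE es_tree) => /or3P[/eqP e|/eqP e|/eqP e].
- by have := es_new hP w; rewrite -e eqxx.
- by left; apply: es_inj; apply: es_child (es_new hP w); rewrite e.
- by right; apply: es_inj; rewrite e (es_par_new hP).
Qed.

Lemma es_nonadj : b != froot A -> ~~ fe B (j (par b)) (j b).
Proof.
move=> br; have np := par_neq TA br; rewrite (feE es_tree); apply/negP => /or3P[/eqP/es_inj e|/eqP|/eqP e].
- by rewrite e eqxx in np.
- by rewrite (es_par_split hP) => e; have := es_new hP (par b); rewrite e eqxx.
move: e; rewrite (es_par_old hP np) => /es_inj e.
have h := par_le (par b); rewrite -e in h.
by case/eqP: np; apply: (tle_anti TA) => //; exact: par_le.
Qed.

Lemma es_above w : s <~ w -> w = s \/ j b <~ w.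
Proof.
move=> sw; have [<-|ne] := eqVneq s w; [by left|right].
by have [u [pu us _ uw]] := child es_tree sw ne; rewrite -(es_child pu us).
Qed.

Lemma es_fibre w u : g w = u -> u != g s -> w = j u.
Proof.
move=> <-; have [->|ws _] := eqVneq w s; first by rewrite eqxx.
by rewrite (es_cover hP ws).
Qed.
End EdgeSplit.

(** Three distinct threads joined by two edges are refuted at one level: the new vertex placed over
    [y n] on the edge to [x n] must be used by [y], yet its only other neighbours are the two old
    ends, and [z n] is neither [x n] nor [y n]. *)
Lemma edge_trans x y z : thread x -> thread y -> thread z ->
  lim_edge x y -> lim_edge y z -> lim_edge x z.
Proof.
move=> hx hy hz xy yz; have [->//|nxy] := pselect (x = y).
have [<-//|nyz] := pselect (y = z); have [->|nxz] := pselect (x = z); first exact: edge_refl.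
have [N1 h1] := thread_neq hx hy nxy; have [N2 h2] := thread_neq hy hz nyz.
have [N3 h3] := thread_neq hx hz nxz; exfalso.
pose n := maxn N1 (maxn N2 N3).
have {}h1 : x n != y n by apply: h1; rewrite leq_maxl.
have {}h2 : y n != z n by apply: h2; rewrite /n leq_max leq_maxl orbT.
have {}h3 : x n != z n by apply: h3; rewrite /n !leq_max leqnn !orbT.
(* [b] is the upper end of the edge, and [side] is chosen so that the new vertex lies over [y n]. *)
have [b [side [br e1 e2]]] : exists b side, [/\ b != froot (F n),
    (if side then b else par b) = y n & (if side then par b else b) = x n].
  have := xy n; rewrite (feE (F_tree n)) /padj (negPf h1) /= => /orP[/eqP e|/eqP e].
    exists (y n), true; split=> //; apply: contra h1 => /eqP e'.
    by rewrite e e' (par_root (F_tree n)).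
  exists (x n), false; split=> //; apply: contra h1 => /eqP e'.
  by rewrite e e' (par_root (F_tree n)).
have [B [g [s [j hP]]]] := edge_split_exists side (F_TC n) br.
have TB := es_tree hP.
have [k [h [_ hS hE]]] := amalgam (es_sstar hP) n; have hM := sstar_tree_map hS.
have gs : g s = y n by rewrite (es_side hP).
have hxk : h (x k) = j (x n) by apply: (es_fibre hP); rewrite -?hE // gs.
have hzk : h (z k) = j (z n) by apply: (es_fibre hP); rewrite -?hE // gs eq_sym.
(* Otherwise [y] passes through the old vertex over [y n], which the splitting has made non-adjacent
   to that of [x n]. *)
have hyk : h (y k) = s.
  apply/eqP; apply: contraT => /(es_cover hP); rewrite -hE // => e.
  have := tm_fe hM (xy k); rewrite hxk -e -e1 -e2.
  have := es_nonadj (F_tree n) hP br.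
  by case: (side) => /negPf; rewrite ?(fe_sym TB (j b)) => ->.
have := tm_fe hM (yz k); rewrite hyk hzk => /(es_nbr hP) [] zb.
  by move: h2 h3; rewrite -e1 -e2 zb; case: (side); rewrite eqxx.
by move: h2 h3; rewrite -e1 -e2 zb; case: (side); rewrite eqxx.
Qed.

(** With the new vertex over [x n], the thread [x] must pass through it, and whatever lies strictly
    above it is above the old vertex over [c n]. So the tree does not branch at the lower end of an
    edge of the limit. *)
Lemma edge_above x c z : thread x -> thread c -> thread z ->
  lim_edge x c -> x <<~ c -> x <> c -> x <<~ z -> z = x \/ c <<~ z.
Proof.
move=> hx hc hz xc lxc nxc xz; have [|ncz] := pselect (c <<~ z); [by right|left].
have [N1 h1] := thread_neq hx hc nxc; have [N2 h2] := thread_nle hc hz ncz.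
apply: thread_eq_cofinal => // N; exists (maxn N (maxn N1 N2)); first exact: leq_maxl.
set n := maxn _ _.
have {}h1 : x n != c n by apply: h1; rewrite /n !leq_max leqnn !orbT.
have {}h2 : ~~ (c n <~ z n) by apply: h2; rewrite /n !leq_max leqnn !orbT.
have xp : x n = par (c n).
  by case: (fe_le (F_tree n) (xc n) (lxc n)) => // e; rewrite e eqxx in h1.
have cr : c n != froot (F n).
  by apply: contra h1 => /eqP e; rewrite xp e (par_root (F_tree n)).
have [B [g [s [j hP]]]] := edge_split_exists false (F_TC n) cr.
have [k [h [_ hS hE]]] := amalgam (es_sstar hP) n; have hM := sstar_tree_map hS.
have gs : g s = x n by rewrite (es_side hP).
have gM := sstar_tree_map (es_sstar hP).
have hck : h (c k) = j (c n) by apply: (es_fibre hP); rewrite -?hE // gs eq_sym.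
have hxk : h (x k) = s.
  apply/eqP; apply: contraT => /(es_cover hP); rewrite -hE // => e.
  have := tm_fe hM (xc k); rewrite hck -e xp.
  by rewrite (negPf (es_nonadj (F_tree n) hP cr)).
have := tm_le hM (xz k); rewrite hxk => /(es_above hP) [e|].
  by rewrite (hE z) // e gs.
by move/(tm_le gM); rewrite (es_section hP) -hE // (negPf h2).
Qed.

(** One ultrafilter serves both sequences, so both limits are approximated at the same indices and
    relations between [S m] and [T m] pass to them. *)
Lemma cluster2 (S T : nat -> thr) : (forall m, thread (S m)) -> (forall m, thread (T m)) ->
  exists c d, [/\ thread c, thread d &
    forall n N, exists m, [/\ N <= m, S m n = c n & T m n = d n]].
Proof.
move=> hS hT; have [U [UU sub]] := ultraFilterLemma (F := nbhs \oo) _.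
have [c [hc cP]] := ultra_thread UU hS; have [d [hd dP]] := ultra_thread UU hT.
exists c, d; split=> // n N.
have h : U [set m | N <= m] by apply: sub; exact: nbhs_infty_ge.
by have [m [[? ?] ?]] := filter_ex (filterI (filterI h (cP n)) (dP n)); exists m.
Qed.

(** At a fixed level the coordinates eventually descend in a finite order, so they settle at the
    value of a cluster point. *)
Lemma descending_limit (S : nat -> thr) : (forall m, thread (S m)) ->
  (forall m, S m.+1 m <~ S m m) ->
  exists2 c, thread c & forall n, exists M, forall m, M <= m -> S m n = c n.
Proof.
move=> hS dS; have [c [d [hc _ cP]]] := cluster2 hS hS.
exists c => // n; have desc m m' : n <= m -> m <= m' -> S m' n <~ S m n.
  move=> nm; elim: m' => [|m' IH]; first by rewrite leqn0 => /eqP ->; exact: connect0.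
  rewrite leq_eqVlt => /predU1P[<-|]; first exact: connect0.
  rewrite ltnS => mm'; apply: tle_trans (IH mm').
  by apply: thread_le (dS m') => //; exact: leq_trans mm'.
have [M [nM SM _]] := cP n n; exists M => m Mm.
have [m' [mm' Sm' _]] := cP n m; apply: (tle_anti (F_tree n)).
  by rewrite -SM; exact: desc.
by rewrite -Sm'; apply: desc => //; exact: leq_trans Mm.
Qed.

Lemma tree_meet (A : rtgraph) (u v : A) : is_tree A ->
  exists m, [/\ m <~ u, m <~ v & forall w, w <~ u -> w <~ v -> w <~ m].
Proof.
move=> TA; pose P k := iter k par u <~ v.
have exP : exists k, P k by case/ancP: (root_le TA u) => k e; exists k; rewrite /P e root_le.
exists (iter (ex_minn exP) par u); case: ex_minnP => k kP kmin; split=> //.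
  exact: fconnect_iter.
move=> _ /ancP[i <-] iv; have ki := kmin _ iv.
by rewrite -(subnK ki) iterD fconnect_iter.
Qed.

(** Levelwise meets need not form a thread, since the image of a meet may lie below the meet of the
    images; but they descend and have a limit. The last clause remembers that [c n] comes from a
    true meet at some level [m], which later forces [q c] into every continuum through both
    points. *)
Lemma thread_meet x y : thread x -> thread y -> exists c, [/\ thread c, c <<~ x, c <<~ y,
    (forall u, thread u -> u <<~ x -> u <<~ y -> u <<~ c) &
    forall n, exists m t, [/\ n <= m, thread t, t n = c n, (t m <~ x m) && (t m <~ y m) &
      forall w, w <~ x m -> w <~ y m -> w <~ t m]].
Proof.
move=> hx hy.
have ex m : exists t, [/\ thread t, t m <~ x m, t m <~ y m &
    forall w, w <~ x m -> w <~ y m -> w <~ t m].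
  have [v [h1 h2 h3]] := tree_meet (x m) (y m) (F_tree m).
  by have [t ht e] := thread_through v; exists t; rewrite e.
have [S SP] := choice ex.
have hS m : thread (S m) by case: (SP m).
have dS m : S m.+1 m <~ S m m.
  case: (SP m) => _ _ _; apply; rewrite -hS.
    by rewrite -hx; apply: (tm_le (bond_map m)); case: (SP m.+1).
  by rewrite -hy; apply: (tm_le (bond_map m)); case: (SP m.+1).
have [c hc cP] := descending_limit hS dS; exists c.
have cP' n : exists m, n <= m /\ S m n = c n.
  by have [M hM] := cP n; exists (maxn n M); rewrite leq_maxl hM ?leq_maxr.
split=> //.
- move=> n; have [m [nm <-]] := cP' n; apply: (thread_le (hS m) hx nm); by case: (SP m).
- move=> n; have [m [nm <-]] := cP' n; apply: (thread_le (hS m) hy nm); by case: (SP m).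
- move=> u hu ux uy n; have [m [nm <-]] := cP' n; apply: (thread_le hu (hS m) nm).
  by case: (SP m) => _ _ _; apply.
- move=> n; have [m [nm e]] := cP' n; exists m, (S m).
  by case: (SP m) => h1 h2 h3 h4; split=> //; rewrite h2 h3.
Qed.

End Threads.

(** * Ramification *)

Section Ramification.
Variables (F : nat -> rtgraph) (al : forall n, F n.+1 -> F n).
Hypothesis HF : fraisse_limit al.
Local Notation thr := (forall n, F n).
Local Notation thread := (thread al).

Definition below (A : rtgraph) (u v : A) := (u <~ v) && (u != v).

(* [s n] is the first vertex after [x n] towards [z n], and [a] is the limit of the [s n]. *)
Record branching (x z : thr) (s : thr) (a : thr) (N : nat) := Branching {
  br_par : forall n, N <= n -> par (s n) = x n /\ s n != x n;
  br_below : forall n, N <= n -> below (s n) (z n);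
  br_bond : forall n, N <= n -> al (s n.+1) <~ s n;
  br_thread : thread a;
  br_le : forall n, N <= n -> a n <~ s n;
  br_limit : forall k, exists M, forall m, M <= m ->
    forall t, thread t -> t m <~ s m -> t k <~ a k;
  br_edge : lim_edge a x }.

Lemma branching_exists x z : thread x -> thread z -> x <<~ z -> ~ lim_edge x z ->
  exists s a N, branching x z s a N.
Proof.
move=> hx hz xz nxz; have [N hN] := thread_nfe HF hx hz nxz.
(* Where [x m = z m] there is no first vertex and [z m] is taken instead; this happens only below
   level [N]. *)
pose Q m v := [/\ x m <~ v, v <~ z m & (x m == z m) && (v == z m) || (par v == x m) && (v != x m)].
have ex m : exists t, thread t /\ Q m (t m).
  have [v Qv] : exists v, Q m v.
    have [e|ne] := eqVneq (x m) (z m); first by exists (z m); split; rewrite ?e ?eqxx.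
    have [w [pw wx _ wz]] := child (F_tree HF m) (xz m) ne.
    by exists w; split; rewrite ?pw ?eqxx ?wx ?orbT // -pw par_le.
  by have [t ht e] := thread_through HF v; exists t; rewrite e.
have [S SP] := choice ex; pose s m := S m m.
have hS m : thread (S m) by case: (SP m).
have dS m : S m.+1 m <~ S m m.
  case: (SP m.+1) => h [+ + +]; case: (SP m) => _ [].
  rewrite -(h m); set u := S m.+1 m.+1; set v := S m m => xv vz alt xu uz alt'.
  have uz' : al u <~ z m by rewrite -hz; exact: (tm_le (bond_map HF m) uz).
  case/orP: alt => [/andP[_ /eqP -> //]|/andP[/eqP pv vx]].
  case/orP: alt' => [/andP[/eqP e /eqP e']|/andP[/eqP pu ux]].
    have e2 : x m = z m by rewrite -hx -hz e.
    rewrite e2 in xv vx; have vz' := tle_anti (F_tree HF m) vz xv.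
    by rewrite vz' eqxx in vx.
  (* The image of the first vertex one level up is either still [x m] or the first vertex at level
     [m]. *)
  have [e|e] := tm_parent (bond_map HF m) u; rewrite pu hx in e; first by rewrite -e.
  have [<-//|ne] := eqVneq (x m) (al u); rewrite eq_sym in ne.
  by rewrite (child_unique (F_tree HF m) (esym e) ne pv vx uz' vz).
have [a ha aP] := descending_limit HF hS dS.
have sN n : N <= n -> par (s n) = x n /\ s n != x n.
  move=> Nn; case: (SP n) => _ [_ _]; have := hN n Nn.
  case: eqVneq => [e|_ _ /= /andP[/eqP-> ->]] //.
  by rewrite e (fe_refl (F_tree HF n)).
exists s, a, N; split=> //.
- move=> n Nn; case: (SP n) => _ [_ sz _]; rewrite /below sz /=.
  apply: contra (hN n Nn) => /eqP <-; have [<- _] := sN n Nn.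
  exact: (fe_par (F_tree HF n) _).
- by move=> n Nn; rewrite /s hS; exact: dS.
- move=> n Nn; have [M hM] := aP n; rewrite -(hM _ (leq_maxr n M)).
  elim: (maxn n M) (leq_maxl n M) => [|m IH]; first by rewrite leqn0 => /eqP ->; exact: connect0.
  rewrite leq_eqVlt => /predU1P[<-|]; first exact: connect0.
  rewrite ltnS => nm; apply: tle_trans (IH nm).
  by apply: (thread_le HF _ _ nm (dS m)).
- move=> k; have [M hM] := aP k; exists (maxn k M) => m; rewrite geq_max => /andP[km Mm] t ht tm.
  by rewrite -(hM _ Mm); exact: (thread_le HF ht (hS m) km).
move=> n; have [M hM] := aP n; pose m := maxn N (maxn n M).
have nm : n <= m by rewrite /m !leq_max leqnn !orbT.
rewrite -(hM m); last by rewrite /m !leq_max leqnn !orbT.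
apply: (thread_fe HF (hS m) hx nm); have [<- _] := sN m (leq_maxl _ _).
by rewrite (fe_sym (F_tree HF m)); exact: (fe_par (F_tree HF m) _).
Qed.

Section Branch.
Variables (x z s a : thr) (N : nat).
Hypotheses (hx : thread x) (hz : thread z) (xz : x <<~ z) (bP : branching x z s a N).

Lemma br_x_le n : N <= n -> x n <~ s n.
Proof. by move=> Nn; have [<- _] := br_par bP Nn; exact: par_le. Qed.

Lemma br_down t m k : thread t -> N <= m -> m <= k -> t k <~ s k -> t m <~ s m.
Proof.
move=> ht Nm /subnK <-; elim: (k - m) => //= d IH h; apply: IH.
apply: tle_trans (br_bond bP _); last by apply: leq_trans Nm _; exact: leq_addl.
by rewrite -ht; exact: (tm_le (bond_map HF _) h).
Qed.

(** The lowest vertex over [b] between [x m] and [z m] is already above the first vertex [s m], and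
    by [tm_up] everything above [b] lifts to its subtree. *)
Lemma br_lift m (B : rtgraph) (h : F m -> B) b v : N <= m -> tree_map h ->
  h (x m) <~ b -> h (x m) != b -> b <~ h (z m) -> b <~ v ->
  exists2 w, s m <~ w & h w = v.
Proof.
move=> Nm hM xb nxb bz bv; have T := F_tree HF m.
have [g [xg nxg gz gb ng]] := tm_first hM (xz m) xb nxb bz.
have gv : h g <~ v by rewrite gb.
have [w [gw hw]] := tm_up hM (or_intror ng) gv.
exists w => //; apply: tle_trans gw.
have [u [pu ux ur ug]] := child T xg nxg.
have [ps sx] := br_par bP Nm; have /andP[sz _] := br_below bP Nm.
by rewrite (child_unique T ps sx pu ux sz (tle_trans ug gz)).
Qed.

Lemma br_step k w : thread w -> N <= k -> below (s k) (w k) ->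
  exists w', [/\ thread w', w' k = w k & below (s k.+1) (w' k.+1)].
Proof.
move=> hw Nk /andP[sw nsw]; have [ps sx] := br_par bP Nk.
have /andP[sz _] := br_below bP Nk.
have [|||v sv av] := br_lift (leqW Nk) (bond_map HF k) (b := s k) (v := w k) _ _ _ sw.
- by rewrite hx; exact: br_x_le.
- by rewrite hx eq_sym.
- by rewrite hz.
have [t ht e] := thread_through HF v; exists t; rewrite e; split=> //.
  by rewrite -ht e av.
rewrite /below sv /=; apply: contra nsw => /eqP e'; apply/eqP.
apply: (tle_anti (F_tree HF k)) => //.
by rewrite -av -e'; exact: (br_bond bP Nk).
Qed.

Lemma br_steps d k w : thread w -> N <= k -> below (s k) (w k) ->
  exists w', [/\ thread w', w' k = w k & below (s (d + k)) (w' (d + k)%N)].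
Proof.
move=> hw Nk bw; elim: d => [|d [w' [h1 h2 h3]]]; first by exists w.
have [|w'' [h1' h2' h3']] := br_step h1 _ h3; first by apply: leq_trans Nk (leq_addl _ _).
exists w''; split=> //; rewrite -h2.
exact: (thread_eq h1' h1 (leq_addl d k) h2').
Qed.

Variables z1 z2 : thr.
Hypotheses (hz1 : thread z1) (hz2 : thread z2)
  (freq : forall M, exists m, [/\ M <= m, below (s m) (z1 m) & below (s m) (z2 m)]).

(* Gluing three copies of the branch at [s m] leaves a copy used by neither [z1] nor
   [z2]; the lift of [w] into it meets both only over [s m]. *)
Lemma br_separate k w : thread w -> N <= k -> below (s k) (w k) ->
  exists k' w', [/\ k < k', thread w', w' k = w k, below (s k') (w' k') &
    forall u, thread u -> u k' <~ w' k' -> u k' <~ z1 k' \/ u k' <~ z2 k' -> u k <~ a k].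
Proof.
move=> hw Nk bw; have [M hM] := br_limit bP k.
have [m [mM b1 b2]] := freq (maxn k M).
have [km Mm] : k <= m /\ M <= m by move: mM; rewrite geq_max => /andP.
have Nm : N <= m := leq_trans Nk km.
have [w1 [hw1 e1 bw1]] := br_steps (m - k) hw Nk bw; rewrite subnK // in bw1.
have [B [g [c cP]]] := branch_copies_exists (s m) (F_TC HF m).
have [k' [h [mk' hS hE]]] := amalgam HF (bc_sstar cP) m.+1.
have hM' := sstar_tree_map hS; have T := F_tree HF m.
have [i1 e1'] := bc_cover cP (h (z1 k')); have [i2 e2'] := bc_cover cP (h (z2 k')).
rewrite -(hE _ hz1) in e1'; rewrite -(hE _ hz2) in e2'.
have [i [ni1 ni2]] : exists i : 'I_3, i != i1 /\ i != i2.
  have : #|[set i1; i2]%SET| < #|'I_3| by rewrite card_ord cards2; case: eqP.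
  rewrite ltnNge => /negP h3; apply: contrapT => h4; apply: h3.
  rewrite -cardsT subset_leq_card //; apply/fintype.subsetP => i _.
  rewrite !finset.inE; apply: contraT; rewrite negb_or => /andP[p1 p2].
  by case: h4; exists i.
have [ps sx] := br_par bP Nm; have /andP[sz nsz] := br_below bP Nm.
have [i0 e0] := bc_cover cP (h (x k')); rewrite -(hE _ hx) in e0.
have [i3 e3] := bc_cover cP (h (z k')); rewrite -(hE _ hz) in e3.
have base j j' : c j (s m) = c j' (s m) by apply: (bc_base cP); rewrite eqxx andbF.
have xi : h (x k') = c i (x m).
  rewrite e0; apply: (bc_base cP); apply/negP => /andP[h1 _].
  by rewrite (tle_anti T h1 (br_x_le Nm)) eqxx in sx.
have /andP[sw1 nsw1] := bw1.
have [||||w' sw' hw'] := br_lift (b := c i (s m)) (v := c i (w1 m)) (leq_trans Nm (ltnW mk')) hM'.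
- by rewrite xi; apply: (copies_le cP); exact: br_x_le.
- by rewrite xi; apply: contra sx => /eqP/(congr1 g); rewrite !(bc_section cP) => ->.
- by rewrite e3 (base i i3); exact: (copies_le cP).
- exact: (copies_le cP).
have [W hW e] := thread_through HF w'.
have Wm : W m = w1 m by rewrite (hE _ hW) e hw' (bc_section cP).
exists k', W; split=> //.
- exact: leq_ltn_trans km mk'.
- by rewrite -e1; exact: (thread_eq hW hw1 km).
- rewrite /below e sw' /=; apply: contra nsw1 => /eqP e'.
  apply/eqP; apply: (tle_anti T) => //; rewrite -Wm.
  by apply: (br_down hW Nm (ltnW mk')); rewrite e e'; exact: connect0.
move=> u hu uW uz; apply: (hM m Mm u hu).
have uw : h (u k') <~ c i (w1 m) by rewrite -hw' -e; exact: (tm_le hM' uW).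
have um : u m <~ w1 m.
  by rewrite (hE _ hu) -(bc_section cP i (w1 m)); exact: (tm_le (sstar_tree_map (bc_sstar cP)) uw).
case: (tle_total um sw1) => // su; suff -> : u m = s m by exact: connect0.
rewrite (hE _ hu) in su *; case: uz => /(tm_le hM'); rewrite ?e1' ?e2' => uz.
  exact: (copies_meet cP ni1 uw uz su).
exact: (copies_meet cP ni2 uw uz su).
Qed.

(** Each use of [br_separate] settles one level, so it is iterated along growing levels and the
    threads obtained are joined diagonally. The last clause has the form of [freq], which lets the
    new branch enter a further round. *)
Lemma br_new : exists w, [/\ thread w, a <<~ w, ~ lim_edge x w,
  (forall u, thread u -> u <<~ w -> u <<~ z1 \/ u <<~ z2 -> u <<~ a) &
  forall M, exists2 m, M <= m & below (s m) (w m)].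
Proof.
pose good (st : nat * thr) := [/\ thread st.2, N <= st.1 & below (s st.1) (st.2 st.1)].
pose R (st st' : nat * thr) := [/\ st.1 < st'.1, st'.2 st.1 = st.2 st.1 &
  forall u, thread u -> u st'.1 <~ st'.2 st'.1 -> u st'.1 <~ z1 st'.1 \/ u st'.1 <~ z2 st'.1 ->
    u st.1 <~ a st.1].
have ex (st : nat * thr) : exists st', good st -> good st' /\ R st st'.
  have [[hw Nk bw]|ng] := pselect (good st); last by exists st.
  have [k' [w' [h1 h2 h3 h4 h5]]] := br_separate hw Nk bw.
  exists (k', w') => _; split; split=> //=; exact: leq_trans Nk (ltnW h1).
have [f fP] := choice ex.
pose st i := iter i f (N, z).
have gst i : good (st i).
  by elim: i => [|i IH]; [split=> //=; exact: (br_below bP)|case: (fP _ IH)].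
have Rst i : R (st i) (st i.+1) by case: (fP _ (gst i)).
have hst i : thread (st i).2 by case: (gst i).
have ki i : i <= (st i).1.
  by elim: i => // i IH; case: (Rst i) => h _ _; exact: leq_ltn_trans h.
have kmono i j : i <= j -> (st i).1 <= (st j).1.
  move/subnK <-; elim: (j - i) => // d IH; rewrite addSn; apply: leq_trans IH _.
  by case: (Rst (d + i)) => /ltnW.
have agree i j n : i <= j -> n <= (st i).1 -> (st j).2 n = (st i).2 n.
  move=> /subnK <-; elim: (j - i) => // d IH ni; rewrite addSn -IH //.
  case: (Rst (d + i)) => _ e _; apply: (thread_eq (hst _) (hst _) _ e).
  exact: leq_trans ni (kmono _ _ (leq_addl d i)).
(* Stage [n] has reached at least level [n], and later stages keep the coordinates settled
   before. *)
pose w : thr := fun n => (st n).2 n.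
have wE i : w (st i).1 = (st i).2 (st i).1 by rewrite /w (agree i).
have hw : thread w.
  by move=> n; rewrite /w (hst n.+1) (agree n).
have bw i : below (s (st i).1) (w (st i).1) by rewrite wE; case: (gst i).
exists w; split=> //.
- apply: (thread_le_cofinal HF (br_thread bP) hw) => n; exists (st n).1 => //.
  case: (gst n) => _ Nn _; apply: tle_trans (br_le bP Nn) _.
  by case/andP: (bw n).
- move=> e; have [_ Nn _] := gst 0; have [ps sx] := br_par bP Nn.
  have /andP[sw nsw] := bw 0; have T := F_tree HF (st 0).1.
  have xw := tle_trans (br_x_le Nn) sw.
  case: (fe_le T (e _) xw) => h.
    by rewrite -h in sw; rewrite (tle_anti T sw (br_x_le Nn)) eqxx in sx.
  have := le_par sw nsw; rewrite -h => h2.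
  by rewrite (tle_anti T h2 (br_x_le Nn)) eqxx in sx.
- move=> u hu uw uz n; apply: (thread_le HF hu (br_thread bP) (ki n)).
  case: (Rst n) => _ _; apply=> //; first by rewrite -wE; exact: uw.
  by case: uz => h; [left|right]; exact: h.
by move=> M; exists (st M).1.
Qed.

End Branch.

(** The first new branch is kept apart from [z], the second from [z] and the first. All of them part
    at [a], which is joined to [x] by an edge of the limit and so gives the same point of the
    realization. *)
Lemma trident x z : thread x -> thread z -> x <<~ z -> ~ lim_edge x z ->
  exists a z2 z3, [/\ thread a, thread z2, thread z3 & lim_edge a x] /\
    [/\ a <<~ z, a <<~ z2, a <<~ z3, ~ lim_edge x z2 & ~ lim_edge x z3] /\
    forall u, thread u -> [\/ u <<~ z /\ u <<~ z2, u <<~ z /\ u <<~ z3 | u <<~ z2 /\ u <<~ z3] ->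
      u <<~ a.
Proof.
move=> hx hz xz nxz; have [s [a [N bP]]] := branching_exists hx hz xz nxz.
have az : a <<~ z.
  apply: (thread_le_cofinal HF (br_thread bP) hz) => n; exists (maxn n N); first exact: leq_maxl.
  have Nn := leq_maxr n N; apply: tle_trans (br_le bP Nn) _.
  by case/andP: (br_below bP Nn).
have [|z2 [h2 az2 nx2 m2 f2]] := br_new hx hz xz bP hz hz.
  by move=> M; exists (maxn M N); rewrite leq_maxl; split=> //; apply: (br_below bP); exact: leq_maxr.
have [|z3 [h3 az3 nx3 m3 _]] := br_new hx hz xz bP hz h2.
  move=> M; have [m Mm bm] := f2 (maxn M N); move: Mm; rewrite geq_max => /andP[Mm Nm].
  by exists m; split=> //; exact: (br_below bP).
exists a, z2, z3; split; first by split=> //; [exact: br_thread bP|exact: br_edge bP].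
split=> // u hu [[h1 h1']|[h1 h1']|[h1 h1']].
- by apply: m2 => //; left.
- by apply: m3 => //; left.
- by apply: m3 => //; right.
Qed.

End Ramification.

Local Open Scope ring_scope.
Local Notation R := Rdefinitions.R.

(** * Real functions on the limit *)

Section Sums.
Implicit Types (u v w : nat -> R).

Lemma nested_sup (a b : nat -> R) :
  (forall n, a n <= a n.+1) -> (forall n, b n.+1 <= b n) -> (forall n, a n <= b n) ->
  forall n, a n <= sup (range a) <= b n.
Proof.
move=> ha hb ab.
have am i j : (i <= j)%N -> a i <= a j.
  by move=> /subnK <-; elim: (j - i)%N => // d IH; exact: le_trans IH (ha _).
have bm i j : (i <= j)%N -> b j <= b i.
  by move=> /subnK <-; elim: (j - i)%N => // d IH; exact: le_trans (hb _) IH.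
have abm i j : a i <= b j.
  have [/am h|/ltnW/bm h] := leqP i j; first exact: le_trans h (ab j).
  exact: le_trans (ab i) h.
move=> n; apply/andP; split.
  by apply: ub_le_sup; [exists (b 0) => _ [i _ <-]|exists n].
by apply: ge_sup; [exists (a 0), 0%N|move=> _ [i _ <-]].
Qed.

Lemma small_pow (e : R) : 0 < e -> exists n, 2 / 2 ^+ n < e.
Proof.
move=> e0; have [n hn] : exists n : nat, 2 / e < n%:R.
  exists (Num.bound (2 / e)); apply: archi_boundP.
  by apply: divr_ge0 => //; exact: ltW.
exists n; rewrite ltr_pdivrMr ?exprn_gt0 //.
have h : (n%:R : R) <= 2 ^+ n by rewrite -natrX ler_nat ltnW // ltn_expl.
move: hn; rewrite ltr_pdivrMr // => hn; apply: lt_le_trans hn _.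
by rewrite mulrC ler_wpM2l // ltW.
Qed.

Definition psum u n : R := \sum_(i < n) u i / 2 ^+ i.
Definition wsum u : R := sup (range (psum u)).
Definition unit_seq u := forall i, 0 <= u i <= 1.

Lemma psumS u n : psum u n.+1 = psum u n + u n / 2 ^+ n.
Proof. by rewrite /psum big_ord_recr. Qed.

Lemma pow_pos n : 0 < (2 : R) ^- n.
Proof. by rewrite invr_gt0 exprn_gt0. Qed.

Lemma powS n : (2 : R) ^- n.+1 = 2 ^- n / 2.
Proof. by rewrite exprS invfM mulrC. Qed.

(** The weights from index [n] on add up to [2 / 2 ^+ n], which bounds the missing tail. *)
Lemma wsum_bounds u : unit_seq u -> forall n, psum u n <= wsum u <= psum u n + 2 / 2 ^+ n.
Proof.
move=> hu; apply: nested_sup => n.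
- have /andP[h _] := hu n; have p := pow_pos n.
  by rewrite psumS lerDl mulr_ge0 // ltW.
- have /andP[_ h] := hu n; have p := pow_pos n.
  rewrite psumS powS; have : u n * 2 ^- n <= 2 ^- n by rewrite ler_piMl // ltW.
  by lra.
- have p := pow_pos n; lra.
Qed.

Lemma wsum_tri u v w : unit_seq u -> unit_seq v -> unit_seq w ->
  (forall i, u i <= v i + w i) -> wsum u <= wsum v + wsum w.
Proof.
move=> hu hv hw h; apply/ler_addgt0Pr => e e0; have [n hn] := small_pow e0.
have /andP[_ u1] := wsum_bounds hu n; have /andP[v1 _] := wsum_bounds hv n.
have /andP[w1 _] := wsum_bounds hw n.
have : psum u n <= psum v n + psum w n.
  rewrite /psum -big_split /=; apply: ler_sum => i _.
  by rewrite -mulrDl ler_wpM2r // ltW // pow_pos.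
by lra.
Qed.

Lemma wsum0 : wsum (fun=> 0) = 0.
Proof.
have h : unit_seq (fun=> 0) by move=> i; rewrite lexx ler01.
have p0 n : psum (fun=> 0) n = 0 by rewrite /psum big1 // => i _; rewrite mul0r.
have /andP[h1 _] := wsum_bounds h 0; rewrite p0 in h1.
apply/eqP; rewrite eq_le h1 andbT; apply/ler_addgt0Pr => e e0.
have [n hn] := small_pow e0; have /andP[_] := wsum_bounds h n; rewrite p0; lra.
Qed.

Lemma wsum_le u v : unit_seq u -> unit_seq v -> (forall i, u i <= v i) -> wsum u <= wsum v.
Proof.
move=> hu hv h; rewrite -[leRHS]addr0 -wsum0; apply: wsum_tri => // i; last by rewrite addr0.
by rewrite lexx ler01.
Qed.

(** The gap at index [i] is a fixed amount, and far enough partial sums leave a tail smaller than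
    it. *)
Lemma wsum_lt u v i : unit_seq u -> unit_seq v -> (forall i, u i <= v i) -> u i < v i ->
  wsum u < wsum v.
Proof.
move=> hu hv h hi; have p := pow_pos i.
have e0 : 0 < (v i - u i) * 2 ^- i by rewrite mulr_gt0 // subr_gt0.
have [n hn] := small_pow e0.
have grow m : (i < m)%N -> psum u m + (v i - u i) * 2 ^- i <= psum v m.
  elim: m => // m IH; rewrite ltnS leq_eqVlt => /predU1P[<-|im]; rewrite !psumS.
    have : psum u i <= psum v i.
      by apply: ler_sum => k _; rewrite ler_wpM2r // ltW // pow_pos.
    by lra.
  have := IH im; have : u m * 2 ^- m <= v m * 2 ^- m by rewrite ler_wpM2r // ltW // pow_pos.
  by lra.
pose m := maxn n i.+1; have im : (i < m)%N by exact: leq_maxr.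
have /andP[_ u1] := wsum_bounds hu m; have /andP[v1 _] := wsum_bounds hv m.
have : 2 * 2 ^- m <= 2 * 2 ^- n :> R.
  by rewrite ler_wpM2l // lef_pV2 ?posrE ?exprn_gt0 // ler_weXn2l ?ler1n // leq_maxl.
by have := grow m im; lra.
Qed.

(** All weights add up to 2, so the first [n] terms contribute less than [e / 4], while [n] is taken
    with a tail below [e / 2]. *)
Lemma wsum_small (e : R) : 0 < e -> exists n, forall u, unit_seq u ->
  (forall i, (i < n)%N -> u i <= e / 8) -> wsum u < e.
Proof.
move=> e0; have e2 : 0 < e / 2 by lra.
have [n hn] := small_pow e2; exists n => u hu h.
have /andP[_ u1] := wsum_bounds hu n.
have : psum u n <= e / 8 * (2 - 2 * 2 ^- n).
  move: h; elim: (n) => [|k IH] h; first by rewrite /psum big_ord0 expr0 invr1; lra.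
  have hk : u k * 2 ^- k <= e / 8 * 2 ^- k by rewrite ler_wpM2r ?h // ltW // pow_pos.
  have hI := IH (fun i ik => h i (ltnW ik)).
  by rewrite psumS powS; lra.
have p : 0 < e * 2 ^- n by rewrite mulr_gt0 // pow_pos.
by lra.
Qed.

End Sums.

Definition clip (t : R) : R := if t <= 0 then 0 else if 1 <= t then 1 else t.

Lemma clip01 t : 0 <= clip t <= 1.
Proof. by rewrite /clip; case: (leP t 0) => h1; [lra|case: (leP 1 t) => h2; lra]. Qed.

Lemma clip_le s t : s <= t -> clip s <= clip t.
Proof.
rewrite /clip => st; case: (leP s 0) => h1; case: (leP t 0) => h2; case: (leP 1 s) => h3;
 case: (leP 1 t) => h4; lra.
Qed.

Lemma clip_dist s t : `|clip s - clip t| <= `|s - t|.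
Proof.
wlog st : s t / s <= t.
  by move=> h; case: (leP s t) => [/h//|/ltW/h]; rewrite distrC [leRHS]distrC.
rewrite distrC [leRHS]distrC !ger0_norm ?subr_ge0 ?clip_le //; move: st; rewrite /clip => st.
by case: (leP s 0) => h1; case: (leP t 0) => h2; case: (leP 1 s) => h3;
 case: (leP 1 t) => h4; lra.
Qed.

(** * Limits of refined functions, the radial function and the metric *)

Section LimitFunctions.
Variables (F : nat -> rtgraph) (al : forall n, F n.+1 -> F n).
Hypothesis HF : fraisse_limit al.
Local Notation thr := (forall n, F n).
Local Notation thread := (thread al).

(** Uniform continuity on the limit, where agreeing in coordinate [k] plays the part of being
    close. *)
Definition modulus (h : thr -> R) := forall e : R, 0 < e ->
  exists k, forall x y, thread x -> thread y -> x k = y k -> `|h x - h y| < e.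
Definition edge_inv (h : thr -> R) := forall x y, thread x -> thread y -> lim_edge x y -> h x = h y.
Definition monotone (h : thr -> R) := forall x y, thread x -> thread y -> x <<~ y -> h x <= h y.

Lemma refine_thread k (psi : F k -> int) : lip psi ->
  exists k' (psi' : F k' -> int), [/\ (k <= k')%N, lip psi',
    (forall x, thread x -> -1 <= psi' (x k') - 3 * psi (x k) <= 1) & incr psi -> incr psi'].
Proof.
move=> L; have [B [g [p [gS nr Lp Ip]]]] := refine3 (F_TC HF k) L.
have [k' [h [kk' hS hE]]] := amalgam HF gS k; have hM := sstar_tree_map hS.
exists k', (p \o h); split=> //.
- by move=> v /=; case: (tm_parent hM v) => ->; [lia|exact: Lp].
- by move=> x hx /=; rewrite (hE _ hx); exact: nr.
by move=> /Ip I v /=; case: (tm_parent hM v) => -> //; exact: I.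
Qed.

(** [h] is the limit of the refined integer functions divided by [3 ^+ i]. Threads joined by an edge
    have integer values differing by at most 1 at every stage, so the scaled difference vanishes. *)
Lemma limit_function m (phi : F m -> int) : lip phi -> exists h : thr -> R,
  [/\ forall x, thread x -> `|h x - (phi (x m))%:~R| <= 1 / 2, edge_inv h, modulus h &
      incr phi -> monotone h].
Proof.
move=> L0; pose st0 : {k & F k -> int} := existT _ m phi.
pose val_ (st : {k & F k -> int}) (x : thr) : R := (projT2 st (x (projT1 st)))%:~R.
pose P (st st' : {k & F k -> int}) := lip (projT2 st) -> lip (projT2 st') /\
  (forall x, thread x -> -1 <= val_ st' x - 3 * val_ st x <= 1) /\
  (incr (projT2 st) -> incr (projT2 st')).
have ex st : exists st', P st st'.
  have [L|nL] := pselect (lip (projT2 st)); last by exists st.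
  have [k' [psi' [_ L' nr' I']]] := refine_thread L.
  exists (existT _ k' psi') => _; split=> //; split=> // x hx; have := nr' x hx.
  rewrite /val_ /=; set a := psi' _; set b := projT2 st _ => hab.
  have -> : 3 * b%:~R = (3 * b)%:~R :> R by rewrite intrM.
  by rewrite -intrB -[-1]/((-1)%:~R) -[1]/(1%:~R) !ler_int.
have [f fP] := choice ex; pose st i := iter i f st0.
have Lst i : lip (projT2 (st i)) by elim: i => //= i /fP[].
have Ist i : incr phi -> incr (projT2 (st i)).
  by move=> I; elim: i => //= i; case: (fP _ (Lst i)) => _ [_]; apply.
have step i x : thread x -> -1 <= val_ (st i.+1) x - 3 * val_ (st i) x <= 1.
  by case: (fP _ (Lst i)) => _ [+ _]; exact.
pose c i : R := 3 ^- i.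
have c0 i : 0 < c i by rewrite /c invr_gt0 exprn_gt0.
have cS i : c i = 3 * c i.+1.
  by rewrite /c exprS invfM mulrA divff ?mul1r.
(* The half-width [c i / 2] is the sum of all later corrections [c i.+1 + c i.+2 + ...], so the
   intervals from [a x i] to [b x i] are nested. *)
pose a x i := val_ (st i) x * c i - c i / 2.
pose b x i := val_ (st i) x * c i + c i / 2.
pose h x := sup (range (a x)).
have hb x : thread x -> forall i, a x i <= h x <= b x i.
  move=> hx; apply: nested_sup => i.
  - have /andP[s1 _] := step i x hx; rewrite /a (cS i).
    have : 0 <= c i.+1 * (val_ (st i.+1) x - 3 * val_ (st i) x + 1).
      by apply: mulr_ge0; [exact: ltW|lra].
    by lra.
  - have /andP[_ s1] := step i x hx; rewrite /b (cS i).
    have : 0 <= c i.+1 * (1 - (val_ (st i.+1) x - 3 * val_ (st i) x)).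
      by apply: mulr_ge0; [exact: ltW|lra].
    by lra.
  - rewrite /a /b; have := c0 i; lra.
have close (x y : thr) (C : R) : 0 <= C -> (forall i, h x - h y <= C * c i) -> h x <= h y.
  move=> C0 hc; apply/ler_addgt0Pr => e e0.
  have [|n hn] := small_pow (e := e / (C + 1)); first by rewrite divr_gt0 // ltr_wpDl.
  have := hc n; have p := pow_pos n.
  have c2 : c n <= 2 ^- n by rewrite /c lef_pV2 ?posrE ?exprn_gt0 // lerXn2r ?nnegrE // ler_nat.
  move: hn; rewrite ltr_pdivlMr ?ltr_wpDl // => hn hcn.
  have : C * c n <= C * 2 ^- n by rewrite ler_wpM2l.
  by nra.
exists h; split.
- move=> x hx; have := hb x hx 0; rewrite /a /b /c /= expr0 invr1 /val_ /= => /andP[h1 h2].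
  by rewrite ler_norml; lra.
- suff half x y : thread x -> thread y -> lim_edge x y -> h x <= h y.
    move=> x y hx hy e; apply/eqP; rewrite eq_le !half //; exact: (edge_sym HF e).
  move=> hx hy e; apply: (close _ _ 2) => // i.
  have := hb x hx i; have := hb y hy i; rewrite /a /b => /andP[h1 _] /andP[_ h2].
  have := lip_fe (F_tree HF _) (Lst i) (e (projT1 (st i))) => /andP[_].
  rewrite -(ler_int R) intrB => h3; have h4 : val_ (st i) x - val_ (st i) y <= 1 by exact: h3.
  have : 0 <= c i * (1 - (val_ (st i) x - val_ (st i) y)) by apply: mulr_ge0; [exact: ltW|lra].
  by lra.
- move=> e e0; have [n hn] := small_pow e0; exists (projT1 (st n)) => x y hx hy exy.
  have := hb x hx n; have := hb y hy n; rewrite /a /b.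
  have -> : val_ (st n) x = val_ (st n) y by rewrite /val_ exy.
  move=> /andP[h1 h2] /andP[h3 h4]; have p := pow_pos n.
  have c2 : c n <= 2 ^- n by rewrite /c lef_pV2 ?posrE ?exprn_gt0 // lerXn2r ?nnegrE // ler_nat.
  by rewrite ltr_norml; lra.
move=> I x y hx hy xy; apply: (close _ _ 1) => // i.
have := hb x hx i; have := hb y hy i; rewrite /a /b => /andP[h1 _] /andP[_ h2].
have := incr_le (Ist i I) (xy (projT1 (st i))); rewrite -(ler_int R) => h3.
have h4 : val_ (st i) x <= val_ (st i) y by exact: h3.
have : 0 <= c i * (val_ (st i) y - val_ (st i) x) by apply: mulr_ge0; [exact: ltW|lra].
by lra.
Qed.

Lemma height_gap (A : rtgraph) (u v : A) : is_tree A -> u <~ v -> ~~ fe A u v ->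
  (height (froot A) par u + 2 <= height (froot A) par v)%N.
Proof.
move=> TA uv nuv; have nE : u != v by apply: contra nuv => /eqP ->; exact: fe_refl.
have vr : v != froot A.
  by apply: contra nE => /eqP e; rewrite e in uv *; rewrite (le_root TA uv).
have np : u != par v by apply: contra nuv => /eqP ->; exact: fe_par.
rewrite (height_parent (root_le TA) vr) addn2 !ltnS ltn_neqAle.
have upv := le_par uv nE.
rewrite (anc_height (par_root TA) (root_le TA) upv) andbT; apply: contra np => /eqP e.
by rewrite (anc_height_eq (par_root TA) (root_le TA) upv e).
Qed.

Definition admissible (h : thr -> R) :=
  [/\ forall x, 0 <= h x <= 1, edge_inv h & modulus h].

(** The limit function stays within 1/2 of [phi], so values at most 0 and at least 2 become values
    at most 1/2 and at least 3/2, and the latter are clipped to 1. *)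
Lemma admissible_clip m (phi : F m -> int) : lip phi -> exists h, [/\ admissible h,
    forall x, thread x -> phi (x m) <= 0 -> h x <= 1 / 2,
    forall x, thread x -> 2 <= phi (x m) -> h x = 1 &
    incr phi -> monotone h].
Proof.
move=> L; have [h [nr ei mo mn]] := limit_function L.
exists (fun x => clip (h x)); split.
- split=> [x|x y hx hy e|e e0]; [exact: clip01|by rewrite (ei x y)|].
  have [k hk] := mo e e0; exists k => x y hx hy exy.
  exact: le_lt_trans (clip_dist _ _) (hk _ _ hx hy exy).
- move=> x hx p0; have := nr x hx; rewrite ler_norml => /andP[_ h1].
  have h2 : (phi (x m))%:~R <= 0 :> R by rewrite lerz0.
  by rewrite /clip; case: (leP (h x) 0) => h3; [lra|case: (leP 1 (h x)) => h4; lra].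
- move=> x hx p0; have := nr x hx; rewrite ler_norml => /andP[h1 _].
  have h2 : 2 <= (phi (x m))%:~R :> R by rewrite -[2]/(2%:~R) ler_int.
  by rewrite /clip; case: (leP (h x) 0) => h3; [lra|case: (leP 1 (h x)) => h4; lra].
by move=> /mn I x y hx hy xy; apply: clip_le; exact: I.
Qed.

Lemma countable_family (I : countType) (P : (thr -> R) -> Prop) (f : I -> thr -> R) :
  (forall i, P (f i)) -> P (fun=> 0) ->
  exists g : nat -> thr -> R, (forall n, P (g n)) /\ forall i, exists n, g n = f i.
Proof.
move=> hf h0; exists (fun n => if unpickle n is Some i then f i else fun=> 0).
split=> [n|i]; first by case: unpickle.
by exists (pickle i); rewrite pickleK.
Qed.

Lemma admissible0 : admissible (fun=> 0).
Proof.
split=> [x|//|e e0]; first by rewrite lexx ler01.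
by exists 0%N => x y _ _ _; rewrite subrr normr0.
Qed.

Lemma wsum_modulus (G : nat -> thr -> thr -> R) :
  (forall x y, unit_seq (fun i => G i x y)) ->
  (forall i e, 0 < e -> exists k, forall x y, thread x -> thread y -> x k = y k -> G i x y <= e) ->
  forall e, 0 < e -> exists k, forall x y, thread x -> thread y -> x k = y k ->
    wsum (fun i => G i x y) < e.
Proof.
move=> hu hG e e0; have [n hn] := wsum_small e0.
suff [k hk] : exists k, forall x y, thread x -> thread y -> x k = y k ->
    forall i, (i < n)%N -> G i x y <= e / 8.
  by exists k => x y hx hy exy; apply: hn => // i; exact: hk.
elim: n {hn} => [|n [k hk]]; first by exists 0%N.
have [|k' hk'] := hG n (e / 8); first by lra.
exists (maxn k k') => x y hx hy exy i; rewrite ltnS leq_eqVlt => /predU1P[->|ni].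
  by apply: hk' => //; exact: (thread_eq hx hy (leq_maxr k k') exy).
by apply: hk => //; exact: (thread_eq hx hy (leq_maxl k k') exy).
Qed.

(** The summands come from heights at some level, shifted by a threshold. If [x] is below [y] and
    not adjacent to it at level [N], their heights there differ by at least 2, and the threshold
    given by the height of [x N] tells them apart. *)
Lemma radial_function : exists lam : thr -> R, [/\ edge_inv lam, modulus lam, monotone lam &
  forall x y, thread x -> thread y -> x <<~ y -> ~ lim_edge x y -> lam x < lam y].
Proof.
pose phi (i : nat * nat) (v : F i.1) : int := (height (froot (F i.1)) par v)%:Z - i.2%:Z.
have hpar i (v : F i) : (height (froot (F i)) par (par v) <= height (froot (F i)) par v <=
    (height (froot (F i)) par (par v)).+1)%N.
  have [->|vr] := eqVneq v (froot (F i)).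
    by rewrite (par_root (F_tree HF i)) leqnn leqnSn.
  by rewrite (height_parent (root_le (F_tree HF i)) vr) leqnn leqnSn.
have L i : lip (@phi i) by move=> v; have := hpar _ v; rewrite /phi; lia.
have I i : incr (@phi i) by move=> v; have := hpar _ v; rewrite /phi; lia.
have ex i : exists h, [/\ admissible h, monotone h,
    forall x, thread x -> phi i (x i.1) <= 0 -> h x <= 1 / 2 &
    forall x, thread x -> 2 <= phi i (x i.1) -> h x = 1].
  have [h [h1 h2 h3 h4]] := admissible_clip (L i).
  by exists h; split=> //; apply: h4.
have [f fP] := choice ex.
have [||g [gP gf]] := @countable_family (nat * nat)%type
  (fun h => admissible h /\ monotone h) f.
- by move=> i; case: (fP i).
- by split; [exact: admissible0|move=> x y _ _ _].
have gu x : unit_seq (g^~ x) by move=> i; case: (gP i) => -[].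
have gle x y : thread x -> thread y -> x <<~ y -> forall i, g i x <= g i y.
  by move=> hx hy xy i; case: (gP i) => _ mo; exact: mo.
pose lam x := wsum (g^~ x).
exists lam; split.
- move=> x y hx hy e; congr wsum; apply: functional_extensionality_dep => i.
  by case: (gP i) => -[_ ei _] _; exact: ei.
- pose G i x y := `|g i x - g i y|.
  have Gu x y : unit_seq (fun i => G i x y).
    move=> i; have /andP[h1 h2] := gu x i; have /andP[h3 h4] := gu y i.
    by rewrite normr_ge0 ler_norml; lra.
  have hG i e : 0 < e -> exists k, forall x y, thread x -> thread y -> x k = y k -> G i x y <= e.
    move=> e0; case: (gP i) => -[_ _ /(_ e e0) [k hk]] _; exists k => x y hx hy exy.
    exact: ltW (hk _ _ hx hy exy).
  move=> e e0; have [k hk] := wsum_modulus Gu hG e0; exists k => x y hx hy exy; have hkxy := hk _ _ hx hy exy.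
  have h1 : lam x <= lam y + wsum (fun i => G i x y).
    by apply: wsum_tri => // i; rewrite -lerBlDl; exact: ler_norm.
  have h2 : lam y <= lam x + wsum (fun i => G i x y).
    by apply: wsum_tri => // i; rewrite -lerBlDl /G distrC; exact: ler_norm.
  by rewrite ltr_norml; lra.
- by move=> x y hx hy xy; apply: wsum_le => //; exact: gle.
move=> x y hx hy xy nxy; have [N hN] := thread_nfe HF hx hy nxy.
have gap := height_gap (F_tree HF N) (xy N) (hN N (leqnn N)).
have [n gn] := gf (N, height (froot (F N)) par (x N)).
apply: (wsum_lt (i := n)) => //; first exact: gle.
rewrite gn; case: (fP (N, height (froot (F N)) par (x N))) => _ _ h1 h2.
have := h1 x hx; rewrite {1}/phi /= subrr lexx => /(_ isT) hx1.
by rewrite (h2 y hy); [lra|rewrite /phi /=; lia].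
Qed.

Lemma limit_metric : exists d : thr -> thr -> R, [/\
  (forall x y, thread x -> thread y -> d x y = 0 <-> lim_edge x y),
  (forall x y, d x y = d y x),
  (forall x y z, d x z <= d x y + d y z),
  (forall x x' y, thread x -> thread x' -> lim_edge x x' -> d x y = d x' y) &
  (forall x y, 0 <= d x y) /\
  forall e, 0 < e -> exists k, forall x y, thread x -> thread y -> x k = y k -> d x y < e].
Proof.
pose I : countType := {n & F n}.
pose phi (i : I) (v : F (projT1 i)) : int :=
  if v == projT2 i then 0 else if fe _ (projT2 i) v then 1 else 2.
have L i : lip (@phi i).
  move=> v; rewrite /phi; have TA := F_tree HF (projT1 i); case: i v TA => n c v TA /=.
  have [->|vc] := eqVneq v c.
    by rewrite (fe_sym TA c) fe_par //; case: eqP.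
  have [pc|pc] := eqVneq (par v) c; first by rewrite -pc fe_par.
  by case: (fe _ c v); case: (fe _ c (par v)).
have ex i : exists h, [/\ admissible h,
    forall x, thread x -> phi i (x (projT1 i)) <= 0 -> h x <= 1 / 2 &
    forall x, thread x -> 2 <= phi i (x (projT1 i)) -> h x = 1].
  have [h [h1 h2 h3 h4]] := admissible_clip (L i).
  by exists h; split.
have [f fP] := choice ex.
have [||g [gP gf]] := @countable_family I admissible f.
- by move=> i; case: (fP i).
- exact: admissible0.
pose G i x y := `|g i x - g i y|.
have Gu x y : unit_seq (fun i => G i x y).
  move=> i; case: (gP i) => g01 _ _; have /andP[h1 h2] := g01 x; have /andP[h3 h4] := g01 y.
  by rewrite normr_ge0 ler_norml; lra.
have u0 : unit_seq (fun=> 0) by move=> i; rewrite lexx ler01.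
exists (fun x y => wsum (fun i => G i x y)); split.
- move=> x y hx hy; split=> [e|e]; last first.
    rewrite -wsum0; congr wsum; apply: functional_extensionality_dep => i.
    by case: (gP i) => _ ei _; rewrite /G (ei _ _ hx hy e) subrr normr0.
  apply: contrapT => /(thread_nfe HF hx hy)[N hN].
  have [n gn] := gf (existT _ N (x N)); case: (fP (existT _ N (x N))) => _ h1 h2.
  have nxy : (y N == x N) = false.
    by apply/negP => /eqP e'; have := hN N (leqnn N); rewrite e' (fe_refl (F_tree HF N)).
  have := h1 x hx; rewrite /phi /= eqxx lexx => /(_ isT) h1'.
  have := h2 y hy; rewrite /phi /= nxy (negPf (hN N (leqnn N))) lexx => /(_ isT) h2'.
  have : wsum (fun=> 0) < wsum (fun i => G i x y).
    apply: (wsum_lt (i := n)) => // [i|]; first exact: normr_ge0.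
    by rewrite /G gn h2' distrC; apply: lt_le_trans (ler_norm _); lra.
  by rewrite e wsum0 ltxx.
- by move=> x y; congr wsum; apply: functional_extensionality_dep => i; rewrite /G distrC.
- by move=> x y z; apply: wsum_tri => // i; exact: ler_distD.
- move=> x x' y hx hx' e; congr wsum; apply: functional_extensionality_dep => i.
  by case: (gP i) => _ ei _; rewrite /G (ei _ _ hx hx' e).
split=> [x y|]; first by rewrite -wsum0; apply: wsum_le => // i; exact: normr_ge0.
apply: wsum_modulus => // i e e0; case: (gP i) => _ _ /(_ e e0) [k hk]; exists k => x y hx hy exy.
exact: ltW (hk _ _ hx hy exy).
Qed.

End LimitFunctions.

Import numFieldNormedType.Exports.
(** * Arcs *)

Lemma affine_continuous (K : realType) (c d : K) : continuous (fun t : K => c + t * d).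
Proof.
move=> t; apply: cvgD; first exact: cvg_cst.
by apply: cvgM; [exact: cvg_id|exact: cvg_cst].
Qed.

Lemma continuous_cst_sub (K : realType) (T : topologicalType) (c : K) (f : T -> K) :
  continuous f -> continuous (fun z => c - f z).
Proof. by move=> cf z; apply: cvgB; [exact: cvg_cst|exact: cf]. Qed.

Lemma continuous_sub_cst (K : realType) (T : topologicalType) (c : K) (f : T -> K) :
  continuous f -> continuous (fun z => f z - c).
Proof. by move=> cf z; apply: cvgB; [exact: cf|exact: cvg_cst]. Qed.

Section Arcs.
Variable X : topologicalType.
Hypothesis hX : hausdorff_space X.
Implicit Types (A J S : set X) (a b : X).

Lemma I01E : I01 = `[0, 1]%classic.
Proof. by apply/seteqP; split=> t; rewrite /I01 /= in_itv. Qed.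

Lemma I01_compact : compact I01.
Proof. by rewrite I01E; exact: segment_compact. Qed.

Lemma I01_connected : connected I01.
Proof. by rewrite I01E; apply/connected_intervalP; exact: interval_is_interval. Qed.

(* A compact connected set carrying a continuous injection to the reals is an arc,
   parametrised by the (rescaled) inverse. *)
Lemma arc_of_injection S (mu : X -> R) a b :
  compact S -> connected S -> {within S, continuous mu} ->
  (forall s t, S s -> S t -> mu s = mu t -> s = t) ->
  S a -> S b -> (forall s, S s -> mu a <= mu s <= mu b) -> a <> b -> arc S a b.
Proof.
move=> kS cS cmu inj Sa Sb bnd nab.
have ab : mu a < mu b.
  have /andP[h _] := bnd b Sb; rewrite lt_neqAle h andbT.
  by apply/eqP => /(inj _ _ Sa Sb).
pose pos (t : R) : R := mu a + t * (mu b - mu a).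
have itv : is_interval (mu @` S).
  by apply/connected_intervalP; exact: connected_continuous_connected.
have ex t : exists s, I01 t -> S s /\ mu s = pos t.
  have [/andP[t0 t1]|nt] := pselect (I01 t); last by exists a.
  have [|||s Ss e] := itv (mu a) (mu b) _ _ (pos t).
  - by exists a.
  - by exists b.
  - by rewrite /pos; nra.
  by exists s.
have [f fP] := choice ex.
have pos_inj t s : pos t = pos s -> t = s.
  by rewrite /pos => e; have : (t - s) * (mu b - mu a) = 0 by [lra|nra]; move/eqP; rewrite mulf_eq0 => /orP[] /eqP h; lra.
have fE s t : S s -> I01 t -> mu s = pos t -> f t = s.
  by move=> Ss It e; have [h1 h2] := fP t It; apply: inj => //; rewrite h2.
have I0 : I01 0 by rewrite /I01 /= lexx ler01.
have I1 : I01 1 by rewrite /I01 /= lexx ler01.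
exists f; split.
- apply/continuous_closedP => C cC; apply/closed_subspaceP.
  exists (pos @^-1` (mu @` (C `&` S))).
    have cpos : continuous pos by exact: affine_continuous.
    move/continuous_closedP: cpos; apply; apply: compact_closed; first exact: Rhausdorff.
    apply: continuous_compact; first exact: continuous_subspaceW cmu.
    apply: (subclosed_compact _ kS); last by move=> ? [].
    by apply: closedI => //; exact: compact_closed.
  apply/seteqP; split=> t /= [h It]; split=> //.
    by case: h => s [Cs Ss] e; suff : C (f t) by []; rewrite (fE s t Ss It e).
  by have [h1 h2] := fP t It; exists (f t).
- move=> s t Is It e; apply: pos_inj; have [_ <-] := fP s Is; have [_ <-] := fP t It.
  by rewrite e.
- apply/seteqP; split=> [_ [t It <-]|s Ss]; first by case: (fP t It).
  have /andP[h1 h2] := bnd s Ss; have d0 : 0 < mu b - mu a by lra.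
  exists ((mu s - mu a) / (mu b - mu a)).
    by rewrite /I01 /= divr_ge0 ?ler_pdivrMr //; lra.
  apply: fE => //; first by rewrite /I01 /= divr_ge0 ?ler_pdivrMr //; lra.
  by rewrite /pos divfK ?gt_eqF //; lra.
- by apply: fE => //; rewrite /pos; lra.
- by apply: fE => //; rewrite /pos; lra.
Qed.

Lemma arc_props A a b : arc A a b -> [/\ closed A, connected A, A a & A b].
Proof.
case=> f [cf inj <- <- <-]; split.
- by apply: compact_closed => //; apply: continuous_compact => //; exact: I01_compact.
- by apply: connected_continuous_connected => //; exact: I01_connected.
- by exists 0; rewrite // /I01 /= lexx ler01.
- by exists 1; rewrite // /I01 /= lexx ler01.
Qed.

(** If [J] missed a point [p] of the arc, the two closed pieces that meet only in [p] would separate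
    [a] from [b] inside [J]. *)
Lemma arc_minimal A a b J : arc A a b -> connected J -> J `<=` A -> J a -> J b -> A `<=` J.
Proof.
case=> f [cf inj fA fa fb] cJ JA Ja Jb p; rewrite -fA => -[t It ftp].
apply: contrapT => nJ; have /andP[t0 t1] := It.
pose L := f @` `[0, t]%classic; pose U := f @` `[t, 1]%classic.
have sub_closed (u v : R) : 0 <= u -> v <= 1 -> closed (f @` `[u, v]%classic).
  move=> u0 v1; apply: compact_closed => //; apply: continuous_compact; last exact: segment_compact.
  apply: continuous_subspaceW cf => s; rewrite /I01 /= in_itv /= => /andP[h1 h2]; lra.
have cL : closed L by exact: sub_closed.
have cU : closed U by exact: sub_closed.
have LU z : L z -> U z -> z = p.
  case=> s; rewrite /= in_itv /= => /andP[s0 s1] <- [s']; rewrite /= in_itv /= => /andP[s0' s1'] e.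
  have e' : s' = s by apply: inj => //; rewrite /I01 /=; lra.
  by rewrite -ftp; congr f; lra.
have sep : separated (J `&` L) (J `&` U).
  split; apply/seteqP; split=> z //.
    case=> h [Jz Uz]; apply: nJ; rewrite -(LU z) //.
    by have := closureI h; case=> _; rewrite -(closure_id L).1.
  case=> [[Jz Lz]] h; apply: nJ; rewrite -(LU z) //.
  by have := closureI h; case=> _; rewrite -(closure_id U).1.
have cov : J `<=` (J `&` L) `|` (J `&` U).
  move=> z Jz; have : A z by exact: JA.
  rewrite -fA => -[s /andP[s0 s1] fs]; have [st|st] := leP s t.
    by left; split=> //; exists s => //; rewrite /= in_itv /= s0.
  by right; split=> //; exists s => //; rewrite /= in_itv /= s1 (ltW st).
have inL : L a by exists 0; rewrite //= in_itv /= lexx.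
have inU : U b by exists 1; rewrite //= in_itv /= lexx andbT.
case: (connected_subset sep cov cJ) => h.
  by have [_ Lb] := h _ Jb; apply: nJ; rewrite -(LU b).
by have [_ Ua] := h _ Ja; apply: nJ; rewrite -(LU a).
Qed.

End Arcs.

(** * The realization *)

Section Systems.
Variables (F : nat -> rtgraph) (al : forall n, F n.+1 -> F n).
Hypothesis HF : fraisse_limit al.
Local Notation thr := (forall n, F n).
Local Notation thread := (thread al).

(** Complement of a [lim_open] set, phrased so that cluster points can be tested coordinate by
    coordinate. *)
Definition tclosed (U : thr -> Prop) := forall x, thread x ->
  (forall n, exists y, [/\ thread y, U y & y n = x n]) -> U x.

Definition pconn (A : rtgraph) (S : A -> Prop) (p : A) := forall u, S u ->
  exists s, [/\ path (fe A) p s, last p s = u & forall w, w \in p :: s -> S w].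

Lemma tclosed_coord n (P : F n -> Prop) : tclosed (fun x => P (x n)).
Proof. by move=> x hx /(_ n)[y [_ + <-]]. Qed.

Variables (S : forall n, F n -> Prop) (N : nat) (p : thr).
Hypotheses (hp : thread p) (Sp : forall n, (N <= n)%N -> S (p n))
  (cS : forall n, (N <= n)%N -> pconn (@S n) (p n))
  (upS : forall n, (N <= n)%N -> forall u : F n, S u -> exists2 u' : F n.+1, S u' & al u' = u)
  (downS : forall n, (N <= n)%N -> forall u : F n.+1, S u -> S (al u)).

Definition slim (x : thr) := forall n, (N <= n)%N -> S (x n).

Lemma slim_through m (v : F m) : (N <= m)%N -> S v ->
  exists t, [/\ thread t, slim t & t m = v].
Proof.
move=> Nm Sv; have [|t [ht tm tS]] := @thread_from m F al S _ v Sv.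
  by move=> n mn u Su; apply: upS => //; exact: leq_trans mn.
exists t; split=> // n Nn; have [mn|/ltnW nm] := leqP m n; first exact: tS.
have : S (t m) by rewrite tm.
move: nm Nn; move/subnK <-; elim: (m - n)%N => // d IH Nn h; apply: IH => //.
by rewrite -ht; apply: downS => //; apply: leq_trans Nn (leq_addl _ _).
Qed.

Lemma tclosed_slim : tclosed slim.
Proof. by move=> x hx h n Nn; have [y [_ ys <-]] := h n; exact: ys. Qed.

(** At each level a path inside [S] from [p n] to [v n] either ends at a coordinate of a thread in
    [U] or has an edge leaving the set of such coordinates. Cluster points of these pairs form an
    edge of the limit. *)
Lemma slim_crossing (U V : thr -> Prop) v : tclosed U -> tclosed V ->
  (forall x, thread x -> slim x -> U x \/ V x) -> U p -> thread v -> slim v -> V v ->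
  exists x y, [/\ thread x, thread y & lim_edge x y] /\ [/\ slim x, slim y, U x & V y].
Proof.
move=> cU cV UV Up hv sv Vv.
have ex n : exists t t', [/\ thread t, thread t', slim t, slim t' & U t] /\
    [/\ V t' & (N <= n)%N -> fe (F n) (t n) (t' n)].
  have [Nn|nN] := leqP N n; last first.
    by exists p, v; split.
  pose P w := `[<exists t, [/\ thread t, slim t, U t & t n = w]>].
  have [/asboolP[t [h1 h2 h3 h4]]|nP] := boolP (P (v n)).
    by exists t, v; split=> //; split=> // _; rewrite h4 (fe_refl (F_tree HF n)).
  have [s [ps ls sS]] := cS Nn (sv n Nn).
  have Pp : P (p n) by apply/asboolP; exists p.
  rewrite -ls in nP.
  have [u [w [Pu Pw uw wS]]] : exists u w, [/\ P u, ~~ P w, fe (F n) u w & S w].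
    elim: s {ls} (p n) ps Pp nP sS => [|y s IH] u /=; first by move=> _ ->.
    case/andP=> uy ys Pu nP sS; have [Py|Py] := boolP (P y).
      by apply: IH ys Py nP _ => w ws; apply: sS; rewrite inE ws orbT.
    by exists u, y; split=> //; apply: sS; rewrite !inE eqxx orbT.
  have [t' [h1' h2' h3']] := slim_through Nn wS.
  case/asboolP: Pu => t [h1 h2 h3 h4]; exists t, t'; split=> //.
  rewrite h4 h3'; split=> //.
  case: (UV t' h1' h2') => // Ut'; case/negP: Pw; apply/asboolP.
  by exists t'.
have [T TP] := choice ex; have [T' TP'] := choice TP.
have hT n : thread (T n) by case: (TP' n) => -[].
have hT' n : thread (T' n) by case: (TP' n) => -[].
have [x [y [hx hy xy]]] := cluster2 hT hT'.
have near n : exists m, (maxn n N <= m)%N /\ T m n = x n /\ T' m n = y n.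
  by have [m [h1 h2 h3]] := xy n (maxn n N); exists m.
exists x, y; split; split=> //.
- move=> n; have [m [+ [<- <-]]] := near n; rewrite geq_max => /andP[nm Nm].
  by apply: (thread_fe HF (hT m) (hT' m) nm); case: (TP' m) => _ [_]; apply.
- by apply: tclosed_slim => // n; have [m [_ [e _]]] := near n; exists (T m); case: (TP' m) => -[].
- by apply: tclosed_slim => // n; have [m [_ [_ e]]] := near n; exists (T' m); case: (TP' m) => -[].
- by apply: cU => // n; have [m [_ [e _]]] := near n; exists (T m); case: (TP' m) => -[].
by apply: cV => // n; have [m [_ [_ e]]] := near n; exists (T' m); case: (TP' m) => -[? ? ? ? ?] [].
Qed.

End Systems.

(** * Quotient topology, metric and arcs *)

Section Realization.
Variables (F : nat -> rtgraph) (al : forall n, F n.+1 -> F n).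
Hypothesis HF : fraisse_limit al.
Local Notation thr := (forall n, F n).
Local Notation thread := (thread al).
Variables (X : topologicalType) (q : thr -> X).
Hypothesis Hq : realization al q.
Implicit Types (x y c t : thr) (K L : set X).

Let q_surj (z : X) : exists2 x, thread x & q x = z. Proof. by case: Hq. Qed.
Let q_sec (z : X) : exists x, thread x /\ q x = z.
Proof. by have [x] := q_surj z; exists x. Qed.
Let q_eq x y : thread x -> thread y -> (q x = q y <-> lim_edge x y).
Proof. by case: Hq => _ [h _]; exact: h. Qed.
Let q_open (U : set X) : open U <-> lim_open al (q @^-1` U). Proof. by case: Hq => _ []. Qed.

Definition qimg (U : thr -> Prop) : set X := [set z | exists x, [/\ thread x, U x & q x = z]].

Lemma closed_pre K : closed K -> tclosed al (fun x => K (q x)).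
Proof.
rewrite -openC => /q_open oK x hx h; apply: contrapT => nK.
have [m hm] := oK x hx nK; have [y [hy Ky e]] := h m.
exact: hm hy e Ky.
Qed.

(** The preimage of [qimg U] consists of the threads joined by an edge to a member of [U]. If [x] is
    a limit of such threads, a cluster point of their partners lies in [U] and is joined to [x]. *)
Lemma closed_img (U : thr -> Prop) : tclosed al U -> closed (qimg U).
Proof.
move=> cU; rewrite -openC; apply/q_open => x hx nU; apply: contrapT => /forallNP h.
have ex m : exists Y S, [/\ thread Y, thread S, Y m = x m, U S & lim_edge S Y].
  have /existsNP[y /not_implyP[hy /not_implyP[e /contrapT [s [hs Us e2]]]]] := h m.
  by exists y, s; split=> //; apply/q_eq.
have [Y YP] := choice ex; have [S SP] := choice YP.
have hY m : thread (Y m) by case: (SP m).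
have hS m : thread (S m) by case: (SP m).
have [c [d [hc hd cd]]] := cluster2 hS hY; apply: nU; exists c; split=> //.
  by apply: cU => // n; have [m [_ e _]] := cd n 0%N; exists (S m); case: (SP m).
apply/q_eq => // n; have [m [nm <- e]] := cd n n.
have <- : Y m n = x n by case: (SP m) => _ _ e' _ _; exact: thread_eq (hY m) hx nm e'.
by case: (SP m).
Qed.

Lemma qimg_in U x : thread x -> U x -> qimg U (q x).
Proof. by move=> hx Ux; exists x. Qed.

Lemma X_compact : compact [set: X].
Proof.
have [sec secP] := choice q_sec.
rewrite compact_ultra => G GU _.
have hsec z : thread (sec z) by case: (secP z).
have [c [hc cG]] := ultra_thread GU hsec; exists (q c); split=> // V.
rewrite nbhsE => -[U [oU Uc] UV]; have [m hm] := (q_open U).1 oU c hc Uc.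
apply: filterS (cG m) => z /= e; apply: UV; have [_ <-] := secP z.
exact: hm.
Qed.

Lemma closed_compactX K : closed K -> compact K.
Proof. by move=> cK; exact: subclosed_compact cK X_compact _. Qed.

(** The pseudometric on threads is constant along edges, so it descends through any section. That
    open sets contain balls is compactness: points outside [U] at distances tending to 0 would
    cluster outside [U] at distance 0. *)
Lemma metric_exists : exists d : X -> X -> R, [/\ metric_for d, forall z w, 0 <= d z w &
  forall e, 0 < e -> exists k, forall x y, thread x -> thread y -> x k = y k ->
    d (q x) (q y) < e].
Proof.
have [sec secP] := choice q_sec.
have hsec z : thread (sec z) by case: (secP z).
have qsec z : q (sec z) = z by case: (secP z).
have [d0 [d00 dS dT dE [dpos dM]]] := limit_metric HF.
pose d z z' := d0 (sec z) (sec z').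
have dq x y : thread x -> thread y -> d (q x) (q y) = d0 x y.
  move=> hx hy; rewrite /d (dE _ x) //; last by apply/q_eq; rewrite ?qsec.
  by rewrite dS (dE _ y) //; apply/q_eq; rewrite ?qsec.
exists d; split; last 2 first.
- by move=> x y; exact: dpos.
- by move=> e e0; have [k hk] := dM e e0; exists k => x y hx hy exy; rewrite dq //; exact: hk.
split=> [z z'|].
  rewrite /d d00 //; split=> [/q_eq|->]; first by rewrite !qsec; apply.
  exact: edge_refl HF _.
split=> [z z'|]; first exact: dS.
split=> [z z' z''|U]; first exact: dT.
split=> [oU z Uz|hU]; last first.
  apply/q_open => x hx Ux; have [e e0 he] := hU _ Ux; have [k hk] := dM e e0.
  by exists k => y hy exy; apply: he; rewrite dq //; exact: hk.
apply: contrapT => h; have [x hx e] := q_surj z; subst z.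
have ex n : exists y, [/\ thread y, d0 x y < 2 / 2 ^+ n & ~ U (q y)].
  apply: contrapT => h2; apply: h; exists (2 / 2 ^+ n); first by rewrite divr_gt0 // exprn_gt0.
  move=> z; have [y hy <-] := q_surj z; rewrite dq // => dxy; apply: contrapT => nU.
  by apply: h2; exists y.
have [Y YP] := choice ex; have hY n : thread (Y n) by case: (YP n).
have [c [_c [hc _ cP]]] := cluster2 hY hY.
have nUc : ~ U (q c).
  have := closed_pre (open_closedC oU); apply=> // n.
  by have [m [_ e _]] := cP n 0%N; exists (Y m); case: (YP m).
apply: nUc; suff <- : q x = q c by [].
apply/q_eq/d00 => //; apply/eqP; rewrite eq_le dpos andbT; apply/ler_addgt0Pr => e e0.
have e2 : 0 < e / 2 by rewrite divr_gt0.
have [k hk] := dM _ e2; have [n hn] := small_pow e2.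
have [m [nm em _]] := cP k n; have [_ hm _] := YP m.
have := hk _ _ (hY m) hc em; have := dT x (Y m) c.
have : 2 / 2 ^+ m <= 2 / 2 ^+ n :> R.
  by rewrite ler_wpM2l // lef_pV2 ?posrE ?exprn_gt0 // ler_weXn2l ?ler1n.
by lra.
Qed.

Lemma X_hausdorff : hausdorff_space X.
Proof.
have [d [[d0 [dS [dT dO]]] dpos _]] := metric_exists.
have ball_open z e : open [set w | d z w < e].
  apply/dO => w /= hw; exists (e - d z w); first by rewrite subr_gt0.
  by move=> v hv /=; have := dT z w v; lra.
rewrite open_hausdorff => z w zw; have dzw : 0 < d z w.
  rewrite lt_neqAle dpos andbT; apply/eqP => e; case/eqP: zw; apply/d0; exact/esym.
exists ([set v | d z v < d z w / 2], [set v | d w v < d z w / 2]); split.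
- by rewrite inE /= (d0 z z).2 // divr_gt0.
- by rewrite inE /= (d0 w w).2 // divr_gt0.
- exact: ball_open.
- exact: ball_open.
apply/eqP/seteqP; split=> // v /= [h1 h2]; have := dT z v w; rewrite (dS v w); lra.
Qed.

(** A relatively clopen set and its complement pull back to sets of threads covered by two closed
    ones; [slim_crossing] finds an edge between these, but both ends of an edge are one point. *)
Lemma system_connected (S : forall n, F n -> Prop) N p : thread p ->
  (forall n, (N <= n)%N -> S n (p n)) ->
  (forall n, (N <= n)%N -> pconn (@S n) (p n)) ->
  (forall n, (N <= n)%N -> forall u : F n, S n u -> exists2 u' : F n.+1, S n.+1 u' & al u' = u) ->
  (forall n, (N <= n)%N -> forall u : F n.+1, S n.+1 u -> S n (al u)) ->
  connected (qimg (slim S N)).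
Proof.
move=> hp Sp cS upS downS B [z0 Bz0] [C1 oC1 B1] [C2 cC2 B2].
have BL : B `<=` qimg (slim S N) by rewrite B2 => z [].
apply/seteqP; split=> // z Lz; apply: contrapT => nBz.
pose U x := C2 (q x); pose V x := (~` C1) (q x).
have cU : tclosed al U := closed_pre cC2.
have cV : tclosed al V := closed_pre (open_closedC oC1).
have UV x : thread x -> slim S N x -> U x \/ V x.
  move=> hx sx; have [h|h] := pselect (C1 (q x)); last by right.
  have : B (q x) by rewrite B1; split=> //; exact: qimg_in.
  by rewrite B2 => -[]; left.
have final x y : thread x -> thread y -> lim_edge x y -> slim S N x -> U x -> V y -> False.
  move=> hx hy e sx Ux; rewrite /V /= -((q_eq hx hy).2 e); apply.
  have : B (q x) by rewrite B2; split=> //; exact: qimg_in.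
  by rewrite B1 => -[].
have [v hv [sv vz]] : exists2 v, thread v & slim S N v /\ q v = z by case: Lz => v [? ? ?]; exists v.
have Vv : V v.
  by case: (UV v hv sv) => // Uv; case: nBz; rewrite B2 -vz; split=> //; exact: qimg_in.
have [u hu [su uz]] : exists2 u, thread u & slim S N u /\ q u = z0.
  by case: (BL _ Bz0) => u [? ? ?]; exists u.
have Uu : U u by move: Bz0; rewrite B2 -uz => -[].
case: (UV p hp Sp) => [Up|Vp].
  have [x [y [[hx hy e] [sx sy Ux Vy]]]] := slim_crossing HF hp Sp cS upS downS cU cV UV Up hv sv Vv.
  exact: final hx hy e sx Ux Vy.
have VU x : thread x -> slim S N x -> V x \/ U x by move=> hx sx; case: (UV x hx sx); [right|left].
have [x [y [[hx hy e] [sx sy Vx Uy]]]] := slim_crossing HF hp Sp cS upS downS cV cU VU Vp hu su Uu.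
exact: final hy hx (edge_sym HF e) sy Uy Vx.
Qed.

Definition shadow K n (u : F n) : Prop := exists x, [/\ thread x, K (q x) & x n = u].

(** The points of [K] with a reachable [n]-th coordinate form a clopen part of [K], because edges of
    the limit project to edges of [F n]. *)
Lemma shadow_pconn K p n : connected K -> thread p -> K (q p) -> pconn (@shadow K n) (p n).
Proof.
move=> cK hp Kp u [v [hv Kv <-]].
pose P w := exists s, [/\ path (fe (F n)) (p n) s, last (p n) s = w &
  forall w', w' \in p n :: s -> shadow K w'].
have Pp : P (p n) by exists [::]; split=> // t; rewrite inE => /eqP ->; exists p.
have step x y : thread x -> thread y -> K (q x) -> K (q y) -> lim_edge x y -> P (x n) -> P (y n).
  move=> hx hy Kx Ky e [s [s1 s2 s3]]; exists (rcons s (y n)).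
  rewrite rcons_path last_rcons s1 s2 e; split=> // t.
  rewrite -rcons_cons mem_rcons inE => /predU1P[->|/s3//]; by exists y.
suff e : K `&` qimg (fun x => P (x n)) = K.
  have : (K `&` qimg (fun x => P (x n))) (q v) by rewrite e.
  case=> _ [x [hx Px exv]]; apply: (step x v) => //; first by rewrite exv.
  exact/q_eq.
apply: cK; first by exists (q p); split=> //; exists p.
  exists (~` qimg (fun x => ~ P (x n))).
    by rewrite openC; apply: closed_img; exact: (@tclosed_coord _ _ n (fun u => ~ P u)).
  apply/seteqP; split=> z [Kz h]; split=> //.
    move=> [y [hy nPy yz]]; case: h => x [hx Px xz]; apply: nPy.
    by apply: (step x y) => //; rewrite ?xz ?yz //; apply/q_eq => //; rewrite xz yz.
  have [x hx xz] := q_surj z; exists x; split=> //; apply: contrapT => nP.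
  by apply: h; exists x.
exists (qimg (fun x => P (x n))) => //.
by apply: closed_img; exact: (@tclosed_coord _ _ n P).
Qed.

Definition iv a b (x : thr) := a <<~ x /\ x <<~ b.

Lemma interval_path (A : rtgraph) (a u : A) : is_tree A -> a <~ u ->
  exists s, [/\ path (fe A) a s, last a s = u & forall w, w \in a :: s -> a <~ w /\ w <~ u].
Proof.
move=> TA /ancP[k]; elim: k u => [|k IH] u.
  move=> /= ->; exists [::]; split=> // w; rewrite inE => /eqP ->; by split; exact: connect0.
rewrite iterSr => e; have [s [s1 s2 s3]] := IH _ e.
exists (rcons s u); rewrite rcons_path last_rcons s1 s2 fe_par //; split=> // w.
have au : a <~ u by rewrite -e -iterSr; exact: fconnect_iter.
rewrite -rcons_cons mem_rcons inE => /predU1P[->|/s3[h1 h2]]; first by split=> //; exact: connect0.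
by split=> //; apply: tle_trans h2 (par_le u).
Qed.

Lemma iv_closed a b : tclosed al (iv a b).
Proof.
by move=> x hx h; split=> n; have [y [_ [h1 h2] <-]] := h n; [exact: h1|exact: h2].
Qed.

Lemma iv_connected a b : thread a -> thread b -> a <<~ b -> connected (qimg (iv a b)).
Proof.
move=> ha hb ab.
have -> : iv a b = slim (fun n u => a n <~ u /\ u <~ b n) 0.
  apply: functional_extensionality_dep => x; apply/propext; split=> [[h1 h2] n _|h].
    by split; [exact: h1|exact: h2].
  by split=> n; case: (h n isT).
apply: (@system_connected _ _ a) => // n _ /=.
- move=> u [au ub]; have [s [s1 s2 s3]] := interval_path (F_tree HF n) au.
  exists s; split=> // w /s3[h1 h2]; split=> //; exact: tle_trans h2 ub.
- move=> u [au ub]; have [<-|nau] := eqVneq (a n) u.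
    by exists (a n.+1); [split; [exact: connect0|exact: ab]|exact: ha].
  have [|||g [h1 _ h2 h3 _]] := tm_first (bond_map HF n) (b := u) (ab n.+1).
  + by rewrite ha.
  + by rewrite ha.
  + by rewrite hb.
  by exists g.
move=> u [au ub]; rewrite -ha -hb; split; exact: (tm_le (bond_map HF n)).
Qed.

(** In each shadow a path from [c n] to [x n] has to enter the subtree above [v n], hence visits
    [v n]. *)
Lemma iv_sub K c x : closed K -> connected K -> thread c -> thread x -> c <<~ x ->
  K (q c) -> K (q x) -> qimg (iv c x) `<=` K.
Proof.
move=> clK cK hc hx cx Kc Kx _ [v [hv [cv vx] <-]]; apply: (closed_pre clK) => // n.
have [s [s1 s2 s3]] := shadow_pconn (n := n) cK hc Kc (ex_intro _ x (And3 hx Kx erefl)).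
have T := F_tree HF n; suff : shadow K (v n) by [].
apply: s3; have [vc|nvc] := boolP (v n <~ c n).
  by rewrite (tle_anti T vc (cv n)) mem_head.
rewrite (path_par T) in s1; have [|h _] := path_enter s1 nvc; first by rewrite s2; exact: vx.
by rewrite inE h orbT.
Qed.

Lemma meet_sub K c x y : closed K -> connected K -> thread c -> thread x -> thread y ->
  K (q x) -> K (q y) ->
  (forall n, exists m t, [/\ (n <= m)%N, thread t, t n = c n, (t m <~ x m) && (t m <~ y m) &
      forall w, w <~ x m -> w <~ y m -> w <~ t m]) -> K (q c).
Proof.
move=> clK cK hc hx hy Kx Ky hm; apply: (closed_pre clK) => // n.
have [m [t [nm ht <- /andP[tx ty] tmax]]] := hm n.
suff [w [hw Kw wt]] : shadow K (t m).
  by exists w; split=> //; exact: thread_eq hw ht nm wt.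
have T := F_tree HF m; have [->|ne] := eqVneq (t m) (x m)%N; first by exists x.
have [u [pu ut _ ux]] := child T tx ne.
have nuy : ~~ (u <~ y m).
  apply/negP => uy; case/eqP: ut; apply: (tle_anti T); first exact: tmax.
  by rewrite -pu par_le.
have [s [s1 s2 s3]] := shadow_pconn (n := m) cK hx Kx (ex_intro _ y (And3 hy Ky erefl)).
apply: s3; rewrite (path_par T) in s1; rewrite -pu.
by have [|_ //] := path_exit s1 ux; rewrite s2.
Qed.

(* the points of the arc from [q x] to [q y], when [c] is the meet of [x] and [y] *)
Definition fork c x y : set X := qimg (iv c x) `|` qimg (iv c y).

Lemma fork_connected c x y : thread c -> thread x -> thread y -> c <<~ x -> c <<~ y ->
  connected (fork c x y).
Proof.
move=> hc hx hy cx cy; apply: connectedU; [|exact: iv_connected..].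
by exists (q c); split; exists c; split=> //; split=> //; exact: xle_refl.
Qed.

Lemma fork_closed c x y : closed (fork c x y).
Proof. by apply: closedU; apply: closed_img; exact: iv_closed. Qed.

Lemma fork_ends c x y : thread x -> thread y -> c <<~ x -> c <<~ y ->
  fork c x y (q x) /\ fork c x y (q y).
Proof.
move=> hx hy cx cy; split; [left; exists x|right; exists y]; split=> //; split=> //;
  exact: xle_refl.
Qed.

(** The radial function falls from [x] to the meet and rises from there to [y]; with its sign
    reversed on the first branch it becomes injective on the whole fork. *)
Lemma fork_arc c x y : thread c -> thread x -> thread y -> c <<~ x -> c <<~ y ->
  (forall u, thread u -> u <<~ x -> u <<~ y -> u <<~ c) -> ~ lim_edge x y ->
  arc (fork c x y) (q x) (q y).
Proof.
move=> hc hx hy cx cy cmax nxy.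
have [lam [lamE lamM lamI lamS]] := radial_function HF.
have [sec secP] := choice q_sec.
have hsec z : thread (sec z) by case: (secP z).
have qsec z : q (sec z) = z by case: (secP z).
pose lamX z := lam (sec z).
have lamq x' : thread x' -> lamX (q x') = lam x'.
  by move=> hx'; apply: lamE => //; apply/q_eq => //; rewrite qsec.
have cont : continuous lamX.
  apply/continuousP => U oU; apply/q_open => t ht /= Ut.
  have [e /= e0 he] := (nbhs_ballP _ _).1 (open_nbhs_nbhs (conj oU Ut)).
  have [k hk] := lamM e e0; exists k => y' hy' eyt /=; apply: he.
  by rewrite /ball /= !lamq //; apply: hk.
have injiv b u v : thread b -> thread u -> thread v -> iv c b u -> iv c b v -> lam u = lam v -> q u = q v.
  move=> hb hu hv [cu ub] [cv vb] e; apply/q_eq => //; apply: contrapT => ne.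
  case: (xle_total HF hu hv ub vb) => h.
    by have := lamS _ _ hu hv h ne; rewrite e ltxx.
  by have := lamS _ _ hv hu h (fun h => ne (edge_sym HF h)); rewrite e ltxx.
have ge b u : thread u -> iv c b u -> lam c <= lam u by move=> hu [cu _]; exact: lamI.
have le b u : thread b -> thread u -> iv c b u -> lam u <= lam b by move=> hb hu [_ ub]; exact: lamI.
have base b u : thread b -> thread u -> c <<~ b -> iv c b u -> lam u = lam c -> q u = q c.
  by move=> hb hu cb hiv e; apply: injiv hiv _ e => //; split=> //; exact: xle_refl.
pose A := qimg (iv c x); pose B := qimg (iv c y).
pose mu z := if pselect (A z) then lam c - lamX z else lamX z - lam c.
have muA z : A z -> mu z = lam c - lamX z by rewrite /mu; case: pselect.
(* The two branches share only [q c], where both formulas give 0. *)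
have muB z : B z -> mu z = lamX z - lam c.
  move=> Bz; have [Az|nA] := pselect (A z); last by rewrite /mu; case: pselect.
  rewrite muA //; case: Az => u [hu [cu ux] uz]; case: Bz => v [hv [cv vy] vz]; suff zc : z = q c by rewrite zc lamq // subrr.
  have e : lim_edge u v by apply/q_eq; rewrite ?uz.
  case: (edge_comparable HF hu hv e) => h.
    by rewrite -uz (xle_anti HF cu (cmax _ hu ux (xle_trans h vy))).
  by rewrite -vz (xle_anti HF cv (cmax _ hv (xle_trans h ux) vy)).
have clA : closed A by apply: closed_img; exact: iv_closed.
have clB : closed B by apply: closed_img; exact: iv_closed.
apply: (arc_of_injection X_hausdorff (mu := mu)).
- by apply: closed_compactX; exact: fork_closed.
- exact: fork_connected.
- apply: withinU_continuous => //.
    apply: (@subspace_eq_continuous _ _ _ (fun z => lam c - lamX z)).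
      by move=> z; rewrite inE => Az; exact/esym/muA.
    exact/continuous_subspaceT/continuous_cst_sub.
  apply: (@subspace_eq_continuous _ _ _ (fun z => lamX z - lam c)).
    by move=> z; rewrite inE => Bz; exact/esym/muB.
  exact/continuous_subspaceT/continuous_sub_cst.
- have mixed (s t : X) : A s -> B t -> mu s = mu t -> s = t.
    move=> As Bt; rewrite muA // muB //; case: As => u [hu iu <-]; case: Bt => v [hv iv' <-].
    rewrite !lamq // => e; have := ge _ _ hu iu; have := ge _ _ hv iv' => h1 h2.
    by rewrite (base x u) ?(base y v) //; lra.
  move=> s t [As|Bs] [At|Bt]; [|exact: mixed| |]; last 2 first.
  + by move=> e; apply/esym; apply: mixed.
  + rewrite !muB //; case: Bs => u [hu iu <-]; case: Bt => v [hv iv' <-].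
    by rewrite !lamq // => e; apply: injiv iu iv' _ => //; lra.
  rewrite !muA //; case: As => u [hu iu <-]; case: At => v [hv iv' <-].
  by rewrite !lamq // => e; apply: injiv iu iv' _ => //; lra.
- by case: (fork_ends hx hy cx cy).
- by case: (fork_ends hx hy cx cy).
- have Ax : A (q x) by exists x; split=> //; split=> //; exact: xle_refl.
  have By : B (q y) by exists y; split=> //; split=> //; exact: xle_refl.
  have cx' := lamI _ _ hc hx cx; have cy' := lamI _ _ hc hy cy.
  move=> s; rewrite (muA (q x)) // (muB (q y)) // !lamq // => -[As|Bs].
    rewrite muA //; case: As => u [hu iu <-]; rewrite lamq //.
    have := ge _ _ hu iu; have := le _ _ hx hu iu; lra.
  rewrite muB //; case: Bs => u [hu iu <-]; rewrite lamq //.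
  have := ge _ _ hu iu; have := le _ _ hy hu iu; lra.
by move/q_eq => h; apply: nxy; exact: h.
Qed.

Lemma iv_arc a b : thread a -> thread b -> a <<~ b -> ~ lim_edge a b ->
  arc (qimg (iv a b)) (q a) (q b).
Proof.
move=> ha hb ab nab.
have -> : qimg (iv a b) = fork a a b.
  apply/esym/setUidPr => _ [u [hu [au ua] <-]]; exists u; split=> //; split=> //.
  exact: xle_trans ua ab.
by apply: fork_arc => //; exact: xle_refl.
Qed.

Lemma fork_exists x y : thread x -> thread y -> exists c, [/\ thread c, c <<~ x, c <<~ y,
  forall u, thread u -> u <<~ x -> u <<~ y -> u <<~ c &
  forall K, closed K -> connected K -> K (q x) -> K (q y) -> fork c x y `<=` K].
Proof.
move=> hx hy; have [c [hc cx cy cmax cm]] := thread_meet HF hx hy.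
exists c; split=> // K clK cK Kx Ky.
have Kc : K (q c) by exact: meet_sub clK cK hc hx hy Kx Ky cm.
by move=> z [|]; apply: iv_sub.
Qed.

Lemma X_connected : connected [set: X].
Proof.
have -> : [set: X] = qimg (slim (fun _ _ => True) 0).
  by apply/seteqP; split=> // z _; have [x hx xz] := q_surj z; exists x.
apply: (@system_connected _ _ (root_thread F)) => // [|n _ u _|n _ u _].
- exact: root_thread_thread HF.
- by have [s [h1 h2]] := connected_tree (F_tree HF n) (root_thread F n) u; exists s.
by have [u' e] := tm_surj (bond_map HF n) u; exists u'.
Qed.

Lemma X_continuum : continuum X.
Proof.
split.
- by exists (q (root_thread F)).
- exact: X_compact.
- exact: X_connected.
- exact: X_hausdorff.
by have [d [hd _ _]] := metric_exists; exists d.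
Qed.

(** Two points of the intersection are joined by their fork, which is connected and lies in both
    continua. *)
Lemma X_hereditarily_unicoherent : hereditarily_unicoherent X.
Proof.
move=> K L [_ clK cK] [_ clL cL] B [z0 Bz0] [C1 oC1 B1] [C2 cC2 B2].
apply/seteqP; split=> [|z KLz]; first by rewrite B2 => z [].
have [Kz0 Lz0] : (K `&` L) z0 by move: Bz0; rewrite B2 => -[].
have [x hx xz] := q_surj z0; have [y hy yz] := q_surj z; case: KLz => Kz Lz; subst z0 z.
have [c [hc cx cy _ J]] := fork_exists hx hy.
have JKL : fork c x y `<=` K `&` L by move=> w Jw; split; [exact: (J K)|exact: (J L)].
have [Jx Jy] := fork_ends hx hy cx cy.
suff e : fork c x y `&` B = fork c x y by move: Jy; rewrite -e => -[].
apply: (fork_connected hc hx hy cx cy); first by exists (q x).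
  exists C1 => //; rewrite B1 setIA; congr (_ `&` _).
  by apply/setIidPl.
exists C2 => //; rewrite B2 setIA; congr (_ `&` _).
by apply/setIidPl.
Qed.

Lemma X_dendroid : dendroid X.
Proof.
split; [exact: X_continuum|exact: X_hereditarily_unicoherent|].
move=> z w zw; have [x hx xz] := q_surj z; have [y hy yz] := q_surj w; subst z w.
have [c [hc cx cy cmax _]] := fork_exists hx hy.
by exists (fork c x y); apply: fork_arc => // /(q_eq hx hy).
Qed.

(** The fork lies in [A] because [A] is a continuum through both ends, and it fills [A] because no
    smaller connected part of an arc joins its ends. *)
Lemma arc_fork A x y : thread x -> thread y -> arc A (q x) (q y) ->
  exists c, [/\ thread c, c <<~ x, c <<~ y & A = fork c x y].
Proof.
move=> hx hy arcA; have [clA cA Ax Ay] := arc_props X_hausdorff arcA.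
have [c [hc cx cy _ J]] := fork_exists hx hy; exists c; split=> //.
have [Jx Jy] := fork_ends hx hy cx cy.
apply/seteqP; split; last exact: J.
by apply: (arc_minimal X_hausdorff arcA) => //; [exact: fork_connected|exact: J].
Qed.

End Realization.

Lemma leaf_above (A : rtgraph) (v : A) : is_tree A ->
  exists2 l, v <~ l & forall u, l <~ u -> u = l.
Proof.
move=> TA; have [l vl lmax] := @arg_maxnP _ v (fun l => v <~ l) (height (froot A) par) (connect0 _ v).
exists l => // u lu; apply/esym; apply: (anc_height_eq (par_root TA) (root_le TA) lu).
apply/eqP; rewrite eqn_leq (anc_height (par_root TA) (root_le TA) lu) /=.
by apply: lmax; exact: (tle_trans vl lu).
Qed.

(** * Smoothness, Kelley's property, endpoints and ramification points *)

Section Properties.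
Variables (F : nat -> rtgraph) (al : forall n, F n.+1 -> F n).
Hypothesis HF : fraisse_limit al.
Local Notation thr := (forall n, F n).
Local Notation thread := (thread al).
Variables (X : topologicalType) (q : thr -> X).
Hypothesis Hq : realization al q.
Implicit Types (x y c t : thr) (K L : set X).
Local Notation qimg := (qimg al q).
Local Notation shadow := (shadow al q).

Let q_surj (z : X) : exists2 x, thread x & q x = z. Proof. by case: Hq. Qed.
Let q_eq x y : thread x -> thread y -> (q x = q y <-> lim_edge x y).
Proof. by case: Hq => _ [h _]; exact: h. Qed.
Let q_open (U : set X) : open U <-> lim_open al (q @^-1` U). Proof. by case: Hq => _ []. Qed.
Let root : thr := root_thread F.
Let hroot : thread root. Proof. exact: (root_thread_thread HF). Qed.

(** The arc from the root to [q y] is the image of the interval below [y], so the arc order based at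
    [q root] is the image of the order of threads. *)
Lemma arc_leP (z w : X) : arc_le (q root) z w <->
  exists x y, [/\ thread x, thread y, x <<~ y, q x = z & q y = w].
Proof.
split.
  case=> h1 h2; have [y hy yw] := q_surj w; subst w.
  have [e|ne] := pselect (q y = q root).
    exists root, root; split; rewrite ?(h1 e) ?e //; exact: xle_refl.
  have nry : ~ lim_edge root y by move/(q_eq hroot hy) => e; apply: ne.
  have [x [hx [_ xy] <-]] := h2 ne _ (iv_arc HF Hq hroot hy (root_thread_le HF y) nry).
  by exists x, y.
case=> x [y [hx hy xy <- <-]]; split.
  move=> /(q_eq hy hroot) e; apply/q_eq => // n; have T := F_tree HF n.
  have [->|ne] := eqVneq (x n) (y n); first exact: e.
  have er : fe (F n) (root n) (y n) by rewrite (fe_sym T); exact: e.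
  have xr : x n <~ root n.
    case: (fe_le T er (root_thread_le HF y n)) => ->; first exact: xy.
    exact: (le_par (xy n) ne).
  by rewrite (tle_anti T xr (root_thread_le HF x n)) fe_refl.
move=> _ A arcA; have [c [hc cr cy ->]] := arc_fork HF Hq hroot hy arcA.
right; exists x; split=> //; split=> //.
exact: (xle_trans cr (root_thread_le HF x)).
Qed.

(** Ordered pairs approaching [(z, w)] lift to ordered pairs of threads, and a cluster pair of these
    is ordered because the order is coordinatewise. *)
Lemma X_smooth : smooth X.
Proof.
have [d [[d0 [dS [dT dO]]] dpos dM]] := metric_exists HF Hq.
have ball_nbhs z n : nbhs z [set w | d z w < 2 / 2 ^+ n].
  have e0 : 0 < 2 / 2 ^+ n :> R by rewrite divr_gt0 // exprn_gt0.
  apply: open_nbhs_nbhs; split; last by rewrite /= (d0 z z).2.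
  apply/dO => w /= hw; exists (2 / 2 ^+ n - d z w); first by rewrite subr_gt0.
  by move=> v hv /=; have := dT z w v; lra.
exists (q root) => -[z w] cl; apply/arc_leP => /=.
have ex n : exists S T, [/\ thread S, thread T, S <<~ T, d z (q S) < 2 / 2 ^+ n &
    d w (q T) < 2 / 2 ^+ n].
  have [|[z' w'] [h [/= h1 h2]]] :=
      cl ([set v | d z v < 2 / 2 ^+ n] `*` [set v | d w v < 2 / 2 ^+ n]).
    by exists ([set v | d z v < 2 / 2 ^+ n], [set v | d w v < 2 / 2 ^+ n]) => //; split; exact: ball_nbhs.
  have [S [T [hS hT ST /= e1 e2]]] := (arc_leP _ _).1 h.
  by exists S, T; rewrite e1 e2.
have [S SP] := choice ex; have [T TP] := choice SP.
have hS n : thread (S n) by case: (TP n).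
have hT n : thread (T n) by case: (TP n).
have [x [y [hx hy xyP]]] := cluster2 hS hT.
have lim (v : X) (W : nat -> thr) u : (forall n, thread (W n)) -> thread u ->
    (forall n, d v (q (W n)) < 2 / 2 ^+ n) ->
    (forall n N, exists2 m, (N <= m)%N & W m n = u n) -> q u = v.
  move=> hW hu dW Wu; apply/esym/d0/eqP; rewrite eq_le dpos andbT.
  apply/ler_addgt0Pr => e e0; have e2 : 0 < e / 2 by rewrite divr_gt0.
  have [k hk] := dM _ e2; have [n hn] := small_pow e2.
  have [m nm em] := Wu k n; have := hk _ _ (hW m) hu em; have := dT v (q (W m)) (q u).
  have : 2 / 2 ^+ m <= 2 / 2 ^+ n :> R.
    by rewrite ler_wpM2l // lef_pV2 ?posrE ?exprn_gt0 // ler_weXn2l ?ler1n.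
  by have := dW m; lra.
exists x, y; split=> //.
- by move=> n; have [m [_ <- <-]] := xyP n 0%N; case: (TP m).
- apply: (lim z S) => // [n|n N]; first by case: (TP n).
  by have [m [? ? _]] := xyP n N; exists m.
- apply: (lim w T) => // [n|n N]; first by case: (TP n).
  by have [m [? _ ?]] := xyP n N; exists m.
Qed.

(** Likeness of [K] and [L] at level [m]; through the modulus of the metric it bounds their
    Hausdorff distance. *)
Definition close m K L :=
  (forall z, L z -> exists y k, [/\ thread y, thread k, q y = z, K (q k) & y m = k m]) /\
  (forall k, thread k -> K (q k) -> exists y, [/\ thread y, L (q y) & y m = k m]).

(* [L] is the component of the preimage of the [m]-th shadow of [K] containing [x]. *)
Lemma confluent_subcontinuum K m x : connected K -> thread x -> shadow K (x m) ->
  exists L, [/\ subcontinuum L, L (q x) & close m K L].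
Proof.
move=> cK hx Kx.
pose Q n (u : F n) := exists t, [/\ thread t, t n = u & shadow K (t m)].
pose C n (u : F n) := exists s, [/\ path (fe (F n)) (x n) s, last (x n) s = u &
  forall w, w \in x n :: s -> Q n w].
have Cx n : C n (x n).
  by exists [::]; split=> // w; rewrite inE => /eqP ->; exists x.
have cC n : pconn (C n) (x n).
  move=> u [s [s1 s2 s3]]; exists s; split=> // w ws.
  case/splitPl: ws s1 s3 {s2} => s1 s2 e; rewrite cat_path => /andP[h1 _] h2.
  exists s1; split=> // w' w's; apply: h2.
  by move: w's; rewrite !inE mem_cat => /orP[->//|->]; rewrite orbT.
have upQ n (w : F n.+1) : (m <= n)%N -> Q n (al w) -> Q n.+1 w.
  move=> mn [t [ht e Kt]]; have [t' ht' e'] := thread_through HF w.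
  exists t'; split=> //; rewrite (thread_eq ht' ht mn) //.
  by rewrite -ht' e' e.
have upC n : (m <= n)%N -> forall u : F n, C n u -> exists2 u' : F n.+1, C n.+1 u' & al u' = u.
  move=> mn u [s [s1 s2 s3]]; rewrite -hx in s1 s2 s3.
  have [s' [s1' s2' s3']] := tm_path (bond_map HF n) s1.
  exists (last (x n.+1) s'); last by rewrite s2' s2.
  exists s'; split=> // w; rewrite inE => /predU1P[->|ws]; apply: upQ => //; apply: s3.
    exact: mem_head.
  exact: (allP s3').
have downC n : (m <= n)%N -> forall u : F n.+1, C n.+1 u -> C n (al u).
  move=> mn u [s [s1 s2 s3]]; exists (map (@al n) s); split.
  - rewrite -hx path_map; apply: sub_path s1 => a b; exact: (tm_fe (bond_map HF n)).
  - by rewrite -hx last_map s2.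
  rewrite -hx -map_cons => w /mapP[w' w's ->]; have [t [ht e Kt]] := s3 _ w's.
  by exists t; split=> //; rewrite -e ht.
exists (qimg (slim C m)); split.
- split.
  + by exists (q x); exists x; split=> // n _; exact: Cx.
  + by apply: (closed_img Hq); exact: tclosed_slim.
  + exact: (system_connected HF Hq hx (fun n _ => Cx n) (fun n _ => @cC n) upC downC).
- by exists x; split=> // n _; exact: Cx.
split.
  move=> z [y [hy sy yz]]; have [s [_ s2 s3]] := sy m (leqnn m).
  have [|t [ht e [k [hk Kk ke]]]] := s3 (y m); first by rewrite -s2 mem_last.
  by exists y, k; rewrite ke.
move=> k hk Kk; case: Kx => k0 [hk0 Kk0 e0].
have Ck : C m (k m).
  have [s [s1 s2 s3]] := shadow_pconn Hq (n := m) cK hk0 Kk0 (ex_intro _ k (And3 hk Kk erefl)).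
  rewrite e0 in s1 s2 s3; exists s; split=> // w /s3 sw.
  by have [t ht tw] := thread_through HF w; exists t; rewrite tw.
have [y [hy sy ye]] := slim_through upC downC (leqnn m) Ck.
by exists y; split=> //; exists y.
Qed.

Lemma close_weaken m m' K L : (m' <= m)%N -> close m K L -> close m' K L.
Proof.
move=> mm [h1 h2]; split.
  move=> z /h1[y [k [hy hk yz Kk e]]]; exists y, k; split=> //; exact: (thread_eq hy hk mm e).
move=> k hk /(h2 k hk)[y [hy Ly e]]; exists y; split=> //; exact: (thread_eq hy hk mm e).
Qed.

Lemma X_kelley : kelley X.
Proof.
have [d [dm dpos dM]] := metric_exists HF Hq; exists d; split=> // K p pn [K0 clK cK] Kp pnp.
pose good m z := exists x, [/\ thread x, q x = z & shadow K (x m)].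
have exL z b : exists L, [/\ subcontinuum L, L z & forall m, (m <= b)%N -> good m z -> close m K L].
  have top m : good m z -> exists L, [/\ subcontinuum L, L z &
      forall m', (m' <= m)%N -> good m' z -> close m' K L].
    move=> [x [hx <- Kx]]; have [L [h1 h2 h3]] := confluent_subcontinuum cK hx Kx.
    by exists L; split=> // m' mm' _; exact: (close_weaken mm' h3).
  elim: b => [|b [L [h1 h2 h3]]].
    have [/top//|ng] := pselect (good 0%N z).
    exists [set z]; split=> //; last by move=> m; rewrite leqn0 => /eqP ->.
    split; [by exists z| |exact: connected1].
    exact/accessible_closed_set1/hausdorff_accessible/(X_hausdorff HF Hq).
  have [/top//|ng] := pselect (good b.+1 z).
  exists L; split=> // m; rewrite leq_eqVlt => /predU1P[-> //|]; rewrite ltnS; exact: h3.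
have ex n : exists L, [/\ subcontinuum L, L (pn n) &
    forall m, (m <= n)%N -> good m (pn n) -> close m K L] by exact: exL.
have [Kn KnP] := choice ex; exists Kn; split; first by move=> n; case: (KnP n).
move=> e e0; have [m hm] := dM e e0.
have [N _ hN] : nbhs \oo [set n | good m (pn n)].
  (* The points with a representative off the shadow form a closed set that misses [p]. *)
  have : nbhs p (~` qimg (fun x => ~ shadow K (x m))).
    apply: open_nbhs_nbhs; split.
      rewrite openC; apply: (closed_img Hq).
      exact: (@tclosed_coord _ _ m (fun u => ~ shadow K u)).
    by case=> x [hx nK xp]; apply: nK; exists x; rewrite xp.
  move/pnp => /= near; have : nbhs \oo (pn @^-1` (~` qimg (fun x => ~ shadow K (x m)))) by exact: near.
  apply: filterS => n /= h; have [x hx xp] := q_surj (pn n).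
  exists x; split=> //; apply: contrapT => nK; apply: h; by exists x.
exists (maxn N m) => n; rewrite geq_max => /andP[Nn mn].
case: (KnP n) => _ _ /(_ m mn (hN n Nn))[h1 h2]; split.
  by move=> z /h1[y [k [hy hk <- Kk yk]]]; exists (q k) => //; exact: hm.
move=> z Kz; have [k hk kz] := q_surj z; subst z.
by have [y [hy Ly yk]] := h2 k hk Kz; exists (q y) => //; exact: hm.
Qed.

(** A point of a fork has a representative below one of the two ends, and the hypothesis identifies
    it with that end. *)
Lemma endpoint_criterion p :
  (forall x z, thread x -> thread z -> q x = p -> x <<~ z -> lim_edge x z) -> endpoint p.
Proof.
move=> h A a b arcA Ap; have [x hx xa] := q_surj a; have [y hy yb] := q_surj b; subst a b.
have [c [hc cx cy eA]] := arc_fork HF Hq hx hy arcA.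
move: Ap; rewrite eA => -[[u [hu [_ ux] up]]|[u [hu [_ uy] up]]]; [left|right].
  by rewrite -up; apply/q_eq => //; apply: h up ux.
by rewrite -up; apply/q_eq => //; apply: h up uy.
Qed.

(** A new leaf over [x m] is covered by some level [F k]; a thread of maximal vertices over it is
    maximal in the order and stays in the given neighbourhood of [q x]. *)
Lemma dense_endpoints : closure [set p : X | endpoint p] = [set: X].
Proof.
apply/seteqP; split=> // z _ V; rewrite nbhsE => -[U [oU Uz] UV].
have [x hx xz] := q_surj z; subst z.
have [m hm] := (q_open U).1 oU x hx Uz.
have [B [g [l [gS gl leaf]]]] := leaf_add_exists (x m) (F_TC HF m).
have [k [h [mk hS hE]]] := amalgam HF gS m; have hM := sstar_tree_map hS.
have [v0 hv0] := tm_surj hM l; have [v v0v vleaf] := leaf_above v0 (F_tree HF k).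
have hv : h v = l by apply: leaf; rewrite -hv0; exact: (tm_le hM v0v).
have [n _ u uleaf|e [he ek eleaf]] := thread_from (al := al)
    (P := fun n (u : F n) => forall w, u <~ w -> w = u) _ (v := v) vleaf.
  have [w0 w0u] := tm_surj (bond_map HF n) u; have [w w0w wleaf] := leaf_above w0 (F_tree HF n.+1).
  by exists w => //; apply: uleaf; rewrite -w0u; exact: (tm_le (bond_map HF n) w0w).
have emax y : thread y -> e <<~ y -> y = e.
  move=> hy ey; apply: (thread_eq_cofinal hy he) => N; exists (maxn N k); first exact: leq_maxl.
  exact: (eleaf _ (leq_maxr N k) _ (ey _)).
exists (q e); split; last by apply/UV/hm => //; rewrite (hE _ he) ek hv.
apply: endpoint_criterion => y w hy hw /(q_eq hy he) ye yw.
(* A different representative [y] of the point lies just below [e], and by [edge_above] whatever is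
   above [y] is [y] itself or above [e]. *)
case: (edge_comparable HF hy he ye) => [le|/(emax _ hy) ey]; last first.
  by rewrite ey in yw *; rewrite (emax _ hw yw); exact: (edge_refl HF _).
have [ye'|nye] := pselect (y = e).
  by rewrite ye' in yw *; rewrite (emax _ hw yw); exact: (edge_refl HF _).
by case: (edge_above HF hy he hw ye le nye yw) => [->|/(emax _ hw) -> //]; exact: (edge_refl HF _).
Qed.

Lemma endpoint_or_ramification (p : X) : endpoint p \/ ramification p.
Proof.
have [|nc] := pselect (forall x z, thread x -> thread z -> q x = p -> x <<~ z -> lim_edge x z).
  by left; exact: endpoint_criterion.
right; have [x [z [hx hz xp xz nxz]]] : exists x z,
    [/\ thread x, thread z, q x = p, x <<~ z & ~ lim_edge x z].
  apply: contrapT => h; apply: nc => x z hx hz xp xz; apply: contrapT => nxz.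
  by apply: h; exists x, z.
have [a [z2 [z3 [[ha h2 h3 ax] [[az az2 az3 nx2 nx3] meet]]]]] := trident HF hx hz xz nxz.
have qa : q a = p by rewrite -xp; apply/q_eq.
(* Transitivity of edges allows the branching point to move from [x] to [a] while the tips remain
   distinct from it. *)
have na w : thread w -> ~ lim_edge x w -> ~ lim_edge a w.
  move=> hw nxw aw; apply: nxw; exact: (edge_trans HF hx ha hw (edge_sym HF ax) aw).
have cap w w' : thread w -> thread w' -> a <<~ w -> a <<~ w' ->
    (forall u, thread u -> u <<~ w -> u <<~ w' -> u <<~ a) ->
    qimg (iv a w) `&` qimg (iv a w') = [set p].
  move=> hw hw' aw aw' mt; apply/seteqP; split=> [v|v ->]; last first.
    by split; exists a; rewrite qa; split=> //; split=> //; exact: xle_refl.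
  move=> [[u [hu [au uw] uv]] [u' [hu' [au' uw'] uv']]] /=.
  have e : lim_edge u u' by apply/q_eq; rewrite ?uv.
  case: (edge_comparable HF hu hu' e) => le.
    by rewrite -uv -qa (xle_anti HF (mt _ hu uw (xle_trans le uw')) au).
  by rewrite -uv' -qa (xle_anti HF (mt _ hu' (xle_trans le uw) uw') au').
exists (qimg (iv a z)), (qimg (iv a z2)), (qimg (iv a z3)); split; split.
- by exists (q a), (q z); apply: iv_arc => //; exact: na.
- by exists (q a), (q z2); apply: iv_arc => //; exact: na.
- by exists (q a), (q z3); apply: iv_arc => //; exact: na.
- by apply: cap => // u hu h h'; apply: meet => //; constructor 1.
- by apply: cap => // u hu h h'; apply: meet => //; constructor 2.
- by apply: cap => // u hu h h'; apply: meet => //; constructor 3.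
Qed.

End Properties.

Theorem theorem8p30 (F : nat -> rtgraph) (al : forall n, F n.+1 -> F n) :
  fraisse_limit al ->
  (forall x y z, thread al x -> thread al y -> thread al z ->
     lim_edge x y -> lim_edge y z -> lim_edge x z) /\
  (forall (X : topologicalType) (q : (forall n, F n) -> X),
     realization al q ->
     [/\ dendroid X, kelley X, smooth X,
         closure [set p : X | endpoint p] = [set: X] &
         forall p : X, endpoint p \/ ramification p]).
Proof.
move=> HF; split; first exact: edge_trans.
move=> X q Hq; split.
- exact: (X_dendroid HF Hq).
- exact: (X_kelley HF Hq).
- exact: (X_smooth HF Hq).
- exact: (dense_endpoints HF Hq).
exact: (endpoint_or_ramification HF Hq).
Qed.
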